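(* Let $X$ be a topological space and let $N\subset\mathcal{M}_s(X)$ be a nonempty analytic set for which there is a countable set $H\subset \mathcal{C}(X,[-1,1])$ such that $|\nu|(X)=\sup\{\nu(h): h\in H\}$ for every $\nu\in N$. Then for every $\mu\in\mathcal{M}_s(X)$ there are a Baire measurable function $g\colon X\to\mathbb{R}$, a Baire set $B\subset X$ and $\lambda\in\mathcal{P}(N)$ such that: (i) $\int_N\|\nu\|\,d\lambda(\nu)<\infty$; (ii) $g(x)=0$ for $x\in B$; (iii) $\int_X|g(x)|\,d|\hat\lambda|(x)<\infty$, where $\hat\lambda\in\mathcal{M}_s(X)$ is the barycenter of $\lambda$; (iv) $|\nu|(B)=0$ for every $\nu\in N$; and (v) for every Baire set $E\subset X$, $$\mu(E)=\mu(E\cap B)+\int_{E\setminus B} g(x)\,d\hat\lambda(x).$$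
   Context: $X$ is an arbitrary topological space. $\mathcal{C}(X,Y)$ is the set of continuous functions $X\to Y$; $\mathcal{C}(X)=\mathcal{C}(X,\mathbb{R})$; $\mathcal{C}_b(X)$ is the set of bounded functions in $\mathcal{C}(X)$. The Baire sets of a topological space are the members of the smallest $\sigma$-algebra with respect to which all continuous real-valued functions are measurable. $\mathcal{M}_s(X)$ is the set of signed (real-valued, countably additive) measures on the Baire sets of $X$. For $\mu\in\mathcal{M}_s(X)$, $\mu(h):=\int_X h\,d\mu$, $|\mu|=\mu^++\mu^-$ is the total variation, where $\mu=\mu^+-\mu^-$ is the Jordan decomposition, and $\|\mu\|:=|\mu|(X)$. $\mathcal{M}_s(X)$ is always equipped with the weak$^*$-topology, i.e. the coarsest topology making all maps $\mu\mapsto\mu(f)$, $f\in\mathcal{C}_b(X)$, continuous. For a topological space $Y$, $\mathcal{P}(Y)$ is the set of probability measures on the Baire sets of $Y$; $\mathcal{P}(N)$ is understood with $N\subset\mathcal{M}_s(X)$ carrying the subspace topology. If $\lambda\in\mathcal{P}(N)$ satisfies $\int\|\nu\|\,d\lambda(\nu)<\infty$, its barycenter is the measure $\hat\lambda\in\mathcal{M}_s(X)$ defined by $\hat\lambda(f)=\int_N \nu(f)\,d\lambda(\nu)$ for all $f\in\mathcal{C}_b(X)$. A multi-valued map $\phi\colon S\to T$ between topological spaces is usco if each value $\phi(s)$ is a compact subset of $T$ and for every open $G\subset T$ the set $\{s\in S:\phi(s)\subset G\}$ is open. For $U\subset S$, $\phi(U):=\bigcup_{u\in U}\phi(u)$.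 A subset of $T$ is analytic if it equals $\phi(P)$ for some Polish space $P$ and some usco map $\phi\colon P\to T$. *)

(* Defs.v *)
From HB Require Import structures.
From mathcomp Require Import all_boot all_order all_algebra.
From mathcomp Require Import all_classical all_reals all_analysis.

Set Implicit Arguments.
Unset Strict Implicit.
Unset Printing Implicit Defensive.

Import Order.TTheory GRing.Theory Num.Theory.
Import numFieldNormedType.Exports.

Local Open Scope classical_set_scope.
Local Open Scope ring_scope.

Definition bounded_continuous (R : realType) (Y : topologicalType)
    (f : Y -> R) : Prop :=
  continuous f /\ exists M : R, forall y, `|f y| <= M.

Definition baire_generators (R : realType) (Y : topologicalType) :
    set (set Y) :=
  \bigcup_(f in [set f : Y -> R | continuous f])
    preimage_set_system [set: Y] f measurable.
Arguments baire_generators : clear implicits.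

(* Measurable types of the library are pointed, hence [ptopologicalType]. *)
Definition baire (R : realType) (Y : ptopologicalType) : Type :=
  g_sigma_algebraType (baire_generators R Y).

HB.instance Definition _ (R : realType) (Y : ptopologicalType) :=
  Measurable.copy (baire R Y) (g_sigma_algebraType (baire_generators R Y)).

Section charge_integral.
Context d (T : measurableType d) (R : realType).
Implicit Types (nu : {charge set T -> \bar R}).

Lemma hahn_sig nu :
  {PN : set T * set T | hahn_decomposition nu PN.1 PN.2}.
Proof.
by apply: cid; have [P [N PN]] := Hahn_decomposition nu; exists (P, N).
Qed.

(* The Jordan decomposition does not depend on the chosen Hahn decomposition. *)
Definition pos_part nu : {finite_measure set T -> \bar R} :=
  jordan_pos (svalP (hahn_sig nu)).

Definition neg_part nu : {finite_measure set T -> \bar R} :=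
  jordan_neg (svalP (hahn_sig nu)).

Definition charge_total_variation nu : {measure set T -> \bar R} :=
  charge_variation (svalP (hahn_sig nu)).

(* Meaningful when [f] is integrable on [D] with respect to
   [charge_total_variation nu]. *)
Definition charge_integral nu (D : set T) (f : T -> R) : R :=
  \int[pos_part nu]_(x in D) f x - \int[neg_part nu]_(x in D) f x.

End charge_integral.

(* A charge is a function on all sets; requiring the value 0 outside of the
   Baire sets ensures that two signed measures that agree on the Baire sets are
   equal. *)
Record signed_measure (R : realType) (X : ptopologicalType) := SignedMeasure {
  charge_of :> {charge set (baire R X) -> \bar R} ;
  charge_of_out : forall A, ~ measurable A -> charge_of A = 0%E }.

HB.instance Definition _ (R : realType) (X : ptopologicalType) :=
  gen_eqMixin (signed_measure R X).
HB.instance Definition _ (R : realType) (X : ptopologicalType) :=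
  gen_choiceMixin (signed_measure R X).

Section weak_star.
Context (R : realType) (X : ptopologicalType).
Implicit Types nu : signed_measure R X.

Definition pairing nu (f : X -> R) : R :=
  charge_integral nu [set: baire R X] f.

Definition variation_norm nu : \bar R :=
  charge_total_variation nu [set: baire R X].

Definition weak_star : Type :=
  sup_topology (fun f : {f : X -> R | bounded_continuous f} =>
    Topological.on
      (initial_topology (fun nu : signed_measure R X => pairing nu (sval f)))).

HB.instance Definition _ := Topological.on weak_star.
HB.instance Definition _ := Topological.copy (signed_measure R X) weak_star.

End weak_star.

Definition usco (S T : topologicalType) (phi : S -> set T) : Prop :=
  (forall s, compact (phi s)) /\
  (forall G : set T, open G -> open [set s | phi s `<=` G]).

(* A Polish space is given by a complete separable metric; only its topology is
   used in [analytic]. [metricType] is not pointed: [P] may be empty. *)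
Definition polish (R : realType) (P : metricType R) : Prop :=
  (exists2 D : set P, countable D & dense D) /\
  (forall F : set_system P, ProperFilter F -> cauchy F -> exists p : P, F --> p).

Definition analytic (R : realType) (T : topologicalType) (A : set T) : Prop :=
  exists (P : metricType R) (phi : P -> set T),
    [/\ polish P, usco phi & A = \bigcup_p phi p].

(* [A] with the subspace topology, pointed by means of [A0]. *)
Definition nonempty_subspace (T : topologicalType) (A : set T)
  (A0 : A !=set0) : Type := set_type A.

HB.instance Definition _ (T : topologicalType) (A : set T) (A0 : A !=set0) :=
  Topological.copy (nonempty_subspace A0) (set_type A).
HB.instance Definition _ (T : topologicalType) (A : set T) (A0 : A !=set0) :=
  isPointed.Build (nonempty_subspace A0)
    (SigSub (mem_set (svalP (cid A0)))).

Section barycenter.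
Context (R : realType) (X : ptopologicalType).
Context (N : set (signed_measure R X)) (N0 : N !=set0).
Implicit Type lam : probability (baire R (nonempty_subspace N0)) R.

(* Meant for [lam] with an integrable [variation_norm]. *)
Definition is_barycenter lam (b : signed_measure R X) : Prop :=
  forall f : X -> R, bounded_continuous f ->
    pairing b f =
    \int[lam]_nu pairing (set_val (nu : nonempty_subspace N0)) f.

End barycenter.

(* Main.v *)
(* Write |nu|(f) = sup_i nu(h_i f), where the h_i enumerate H. Hence nu |-> |nu|(E)
   is Baire measurable on N, and a probability kappa on N with integrable norm has
   a mixture theta_kappa(E) = int |nu|(E) dkappa. By exhaustion there are kappa and
   a Baire set S such that |mu| is dominated by theta_kappa off S, while
   m = |mu| restricted to S is singular to theta_kappa' for all kappa'.

   For delta > 0 let c(A) be the infimum of int (1 - f)^2 dm over the Baire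
   functions f with values in [0,1] such that |nu|(f) <= delta for all nu in A. By
   the parallelogram identity c is continuous along increasing sequences. If
   c(N) > a > 0, then, as in Choquet's capacitability theorem, N being analytic
   contains a decreasing sequence of sets M_k with c(M_k) > a that behaves like a
   compact set: whenever open sets increase to N, one of them contains some M_k.
   A minimax argument (Hahn-Banach, and Daniell's construction to represent the
   functional by a measure) then yields kappa' with
   theta_kappa'(E) / delta + m(~E) / a >= 1 for all E, against singularity. So
   c(N) = 0 for all delta, and Borel-Cantelli gives a Baire set B with m(~B) = 0
   and |nu|(B) = 0 for all nu in N.

   The barycenter of kappa itself may be too small, since different nu can cancel.
   Cut N into countably many pieces, on each of which a single h_i nearly norms all
   nu. The barycenters of kappa on the pieces have densities s_n with respect to
   theta_kappa, which vanish simultaneously only on a null set. For suitable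
   c_n > 0 the sum of the c_n s_n vanishes only there, so the normalization lambda
   of the sum of the c_n kappa|A_n has theta_kappa << |hat lambda|. Finally g is
   the Radon-Nikodym density of mu off B with respect to |hat lambda|, with its
   sign changed on the negative set of hat lambda. *)

Require Import Defs.
From HB Require Import structures.
From mathcomp Require Import all_boot all_order all_algebra.
From mathcomp Require Import all_classical all_reals all_analysis.
From mathcomp Require Import measurable_realfun.
From mathcomp Require Import ring lra.

Set Implicit Arguments.
Unset Strict Implicit.
Unset Printing Implicit Defensive.

Import Order.TTheory GRing.Theory Num.Theory.
Import numFieldNormedType.Exports.

Local Open Scope classical_set_scope.
Local Open Scope ring_scope.

(** * The Hahn-Banach theorem *)

Definition sublinear_on (R : realType) (V : lmodType R) (B : set V)
    (p : V -> R) :=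
  (forall x y, B x -> B y -> p (x + y) <= p x + p y) /\
  (forall t x, 0 < t -> B x -> p (t *: x) <= t * p x).

Section hahn_banach.
Context (R : realType) (V : lmodType R) (B : set V).
Hypotheses (BD : forall x y, B x -> B y -> B (x + y))
  (BZ : forall t x, B x -> B (t *: x)).

Lemma sublinear_onZ (p : V -> R) t x : sublinear_on B p -> 0 < t -> B x ->
  p (t *: x) = t * p x.
Proof.
move=> [_ pZ] t0 Bx; apply/eqP; rewrite eq_le pZ//=.
have := pZ t^-1 _ _ (BZ t Bx); rewrite invr_gt0 => /(_ t0).
by rewrite scalerA mulVf ?gt_eqF// scale1r ler_pdivlMl.
Qed.

Lemma sublinear_on0 (p : V -> R) : sublinear_on B p -> B 0 -> p 0 = 0.
Proof.
move=> sp B0; have := sublinear_onZ sp (ltr0n R 2) B0.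
by rewrite scaler0; lra.
Qed.

Lemma sublinear_onN (p : V -> R) x : sublinear_on B p -> B x -> - p (- x) <= p x.
Proof.
move=> sp Bx; have BNx : B (- x) by rewrite -scaleN1r; exact: BZ.
have B0 : B 0 by rewrite -(scale0r x); exact: BZ.
have := sp.1 _ _ Bx BNx; rewrite subrr sublinear_on0//; lra.
Qed.

Lemma minimal_sublinear_additive (p : V -> R) : sublinear_on B p ->
  (forall p' : V -> R, sublinear_on B p' -> (forall x, B x -> p' x <= p x) ->
    forall x, B x -> p x <= p' x) ->
  forall x y, B x -> B y -> p (x + y) = p x + p y.
Proof.
move=> sp minp x y Bx By; apply/eqP; rewrite eq_le sp.1//=.
pose E z := [set p (z + t *: y) - t * p y | t in [set t : R | 0 <= t]].
pose p' z := inf (E z).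
have lbE z : B z -> lbound (E z) (- p (- z)).
  move=> Bz _ [t/= t0 <-].
  have BNz : B (- z) by rewrite -scaleN1r; exact: BZ.
  have := sp.1 _ _ (BD Bz (BZ t By)) BNz; rewrite addrAC subrr add0r.
  have /predU1P[<-|{}t0] : (0 == t) || (0 < t) by rewrite -le_eqVlt.
    by rewrite !scale0r addr0 mul0r subr0 => _; exact: sublinear_onN.
  by rewrite sublinear_onZ//; lra.
have hE z : B z -> has_inf (E z).
  move=> Bz; split; last by exists (- p (- z)); exact: lbE.
  by exists (p (z + 0 *: y) - 0 * p y), 0 => /=.
have p'le z t : B z -> 0 <= t -> p' z <= p (z + t *: y) - t * p y.
  by move=> Bz t0; apply: ge_inf; [exact: (hE _ Bz).2|exists t].
have sp' : sublinear_on B p'.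
  split=> [a b Ba Bb|t a t0 Ba].
    rewrite -lerBlDr; apply: lb_le_inf; first exact: (hE a Ba).1.
    move=> _ [s/= s0 <-]; rewrite lerBlDr -lerBlDl.
    apply: lb_le_inf; first exact: (hE b Bb).1.
    move=> _ [u/= u0 <-]; rewrite lerBlDl.
    apply: (le_trans (p'le _ (s + u) (BD Ba Bb) (addr_ge0 s0 u0))).
    have := sp.1 _ _ (BD Ba (BZ s By)) (BD Bb (BZ u By)).
    by rewrite addrACA -scalerDl; lra.
  rewrite -ler_pdivrMl//; apply: lb_le_inf; first exact: (hE a Ba).1.
  move=> _ [s/= s0 <-]; rewrite ler_pdivrMl//.
  apply: (le_trans (p'le _ (t * s) (BZ t Ba) (mulr_ge0 (ltW t0) s0))).
  rewrite -scalerA -scalerDr sublinear_onZ//; last exact/BD/BZ.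
  by rewrite mulrBr mulrA.
have := minp _ sp' _ _ Bx => /(_ _)/le_trans.
move=> /(_ _ _ (p'le _ 1 Bx ler01)); rewrite scale1r mul1r => h.
by rewrite -lerBrDr; apply: h => z Bz; have := p'le _ 0 Bz (lexx _);
  rewrite scale0r addr0 mul0r subr0.
Qed.

Lemma hahn_banach_sublinear (q : V -> R) : sublinear_on B q ->
  exists p : V -> R, [/\ forall x, B x -> p x <= q x,
    forall x y, B x -> B y -> p (x + y) = p x + p y &
    forall t x, B x -> p (t *: x) = t * p x].
Proof.
move=> sq.
pose P (p : V -> R) := sublinear_on B p /\ forall x, B x -> p x <= q x.
pose S := {p : V -> R | P p}.
pose le_S (p p' : S) := `[< forall x, B x -> sval p' x <= sval p x >].
have q_S : P q by [].
have [||A totA|[p [sp pq]] maxp] := @ZL_preorder S (exist P q q_S) le_S.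
- by move=> p; apply/asboolP => x.
- move=> p1 p2 p3 /asboolP h /asboolP h'; apply/asboolP => x Bx.
  by rewrite (le_trans (h' x Bx))// h.
- have [[p0 Ap0]|A0] := pselect (exists p, A p); last first.
    by exists (exist P q q_S) => p Ap; exfalso; apply: A0; exists p.
  pose E x := [set sval p x | p in A].
  have hE x : B x -> has_inf (E x).
    move=> Bx; split; first by exists (sval p0 x), p0.
    exists (- q (- x)) => _ [p Ap <-].
    have BNx : B (- x) by rewrite -scaleN1r; exact: BZ.
    have := sublinear_onN (svalP p).1 Bx; have := (svalP p).2 _ BNx; lra.
  have le_E p x : A p -> B x -> inf (E x) <= sval p x.
    by move=> Ap Bx; apply: ge_inf; [exact: (hE x Bx).2|exists p].
  suff sE : P (fun x => inf (E x)).
    by exists (exist P _ sE) => p Ap; apply/asboolP => x Bx; exact: le_E.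
  split; last first.
    by move=> x Bx; rewrite (le_trans (le_E p0 _ _ _))//; exact: (svalP p0).2.
  split=> [x y Bx By|t x t0 Bx].
    rewrite -lerBlDr; apply: lb_le_inf; first exact: (hE x Bx).1.
    move=> _ [p Ap <-]; rewrite lerBlDr -lerBlDl.
    apply: lb_le_inf; first exact: (hE y By).1.
    move=> _ [p' Ap' <-]; rewrite lerBlDl.
    have [/asboolP pp'|/asboolP p'p] := totA _ _ Ap Ap'.
      rewrite (le_trans (le_E _ _ Ap' (BD Bx By)))//.
      by rewrite (le_trans ((svalP p').1.1 _ _ Bx By))// lerD2r pp'.
    rewrite (le_trans (le_E _ _ Ap (BD Bx By)))//.
    by rewrite (le_trans ((svalP p).1.1 _ _ Bx By))// lerD2l p'p.
  rewrite -ler_pdivrMl//; apply: lb_le_inf; first exact: (hE x Bx).1.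
  move=> _ [p Ap <-]; rewrite ler_pdivrMl//.
  by rewrite (le_trans (le_E _ _ Ap (BZ t Bx)))//; exact: (svalP p).1.2.
- have pD x y : B x -> B y -> p (x + y) = p x + p y.
    move=> Bx By; move: x y Bx By; apply: minimal_sublinear_additive => // p' sp' p'p.
    have p'q : P p'.
      by split=> // x Bx; rewrite (le_trans (p'p x Bx))// pq.
    by have /asboolP := maxp (exist P p' p'q) (introT (asboolP _) p'p).
  exists p; split=> // t x Bx.
  have B0 : B 0 by rewrite -(scale0r x); exact: BZ.
  have p0 := sublinear_on0 sp B0.
  have [t0|t0|<-] := ltgtP 0 t; last by rewrite scale0r mul0r.
    exact: sublinear_onZ.
  have := pD _ _ (BZ t Bx) (BZ (- t) Bx).
  rewrite (sublinear_onZ (t := - t) sp _ Bx) ?oppr_gt0// scaleNr subrr p0 mulNr => /eqP.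
  by rewrite eq_sym subr_eq0 => /eqP.
Qed.

End hahn_banach.

(** * Bounded continuous functions and Baire sets *)

Section bounded_continuous_theory.
Context (R : realType) (Y : topologicalType).
Implicit Types f g : Y -> R.

Lemma bounded_continuous_cst (c : R) :
  bounded_continuous (fun _ : Y => c).
Proof. by split; [exact: cst_continuous|exists `|c|]. Qed.

Lemma bounded_continuousD f g : bounded_continuous f -> bounded_continuous g ->
  bounded_continuous (fun y => f y + g y).
Proof.
move=> [cf [A fA]] [cg [B gB]]; split.
  by move=> y; apply: cvgD; [exact: cf|exact: cg].
by exists (A + B) => y; rewrite (le_trans (ler_normD _ _))// lerD.
Qed.

Lemma bounded_continuousM f g : bounded_continuous f -> bounded_continuous g ->
  bounded_continuous (fun y => f y * g y).
Proof.
move=> [cf [A fA]] [cg [B gB]]; split.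
  by move=> y; apply: cvgM; [exact: cf|exact: cg].
by exists (A * B) => y; rewrite normrM ler_pM.
Qed.

Lemma bounded_continuousZ (c : R) f : bounded_continuous f ->
  bounded_continuous (fun y => c * f y).
Proof. by move=> bf; apply: bounded_continuousM => //; exact: bounded_continuous_cst. Qed.

Lemma bounded_continuousB f g : bounded_continuous f -> bounded_continuous g ->
  bounded_continuous (fun y => f y - g y).
Proof.
move=> bf bg; rewrite (_ : (fun _ => _) = fun y => f y + (-1) * g y); last first.
  by apply/funext => y; rewrite mulN1r.
by apply: bounded_continuousD => //; exact: bounded_continuousZ.
Qed.

Lemma bounded_continuous_min f g :
  bounded_continuous f -> bounded_continuous g ->
  bounded_continuous (fun y => Num.min (f y) (g y)).
Proof.
move=> [cf [A fA]] [cg [B gB]]; split.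
  by move=> y; apply: (@continuous_min _ _ f g y); [exact: cf|exact: cg].
exists (Num.max A B) => y; rewrite le_max; case: (leP (f y) (g y)) => _.
  by rewrite fA.
by rewrite gB orbT.
Qed.

Lemma bounded_continuous_clip f (a b : R) : continuous f -> a <= b ->
  bounded_continuous (fun y => Num.min b (Num.max a (f y))).
Proof.
move=> cf ab; split.
  move=> y; apply: (@continuous_min _ _ (cst b) (fun y => Num.max a (f y)) y).
    exact: cst_continuous.
  apply: (@continuous_max _ _ (cst a) f y); [exact: cst_continuous|exact: cf].
exists (`|a| + `|b|) => y.
have : a <= Num.min b (Num.max a (f y)) by rewrite le_min ab le_max lexx.
have : Num.min b (Num.max a (f y)) <= b by rewrite ge_min lexx.
have := ler_norm b; have := ler_norm (- a); rewrite normrN ler_norml.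
by have := normr_ge0 a; have := normr_ge0 b; lra.
Qed.

Lemma bounded_continuous_sum (u : nat -> Y -> R) n :
  (forall k, bounded_continuous (u k)) ->
  bounded_continuous (fun y => \sum_(k < n) u k y).
Proof.
move=> bu; elim: n => [|n ih].
  under eq_fun do rewrite big_ord0.
  exact: bounded_continuous_cst.
under eq_fun do rewrite big_ord_recr/=.
exact: bounded_continuousD.
Qed.

End bounded_continuous_theory.

Section baire_sigma_algebra.
Context (R : realType) (Y : ptopologicalType).

Definition cozero_sets : set (set Y) :=
  [set [set y | 0 < f y] | f in
    [set f : Y -> R | continuous f /\ forall y, 0 <= f y <= 1]].

Lemma baire_cozeroE : @measurable _ (baire R Y) = <<s cozero_sets >>.
Proof.
apply/seteqP; split; apply: smallest_sub.
- exact: smallest_sigma_algebra.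
- move=> A [f cf [M mM <-]].
  pose F : g_sigma_algebraType cozero_sets -> R := f.
  suff mF : measurable_fun [set: g_sigma_algebraType cozero_sets] F.
    exact: (mF measurableT M mM).
  apply: (measurability _ (RGenOInfty.measurableE R)) => _ [_ [x ->] <-].
  rewrite setTI; apply: sub_sigma_algebra.
  exists (fun y => Num.min 1 (Num.max 0 (f y - x))).
    split.
      apply: (bounded_continuous_clip _ ler01).1 => y.
      by apply: cvgB; [exact: cf|exact: cvg_cst].
    by move=> y; rewrite le_min ler01 le_max lexx/= ge_min lexx.
  apply/seteqP; split => y /=; rewrite lt_min ltr01/= lt_max ltxx/= subr_gt0.
    by rewrite in_itv/= andbT.
  by rewrite in_itv/= andbT.
- exact: sigma_algebra_measurable.
- move=> _ [f [cf _] <-]; apply: sub_sigma_algebra.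
  exists f => //; exists `]0, +oo[%classic; first exact: measurable_itv.
  by rewrite setTI; apply/seteqP; split => y /=; rewrite in_itv/= andbT.
Qed.

Lemma setI_closed_cozero : setI_closed cozero_sets.
Proof.
move=> _ _ [f [cf f01] <-] [g [cg g01] <-].
exists (fun y => Num.min (f y) (g y)).
  split; first by move=> y; apply: (@continuous_min _ _ f g y);
    [exact: cf|exact: cg].
  move=> y; have /andP[f0 f1] := f01 y; have /andP[g0 g1] := g01 y.
  by rewrite le_min f0 g0 ge_min f1.
by apply/seteqP; split => y /=; rewrite lt_min => /andP.
Qed.

Lemma continuous_baire_measurable (f : Y -> R) : continuous f ->
  measurable_fun [set: baire R Y] (f : baire R Y -> R).
Proof.
move=> cf _ M mM; apply: sub_sigma_algebra.
by exists f => //; exists M => //; rewrite setTI.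
Qed.

End baire_sigma_algebra.

(** * Daniell's extension of positive functionals *)

Lemma mnormalize1 d (T : measurableType d) (R : realType)
    (m : {measure set T -> \bar R}) (P : probability T R) A :
  m setT = 1%E -> mnormalize m P A = m A.
Proof.
move=> m1; suff -> : mnormalize m P = m by [].
apply/funext => B; rewrite /mnormalize m1 onee_eq0.
by rewrite -[LHS]/(m B * (1^-1)%:E)%E invr1 mule1.
Qed.

Section daniell.
Context (R : realType) (Y : ptopologicalType) (L : (Y -> R) -> R).
Local Notation Cb := (@bounded_continuous R Y).
Hypothesis LD : forall f g, Cb f -> Cb g ->
  L (fun y => f y + g y) = L f + L g.
Hypothesis LZ : forall t f, Cb f -> L (fun y => t * f y) = t * L f.
Hypothesis L_ge0 : forall f, Cb f -> (forall y, 0 <= f y) -> 0 <= L f.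
Hypothesis L1 : L (fun _ => 1) = 1.
Hypothesis L_sigma : forall (u : nat -> Y -> R) (c : R),
  (forall n, Cb (u n)) -> (forall y, nondecreasing_seq (u ^~ y)) ->
  (forall y, exists n, c < u n y) -> exists n, c <= L (u n).

Lemma functionalB f g : Cb f -> Cb g -> L (fun y => f y - g y) = L f - L g.
Proof.
move=> bf bg; rewrite -(mulN1r (L g)) -LZ// -LD//; last exact: bounded_continuousZ.
by congr L; apply/funext => y; rewrite mulN1r.
Qed.

Lemma le_functional f g : Cb f -> Cb g -> (forall y, f y <= g y) -> L f <= L g.
Proof.
move=> bf bg fg; rewrite -subr_ge0 -functionalB//; apply: L_ge0.
  exact: bounded_continuousB.
by move=> y; rewrite subr_ge0.
Qed.

Lemma functional_sum (u : nat -> Y -> R) n : (forall k, Cb (u k)) ->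
  L (fun y => \sum_(k < n) u k y) = \sum_(k < n) L (u k).
Proof.
move=> bu; elim: n => [|n ih].
  rewrite big_ord0 -[RHS](mul0r (L (fun=> 1))) -LZ; last exact: bounded_continuous_cst.
  by congr L; apply/funext => y; rewrite big_ord0 mul0r.
rewrite big_ord_recr/= -ih -LD//; last exact: bounded_continuous_sum.
by congr L; apply/funext => y; rewrite big_ord_recr.
Qed.

(* [inf {c | cover A c}] is the outer measure of [A] induced by [L]. *)
Let cover (A : set Y) (c : R) := exists u : nat -> Y -> R,
  [/\ forall n, Cb (u n) /\ forall y, 0 <= u n y,
      forall y, nondecreasing_seq (u ^~ y),
      forall n, L (u n) <= c &
      forall y, A y -> forall e, e < 1 -> exists n, e < u n y].

Let cover_ge0 A c : cover A c -> 0 <= c.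
Proof.
by move=> [u [bu _ uc _]]; have [? ?] := bu 0%N; rewrite (le_trans _ (uc 0%N))// L_ge0.
Qed.

Let cover1 A : cover A 1.
Proof.
exists (fun _ _ => 1); split=> [n|y|n|y _ e e1].
- by split=> //; exact: bounded_continuous_cst.
- by move=> ? ? _; exact: lexx.
- by rewrite L1.
- by exists 0%N.
Qed.

Let has_inf_cover A : has_inf (cover A).
Proof. by split; [exists 1|exists 0 => c /cover_ge0]. Qed.

Let cover_le A B c : A `<=` B -> cover B c -> cover A c.
Proof. by move=> AB [u [? ? ? uB]]; exists u; split=> // y /AB /uB. Qed.

Let w A : R := inf (cover A).

Let w_le A c : cover A c -> w A <= c.
Proof. by move=> Ac; apply: ge_inf => //; exact: (has_inf_cover A).2. Qed.

Let w_ge A c : (forall x, cover A x -> c <= x) -> c <= w A.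
Proof. by move=> Ac; apply: lb_le_inf => //; exact: (has_inf_cover A).1. Qed.

Let w0 : w set0 = 0.
Proof.
apply/eqP; rewrite eq_le; apply/andP; split; last by apply: w_ge => x /cover_ge0.
apply: w_le; exists (fun _ _ => 0); split=> [n|y|n|//].
- by split=> //; exact: bounded_continuous_cst.
- by move=> ? ? _; exact: lexx.
rewrite -[leRHS](mul0r (L (fun=> 1))) -LZ; last exact: bounded_continuous_cst.
by rewrite mul0r.
Qed.

Let w_sigma_subadditive : sigma_subadditive (fun A => (w A)%:E).
Proof.
move=> F /=; set S := (X in (_ <= X)%E).
have S0 : (0 <= S)%E by apply: nneseries_ge0 => n _ _; rewrite lee_fin; apply: w_ge => x /cover_ge0.
have [->|Soo] := eqVneq S +oo%E; first exact: leey.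
have Sfin : S \is a fin_num by rewrite ge0_fin_numE// lt_neqAle Soo leey.
apply/lee_addgt0Pr => e e0.
have e2 k : 0 < e / (2 ^ k.+1)%:R by rewrite divr_gt0// ltr0n expn_gt0.
have /choice[u uP] : forall k, exists u : nat -> Y -> R,
  [/\ forall n, Cb (u n) /\ forall y, 0 <= u n y,
      forall y, nondecreasing_seq (u ^~ y),
      forall n, L (u n) <= w (F k) + e / (2 ^ k.+1)%:R &
      forall y, F k y -> forall e, e < 1 -> exists n, e < u n y].
  move=> k; have [c [u [bu ndu uc uF]] /ltW ce] := inf_adherent (e2 k) (has_inf_cover (F k)).
  by exists u; split=> // n; rewrite (le_trans (uc n)).
rewrite /= -(fineK Sfin) -EFinD lee_fin; apply: w_le.
exists (fun n y => \sum_(k < n.+1) u k n y); split=> [n|y|n|y [k _ Fky] a a1].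
- split=> [|y]; first apply: (bounded_continuous_sum (u := fun k => u k n)) => k.
    by have [bu _ _ _] := uP k; exact: (bu n).1.
  by apply: sumr_ge0 => k _; have [bu _ _ _] := uP k; exact: (bu n).2.
- apply/nondecreasing_seqP => n; rewrite [leRHS]big_ord_recr/=.
  rewrite -[leLHS]addr0 lerD//.
    by apply: ler_sum => k _; have [_ ndu _ _] := uP k; apply: ndu.
  by have [bu _ _ _] := uP n.+1; exact: (bu _).2.
- rewrite (functional_sum (u := fun k => u k n)) => [|k]; last first.
    by have [bu _ _ _] := uP k; exact: (bu n).1.
  apply: (@le_trans _ _ (\sum_(k < n.+1) (w (F k) + e / (2 ^ k.+1)%:R))).
    by apply: ler_sum => k _; have [_ _ + _] := uP k; exact.
  rewrite -lee_fin EFinD fineK//.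
  apply: (le_trans _ (epsilon_trick xpredT _ (ltW e0))); last first.
    by move=> k; rewrite lee_fin; apply: w_ge => x /cover_ge0.
  rewrite -sumEFin -(big_mkord xpredT (fun k => (w (F k) + e / (2 ^ k.+1)%:R)%:E)).
  apply: nneseries_lim_ge => k _ _; rewrite lee_fin addr_ge0 ?(ltW (e2 _))//.
  by apply: w_ge => x /cover_ge0.
- have [_ ndu _ uF] := uP k; have [n an] := uF _ Fky _ a1.
  exists (maxn k n).
  have kn : (k < (maxn k n).+1)%N by rewrite ltnS leq_maxl.
  rewrite (bigD1 (Ordinal kn))//= (lt_le_trans an)//.
  rewrite -[leLHS]addr0 lerD//; first by apply: ndu; rewrite leq_maxr.
  by apply: sumr_ge0 => j _; have [bu _ _ _] := uP j; exact: (bu _).2.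
Qed.

Let wE : {om : {outer_measure set Y -> \bar R} | forall A, om A = (w A)%:E}.
Proof.
have h0 : (w set0)%:E = 0%E :> \bar R by rewrite w0.
have hge A : (0 <= (w A)%:E)%E by rewrite lee_fin; apply: w_ge => x /cover_ge0.
have hle : {homo (fun A => (w A)%:E) : A B / A `<=` B >-> (A <= B)%E}.
  by move=> A B AB; rewrite lee_fin; apply: w_ge => x /(cover_le AB)/w_le.
pose om : {outer_measure set Y -> \bar R} := HB.pack (fun A => (w A)%:E)
  (isOuterMeasure.Build R Y _ h0 hge hle w_sigma_subadditive).
by exists om.
Qed.

Let om := sval wE.

Let wU A B : w (A `|` B) <= w A + w B.
Proof. by rewrite -lee_fin EFinD -!(svalP wE); exact: outer_measureU2. Qed.

Let le_w A B : A `<=` B -> w A <= w B.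
Proof. by move=> AB; rewrite -lee_fin -!(svalP wE); exact: le_outer_measure. Qed.

Let ramp (g : Y -> R) (m : nat) y := Num.min 1 (m%:R * g y).

Section cozero.
Variable g : Y -> R.
Hypotheses (cg : continuous g) (g01 : forall y, 0 <= g y <= 1).
Let g_ge0 y : 0 <= g y. Proof. by have /andP[] := g01 y. Qed.

Let bg : Cb g.
Proof. by split=> //; exists 1 => y; rewrite ger0_norm//; have /andP[] := g01 y. Qed.

Let bramp m : Cb (ramp g m).
Proof.
by apply: bounded_continuous_min; [exact: bounded_continuous_cst|exact: bounded_continuousZ].
Qed.

Let ramp_ge0 m y : 0 <= ramp g m y.
Proof. by rewrite le_min ler01 mulr_ge0. Qed.

Let ramp_le1 m y : ramp g m y <= 1. Proof. by rewrite ge_min lexx. Qed.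

Let ramp_nd y : nondecreasing_seq (ramp g ^~ y).
Proof.
move=> m n mn; rewrite /ramp le_min !ge_min lexx/=; apply/orP; right.
by rewrite ler_wpM2r// ler_nat.
Qed.

Let V := sup [set L (ramp g m) | m in [set: nat]].

Let has_sup_V : has_sup [set L (ramp g m) | m in [set: nat]].
Proof.
split; first by exists (L (ramp g 0)), 0%N.
by exists 1 => _ [m _ <-]; rewrite -L1; apply: le_functional => //; exact: bounded_continuous_cst.
Qed.

Let shell k : w [set y | 0 < g y /\ (2 * k)%:R * g y < 1] <= 2 * (V - L (ramp g k)).
Proof.
apply: w_le; exists (fun n y => 2 * (ramp g (n + k) y - ramp g k y)).
split=> [n|y n m nm|n|y /= [gy0 kgy] e e1].
- split=> [|y]; first exact/bounded_continuousZ/bounded_continuousB.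
  by rewrite mulr_ge0// subr_ge0 ramp_nd// leq_addl.
- by rewrite ler_pM2l// lerD2r ramp_nd// leq_add2r.
- rewrite LZ; last exact: bounded_continuousB.
  rewrite ler_pM2l// functionalB// lerD2r; apply: ub_le_sup; first exact: has_sup_V.2.
  by exists (n + k)%N.
- exists (Num.truncn (g y)^-1).+1.
  have h1 : 1 <= ((Num.truncn (g y)^-1).+1 + k)%:R * g y.
    rewrite -ler_pdivrMr// div1r natrD ler_wpDr//.
    exact/ltW/truncnS_gt.
  have h2 : k%:R * g y < 1/2 by move: kgy; rewrite natrM; lra.
  by rewrite /ramp min_l// min_r ?(ltW (lt_trans h2 _))//; lra.
Qed.

Lemma daniell_caratheodory_cozero : om.-caratheodory [set y | 0 < g y].
Proof.
apply: le_caratheodory_measurable => A; rewrite /om !(svalP wE) -EFinD lee_fin.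
set U := [set y | _].
apply: w_ge => c [u [bu ndu uc uA]].
apply/ler_addgt0Pr => e e0.
have e2 : 0 < e / 2 by rewrite divr_gt0.
have [_ [k _ <-] Vk] := sup_adherent e2 has_sup_V.
have sh : w [set y | 0 < g y /\ (2 * k)%:R * g y < 1] <= e.
  by rewrite (le_trans (shell k))//; rewrite -/V in Vk; lra.
pose v := ramp g (2 * k).
have bv : Cb v by exact: bramp.
pose u1 n y := u n y * v y; pose u2 n y := u n y * (1 - v y).
have v01 y : 0 <= v y <= 1 by rewrite /v ramp_ge0 ramp_le1.
have bv' : Cb (fun y => 1 - v y).
  by apply: bounded_continuousB => //; exact: bounded_continuous_cst.
have bu1 n : Cb (u1 n) by apply: bounded_continuousM => //; exact: (bu n).1.
have bu2 n : Cb (u2 n) by apply: bounded_continuousM => //; exact: (bu n).1.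
have ndu1 y : nondecreasing_seq (u1 ^~ y).
  by move=> n m nm; rewrite ler_wpM2r ?ndu//; have /andP[] := v01 y.
have ndu2 y : nondecreasing_seq (u2 ^~ y).
  by move=> n m nm; rewrite ler_wpM2r ?ndu// subr_ge0; have /andP[] := v01 y.
have u12 n m : L (u1 n) + L (u2 m) <= c.
  apply: le_trans (uc (maxn n m)); rewrite -LD//.
  apply: le_functional; [exact: bounded_continuousD|exact: (bu _).1|move=> y].
  apply: (@le_trans _ _ (u1 (maxn n m) y + u2 (maxn n m) y)).
    by rewrite lerD// ?ndu1 ?ndu2// ?leq_maxl ?leq_maxr.
  by rewrite /u1 /u2; lra.
pose E1 := [set L (u1 n) | n in [set: nat]].
have supE1 : has_sup E1.
  split; first by exists (L (u1 0%N)), 0%N.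
  exists (c - L (u2 0%N)) => _ [n _ <-]; have := u12 n 0%N; lra.
have u2c m : L (u2 m) <= c - sup E1.
  rewrite lerBrDr -lerBrDl; apply: ge_sup; first exact: supE1.1.
  by move=> _ [n _ <-]; have := u12 n m; lra.
have wD : w (A `&` ~` U) <= c - sup E1.
  apply: w_le; exists u2; split=> // [n|y [Ay] /negP Uy a a1].
    split=> // y; rewrite mulr_ge0 ?(bu n).2// subr_ge0.
    by have /andP[] := v01 y.
  have [n an] := uA y Ay a a1; exists n; rewrite /u2 /v /ramp.
  have -> : g y = 0 by apply/eqP; rewrite eq_le g_ge0 andbT leNgt.
  by rewrite mulr0 min_r// subr0 mulr1.
have wI : w (A `&` [set y | 1 <= (2 * k)%:R * g y]) <= sup E1.
  apply: w_le; exists u1; split=> // [n|n|y [Ay]/= gy a a1].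
  - by split=> // y; rewrite mulr_ge0 ?(bu n).2//; have /andP[] := v01 y.
  - by apply: ub_le_sup; [exact: supE1.2|exists n].
  - by have [n an] := uA y Ay a a1; exists n; rewrite /u1 /v /ramp min_l ?mulr1.
have : w (A `&` U) <= w (A `&` [set y | 1 <= (2 * k)%:R * g y]) +
    w [set y | 0 < g y /\ (2 * k)%:R * g y < 1].
  apply: le_trans (wU _ _); apply: le_w => y [Ay Uy] /=.
  by have [gy|gy] := leP 1 ((2 * k)%:R * g y); [left|right].
lra.
Qed.

End cozero.

Let caratheodory_baire (A : set Y) : @measurable _ (baire R Y) A ->
  om.-caratheodory A.
Proof.
rewrite baire_cozeroE; move: A.
apply: (@smallest_sub _ _ _ [set B | om.-caratheodory B]).
  split=> [|B hB|F hF] /=.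
  - exact: caratheodory_measurable_set0.
  - by rewrite setTD; exact: caratheodory_measurable_setC.
  - exact: caratheodory_measurable_bigcup.
by move=> _ [g [cg g01] <-]; exact: daniell_caratheodory_cozero.
Qed.

Let wT : w setT = 1.
Proof.
apply/eqP; rewrite eq_le w_le//=; apply: w_ge => c [u [bu ndu uc uT]].
apply/ler_addgt0Pr => e e0; rewrite -lerBlDr.
have [n hn] : exists n, 1 - e <= L (u n).
  apply: L_sigma => // [n|y]; first exact: (bu n).1.
  by apply: uT => //; rewrite ltrBlDr ltrDl.
exact: le_trans hn (uc n).
Qed.

Lemma daniell_outer : exists kappa : probability (baire R Y) R,
  forall A : set Y, @measurable _ (baire R Y) A ->
  forall f, Cb f -> (forall y, 0 <= f y) -> (forall y, A y -> 1 <= f y) ->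
  (kappa A <= (L f)%:E)%E.
Proof.
have k0 : om set0 = 0%E by exact: outer_measure0.
have kge A : (0 <= om A)%E by exact: outer_measure_ge0.
have ks : semi_sigma_additive (om : set (baire R Y) -> \bar R).
  move=> F mF tF mUF; apply: (caratheodory_measure_sigma_additive (mu := om)) => //.
    by move=> n; exact: caratheodory_baire.
  exact: caratheodory_baire.
have [k kE] : exists k : {measure set (baire R Y) -> \bar R},
    forall A, k A = om A.
  pose k : {measure set (baire R Y) -> \bar R} :=
    HB.pack (om : set (baire R Y) -> \bar R)
      (isMeasure.Build _ (baire R Y) R _ k0 kge ks).
  by exists k.
have kT : k [set: baire R Y] = 1%E by rewrite kE /om (svalP wE) wT.
pose P : probability (baire R Y) R := point.
exists (mnormalize k P) => A mA f bf f0 fA.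
suff : (k A <= (L f)%:E)%E by rewrite -(mnormalize1 P A kT).
rewrite kE /om (svalP wE) lee_fin; apply: w_le.
exists (fun=> f); split=> [n|y n m _|n|y Ay e e1] //; exists 0%N.
exact: lt_le_trans e1 (fA _ Ay).
Qed.

End daniell.

Section daniell_integral.
Context (R : realType) (Y : ptopologicalType) (L : (Y -> R) -> R).
Local Notation Cb := (@bounded_continuous R Y).
Hypothesis LD : forall f g, Cb f -> Cb g ->
  L (fun y => f y + g y) = L f + L g.
Hypothesis LZ : forall t f, Cb f -> L (fun y => t * f y) = t * L f.
Hypothesis L_ge0 : forall f, Cb f -> (forall y, 0 <= f y) -> 0 <= L f.
Hypothesis L1 : L (fun _ => 1) = 1.
Hypothesis L_sigma : forall (u : nat -> Y -> R) (c : R),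
  (forall n, Cb (u n)) -> (forall y, nondecreasing_seq (u ^~ y)) ->
  (forall y, exists n, c < u n y) -> exists n, c <= L (u n).

Section layers.
Variable kappa : probability (baire R Y) R.
Hypothesis kappaL : forall A : set Y, @measurable _ (baire R Y) A ->
  forall f, Cb f -> (forall y, 0 <= f y) -> (forall y, A y -> 1 <= f y) ->
  (kappa A <= (L f)%:E)%E.

Lemma daniell_integral_le f : Cb f -> (forall y, 0 <= f y) ->
  (\int[kappa]_y (f y)%:E <= (L f)%:E)%E.
Proof.
move=> bf f0; apply/lee_addgt0Pr => e e0.
have [cf [C fC]] := bf.
pose N := (Num.truncn (C / e)).+1.
have CN : C <= N%:R * e.
  by rewrite -ler_pdivrMr//; exact/ltW/truncnS_gt.
pose G j y := Num.min (f y) (j.+1%:R * e) - Num.min (f y) (j%:R * e).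
have GE n y : \sum_(j < n) G j y = Num.min (f y) (n%:R * e).
  rewrite -(big_mkord xpredT (G ^~ y)) telescope_sumr// mul0r.
  by rewrite [X in _ - X]min_r ?subr0.
have bG j : Cb (G j).
  by apply: bounded_continuousB; apply: bounded_continuous_min => //;
    exact: bounded_continuous_cst.
have Sj j : j.+1%:R * e = j%:R * e + e by rewrite -natr1 mulrDl mul1r.
have G_ge0 j y : 0 <= G j y.
  rewrite subr_ge0 le_min ge_min lexx/= ge_min Sj.
  by apply/orP; right; rewrite lerDl ltW.
pose A j := [set y : baire R Y | j.+1%:R * e <= f y].
have mA j : measurable (A j).
  have := @continuous_baire_measurable R Y f cf measurableT
    `[j.+1%:R * e, +oo[%classic (measurable_itv _).
  by rewrite setTI; congr measurable; apply/seteqP; split => y /=; rewrite in_itv/= andbT.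
have GA j y : G j.+1 y <= e * \1_(A j) y.
  rewrite indicE; case: (boolP (y \in A j)) => yA.
    rewrite mulr1 /G Sj; have [h|h] := leP (f y) (j.+1%:R * e).
      by rewrite (min_l (ltW (le_lt_trans h _))) ?subrr ?(ltW e0)// ltrDl.
    by rewrite lerBlDl ge_min lexx orbT.
  rewrite mulr0 /G; have : f y < j.+1%:R * e.
    by rewrite ltNge; apply: contra yA => h; exact/mem_set.
  move=> h; rewrite (min_l (ltW h)) min_l ?subrr// Sj (le_trans (ltW h))//.
  by rewrite lerDl ltW.
have fle y : f y <= e + \sum_(j < N) e * \1_(A j) y.
  have -> : f y = \sum_(j < N.+1) G j y.
    rewrite GE min_l// Sj (le_trans (ler_norm _))// (le_trans (fC y))//.
    by rewrite (le_trans CN)// lerDl ltW.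
  rewrite big_ord_recl lerD//; last by apply: ler_sum => j _; exact: GA.
  by rewrite /G /= mul1r mul0r [X in _ - X]min_r ?subr0// ge_min lexx orbT.
have m1 j : measurable_fun [set: baire R Y] (fun y => e * \1_(A j) y).
  by apply: measurable_funM => //; exact: measurable_indic.
apply: (@le_trans _ _ (\int[kappa]_y (e%:E + \sum_(j < N) (e * \1_(A j) y)%:E))%E).
  apply: ge0_le_integral => //.
  - by move=> y _; rewrite lee_fin.
  - by apply/measurable_EFinP; exact: (continuous_baire_measurable cf).
  - apply: emeasurable_funD => //; apply: emeasurable_sum => j.
    exact/measurable_EFinP.
  - by move=> y _; rewrite sumEFin -EFinD lee_fin.
have e1A j y : (0 <= (e * \1_(A j) y)%:E)%E by rewrite lee_fin mulr_ge0 ?(ltW e0)// indicE ler0n.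
rewrite ge0_integralD//=; last first.
- by apply: emeasurable_sum => j; exact/measurable_EFinP.
- by move=> y _; apply: sume_ge0.
- by move=> y _; rewrite lee_fin ltW.
rewrite integral_cst//= probability_setT mule1 addeC.
rewrite ge0_integral_sum//; last by move=> j; exact/measurable_EFinP.
apply: (@le_trans _ _ ((\sum_(j < N) L (G j))%:E + e%:E)%E).
  rewrite leeD2r// -sumEFin; apply: lee_sum => j _.
  under eq_integral do rewrite EFinM.
  rewrite ge0_integralZl_EFin//; last 2 first.
  - exact/measurable_EFinP/measurable_indic.
  - exact: ltW.
  rewrite integral_indic// setIT -lee_pdivlMl// -EFinM -LZ//.
  apply: kappaL => // [|y|y Ay].
  - exact: bounded_continuousZ.
  - by rewrite mulr_ge0// invr_ge0 ltW.
  - rewrite ler_pdivlMl// mulr1 /G min_r// min_r; first by rewrite Sj addrAC subrr add0r.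
    by rewrite (le_trans _ Ay)// Sj lerDl ltW.
rewrite leeD2r// lee_fin -(functional_sum LD LZ)//.
apply: (le_functional LD LZ L_ge0) => //; first exact: bounded_continuous_sum.
by move=> y; rewrite GE ge_min lexx.
Qed.

End layers.

Theorem daniell_riesz : exists kappa : probability (baire R Y) R,
  forall f, Cb f -> (forall y, 0 <= f y) ->
  (\int[kappa]_y (f y)%:E = (L f)%:E)%E.
Proof.
have [kappa kP] := daniell_outer LD LZ L_ge0 L1 L_sigma.
exists kappa => f bf f0; have kle := daniell_integral_le kP.
apply/eqP; rewrite eq_le kle//=.
have [cf [C fC]] := bf.
have fC' y : 0 <= C - f y by rewrite subr_ge0 (le_trans (ler_norm _)).
have bC : Cb (fun=> C) := bounded_continuous_cst _ _.
have bCf : Cb (fun y => C - f y) := bounded_continuousB bC bf.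
have := kle _ bCf fC'.
rewrite (functionalB LD LZ)// (_ : (fun=> C) = fun _ => C * 1); last first.
  by apply/funext => y; rewrite mulr1.
rewrite LZ ?L1 ?mulr1; last exact: bounded_continuous_cst.
have : (\int[kappa]_y (f y)%:E + \int[kappa]_y (C - f y)%:E = C%:E)%E.
  rewrite -ge0_integralD//=.
  - under eq_integral do rewrite -EFinD subrKC.
    by rewrite integral_cst//= probability_setT mule1.
  - by move=> y _; rewrite lee_fin.
  - by apply/measurable_EFinP; exact: (continuous_baire_measurable cf).
  - by move=> y _; rewrite lee_fin.
  - by apply/measurable_EFinP; exact: (continuous_baire_measurable bCf.1).
have fin h : Cb h -> (forall y, 0 <= h y) ->
    (\int[kappa]_y (h y)%:E)%E \is a fin_num.
  move=> bh h0; rewrite ge0_fin_numE ?(le_lt_trans (kle _ bh h0)) ?ltry//.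
  by apply: integral_ge0 => y _; rewrite lee_fin.
rewrite -(fineK (fin _ bf f0)) -(fineK (fin _ bCf fC')) -EFinD => -[IC].
by rewrite !lee_fin; move: IC; lra.
Qed.

End daniell_integral.

(** * A minimax theorem *)

Section minimax_measure.
Context (R : realType) (Y : ptopologicalType) (M : nat -> set Y)
  (F : set (Y -> R)) (c : R).
Local Notation Cb := (@bounded_continuous R Y).
Hypothesis M_decr : forall k, M k.+1 `<=` M k.
Hypothesis M_compact : forall G : nat -> set Y, (forall n, open (G n)) ->
  (forall y, exists n, G n y) -> (forall n, G n `<=` G n.+1) ->
  exists n k, M k `<=` G n.
Hypothesis F_nonempty : F !=set0.
Hypothesis F_bounded : forall f, F f -> exists C, forall y, M 0 y -> `|f y| <= C.
Hypothesis F_convex : forall f g t, F f -> F g -> 0 <= t <= 1 ->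
  exists2 h, F h & forall y, M 0 y -> h y <= t * f y + (1 - t) * g y.
Hypothesis F_ge : forall f k, F f -> exists2 y, M k y & c <= f y.

Let M_le i j : (i <= j)%N -> M j `<=` M i.
Proof.
move=> ij; rewrite -(subnKC ij); elim: (j - i)%N => [|n ih].
  by rewrite addn0.
by rewrite addnS => y /M_decr /ih.
Qed.

Let V : lmodType R := Y -> R^o.
Let B : set V := [set f | exists C, forall y, M 0 y -> `|f y| <= C].

Let BD (f g : V) : B f -> B g -> B (f + g).
Proof.
move=> [C fC] [D gD]; exists (C + D) => y My.
by apply: (le_trans (ler_normD (f y) (g y))); rewrite lerD ?fC ?gD.
Qed.

Let BZ t (f : V) : B f -> B (t *: f).
Proof.
move=> [C fC]; exists (`|t| * C) => y My.
by rewrite [(t *: f) y]/(t * f y) normrM ler_wpM2l// fC.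
Qed.

Let Bcb f : Cb f -> B f.
Proof. by move=> [_ [C fC]]; exists C. Qed.

(* [inf (E f)] is the sublinear functional [inf_k sup_(M k) f], lowered so that
   a linear functional below it is at least [c] on [F]. *)
Let E (f : V) : set R := [set x | exists k t g, [/\ 0 <= t, F g &
  forall y, M k y -> f y + t * (g y - c) <= x]].

Let q (f : V) := inf (E f).

Let has_inf_E f : B f -> has_inf (E f).
Proof.
move=> [C fC]; split.
  have [g Fg] := F_nonempty.
  exists C, 0%N, 0, g; split=> // y My.
  by rewrite mul0r addr0 (le_trans (ler_norm _))// fC.
exists (- C) => x [k [t [g [t0 Fg fx]]]].
have [y My cg] := F_ge k Fg.
rewrite (le_trans _ (fx _ My))//.
have := fC _ (M_le (leq0n k) My); rewrite ler_norml => /andP[h _].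
by rewrite (le_trans h)// lerDl mulr_ge0// subr_ge0.
Qed.

Let q_le f x : B f -> E f x -> q f <= x.
Proof. by move=> Bf Ex; apply: ge_inf => //; exact: (has_inf_E Bf).2. Qed.

Let sublinear_q : sublinear_on B q.
Proof.
split=> [f g Bf Bg|s f s0 Bf].
  rewrite -lerBlDr; apply: lb_le_inf; first exact: (has_inf_E Bf).1.
  move=> x [k [t [h [t0 Fh fx]]]]; rewrite lerBlDr -lerBlDl.
  apply: lb_le_inf; first exact: (has_inf_E Bg).1.
  move=> x' [k' [t' [h' [t'0 Fh' gx]]]]; rewrite lerBlDl.
  apply: q_le; first exact: BD.
  have [tt0|tt0] := eqVneq (t + t') 0.
    have [t00 t'00] : t = 0 /\ t' = 0 by move: tt0 t0 t'0; lra.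
    exists (maxn k k'), 0, h; split=> // y My.
    have := fx _ (M_le (leq_maxl _ _) My); have := gx _ (M_le (leq_maxr _ _) My).
    rewrite t00 t'00 !mul0r !addr0 => gx' fx'.
    exact: lerD fx' gx'.
  have tt'0 : 0 < t + t' by rewrite lt_neqAle eq_sym tt0 addr_ge0.
  have [|h'' Fh'' hh''] := F_convex (t := t / (t + t')) Fh Fh'.
    by rewrite divr_ge0 ?(ltW tt'0)// ler_pdivrMr// mul1r lerDl.
  exists (maxn k k'), (t + t'), h''; split=> [||y My]; [by rewrite ltW|by []|].
  have := fx _ (M_le (leq_maxl _ _) My); have := gx _ (M_le (leq_maxr _ _) My).
  move=> g' f'; rewrite (le_trans _ (lerD f' g'))//.
  have := hh'' _ (M_le (leq0n _) My).
  rewrite -(ler_pM2l tt'0) mulrDr.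
  have -> : (t + t') * (t / (t + t') * h y) = t * h y by field.
  have -> : (t + t') * ((1 - t / (t + t')) * h' y) = t' * h' y by field.
  have aux (a b u v w : R) : (t + t') * w <= t * u + t' * v ->
      a + b + (t + t') * (w - c) <= a + t * (u - c) + (b + t' * (v - c)) by lra.
  exact: aux.
rewrite -ler_pdivrMl//; apply: lb_le_inf; first exact: (has_inf_E Bf).1.
move=> x [k [t [h [t0 Fh fx]]]]; rewrite ler_pdivrMl//.
apply: q_le; first exact: BZ.
exists k, (s * t), h; split=> [||y My]; [by rewrite mulr_ge0// ltW|by []|].
rewrite [(s *: f) y]/(s * f y) -mulrA -mulrDr ler_pM2l//.
exact: fx.
Qed.

Theorem minimax_measure : exists kappa : probability (baire R Y) R,
  (forall f g k, F f -> Cb g -> (forall y, 0 <= g y) ->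
     (forall y, M k y -> f y <= g y) -> (c%:E <= \int[kappa]_y (g y)%:E)%E) /\
  (forall g C k, Cb g -> (forall y, 0 <= g y) ->
     (forall y, M k y -> g y <= C) -> (\int[kappa]_y (g y)%:E <= C%:E)%E).
Proof.
have [L [Lq LD LZ]] := hahn_banach_sublinear BD BZ sublinear_q.
have L_le k (f : V) x : B f -> (forall y, M k y -> f y <= x) -> L f <= x.
  move=> Bf fx; rewrite (le_trans (Lq _ Bf))// q_le//.
  have [g Fg] := F_nonempty.
  by exists k, 0, g; split=> // y My; rewrite mul0r addr0 fx.
have LN f : B f -> L (- f) = - L f.
  by move=> Bf; rewrite -scaleN1r LZ// mulN1r.
have L_ge k (f : V) x : B f -> (forall y, M k y -> x <= f y) -> x <= L f.
  move=> Bf xf; rewrite -lerN2 -LN//; apply: (L_le k).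
    by rewrite -scaleN1r; exact: BZ.
  by move=> y My; rewrite lerN2 xf.
have B1 (x : R) : B (fun=> x) by exists `|x|.
have L1 (x : R) : L (fun=> x) = x.
  by apply/eqP; rewrite eq_le (L_le 0%N)//= (L_ge 0%N).
have L_sigma (u : nat -> Y -> R) (d : R) :
    (forall n, Cb (u n)) -> (forall y, nondecreasing_seq (u ^~ y)) ->
    (forall y, exists n, d < u n y) -> exists n, d <= L (u n).
  move=> bu ndu du.
  have [|//|n y /=|n [k Mk]] := M_compact (G := fun n => [set y | d < u n y]).
  - move=> n; rewrite (_ : mkset _ = u n @^-1` [set x | d < x]); last by [].
    apply: open_comp; last exact: open_gt.
    by move=> y _; exact: (bu n).1.
  - by move/lt_le_trans; apply; exact: ndu.
  - by exists n; apply: (L_ge k); [exact: Bcb|move=> y /Mk /ltW].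
have [kappa kP] := @daniell_riesz R Y L
  (fun f g bf bg => LD f g (Bcb bf) (Bcb bg))
  (fun t f bf => LZ t f (Bcb bf))
  (fun f bf f0 => L_ge 0%N f 0 (Bcb bf) (fun y _ => f0 y))
  (L1 1) L_sigma.
exists kappa; split=> [f g k Ff bg g0 fg|g C k bg g0 gC]; last first.
  by rewrite kP// lee_fin (L_le k)//; exact: Bcb.
rewrite kP// lee_fin.
have Bf : B f := F_bounded Ff.
have Bg : B g := Bcb bg.
have BN h : B h -> B (- h) by rewrite -scaleN1r; exact: BZ.
have fgL : L f <= L g.
  rewrite -subr_le0 -LN// -LD//; last exact: BN.
  apply: (L_le k); first by apply: BD => //; exact: BN.
  by move=> y My; rewrite subr_le0 fg.
apply: le_trans fgL; rewrite -[leLHS]L1 -subr_le0 -LN// -LD//; last exact: BN.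
have BcN : B ((fun=> c) - f : V) by apply: BD => //; exact: BN.
rewrite (le_trans (Lq _ BcN))// q_le//.
exists 0%N, 1, f; split=> // y My.
have aux (a b : R) : a - b + 1 * (b - a) <= 0 by lra.
exact: aux.
Qed.

End minimax_measure.

(** * Usco images of Polish spaces *)

Lemma countable_enumeration (T : Type) (A : set T) :
  countable A -> A !=set0 ->
  exists u : nat -> T, (forall n, A (u n)) /\ forall x, A x -> exists n, u n = x.
Proof.
move=> /countable_injP[f f_inj] [a Aa].
have /choice[u uP] : forall n, exists x : T, A x /\
    forall y, A y -> f y = n -> x = y.
  move=> n; have [[x [Ax fx]]|h] := pselect (exists x, A x /\ f x = n).
    exists x; split=> // y Ay fy; apply: f_inj; rewrite ?inE//.
    by rewrite fx fy.
  by exists a; split=> // y Ay fy; exfalso; apply: h; exists y.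
exists u; split=> [n|x Ax]; first exact: (uP n).1.
by exists (f x); exact: (uP _).2.
Qed.

Lemma ultra_ord_cover (T : Type) (U : set_system T) (A : nat -> set T) n :
  UltraFilter U -> U [set x | exists m, (m <= n)%N /\ A m x] ->
  exists m, U (A m).
Proof.
move=> UU; have FU : Filter U := filter_filter; elim: n => [|n ih] UA.
  exists 0%N; apply: filterS UA => x [m []].
  by rewrite leqn0 => /eqP ->.
have [UAn|UAn] := in_ultra_setVsetC (A n.+1) UU; first by exists n.+1.
apply: ih; apply: filterS (filterI UA UAn) => x [[m [mn Am]] nAx].
exists m; split=> //; rewrite -ltnS ltn_neqAle mn andbT.
by apply/eqP => mE; apply: nAx; rewrite -mE.
Qed.

Section analytic.
Context (R : realType) (P : metricType R) (T : topologicalType)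
  (phi : P -> set T).

Lemma polish_dense_sequence : polish P -> [set: P] !=set0 ->
  exists d : nat -> P, forall p e, 0 < e -> exists m, ball (d m) e p.
Proof.
move=> [[D cD dD] _] [p0 _].
have D0 : D !=set0.
  by have [|x [_ Dx]] := dD setT _ openT; [exists p0|exists x].
have [d [_ dP]] := countable_enumeration cD D0.
exists d => p e e0.
have [||x [xp Dx]] := dD (interior (ball p e)).
- by exists p; exact: nbhsx_ballx.
- exact: open_interior.
- by have [m dm] := dP _ Dx; exists m; rewrite dm; apply: ball_sym; exact: interior_subset.
Qed.

Definition cell (d : nat -> P) (n : nat -> nat) (k : nat) : set P :=
  [set p | forall j, (j <= k)%N ->
    exists m, (m <= n j)%N /\ ball (d m) j.+1%:R^-1 p].

Lemma usco_cell_cover (d : nat -> P) (n : nat -> nat) (G : nat -> set T) :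
  polish P -> usco phi -> (forall i, open (G i)) ->
  (forall i, G i `<=` G i.+1) -> (\bigcup_p phi p `<=` \bigcup_i G i) ->
  exists i k, forall p, cell d n k p -> phi p `<=` G i.
Proof.
move=> [_ complete] [cphi ophi] oG ndG phiG; apply: contrapT => nG.
have G_le i j : (i <= j)%N -> G i `<=` G j.
  move=> ij; rewrite -(subnKC ij); elim: (j - i)%N => [|m ih].
    by rewrite addn0.
  by rewrite addnS => y /ih /ndG.
have /choice[p pP] : forall k, exists p, cell d n k p /\ ~ (phi p `<=` G k).
  move=> k; apply: contrapT => h; apply: nG; exists k, k => p cp.
  by apply: contrapT => pG; apply: h; exists p.
have [U [UU ooU]] := ultraFilterLemma eventually_filter.
have FU : Filter U := filter_filter.
have pU_cauchy : cauchy (p @ U).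
  apply: cauchy_exP => e e0.
  pose j := Num.truncn e^-1.
  have je : j.+1%:R^-1 <= e.
    by rewrite invf_ple ?posrE//; exact/ltW/truncnS_gt.
  have [|m Um] := @ultra_ord_cover _ U (fun m => [set k | ball (d m) j.+1%:R^-1 (p k)]) (n j) UU.
    apply: ooU; exists j => // k /= jk; exact: (pP k).1.
  by exists (d m); apply: filterS Um => k; exact: le_ball.
have [q pq] := complete _ _ pU_cauchy.
have [i Gi] : exists i, phi q `<=` G i.
  have /compact_near_coveringP := cphi q.
  move=> /(_ nat \oo (fun i => G i) _)[|i _ Gi]; last first.
    by exists i; exact: (Gi i (leqnn i)).
  move=> x qx; have [i _ Gix] := phiG x (ex_intro2 _ _ q Logic.I qx).
  exists (G i, [set j | (i <= j)%N]) => /=.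
    by split; [exact: open_nbhs_nbhs|exists i].
  by move=> [y j] /= [Giy ij]; exact: G_le Giy.
have Up : U [set k | phi (p k) `<=` G i].
  have : (p @ U) [set s | phi s `<=` G i].
    by apply: pq; apply: open_nbhs_nbhs; split=> //; exact: ophi.
  exact.
have [k [/= ik Gk]] := filter_ex (filterI (ooU _ (nbhs_infty_ge i)) Up).
by apply: (pP k).2 => y /Gk; exact: G_le.
Qed.

End analytic.

(** * Mixtures of measures *)

Section mixture.
Context d d' (T : measurableType d) (X : measurableType d') (R : realType).
Local Open Scope ereal_scope.

(* The measurability of [k] is an argument, so that the measure structure can be
   inferred from the term. *)
Definition mixture (k : T -> {measure set X -> \bar R})
    of (forall U, measurable U -> measurable_fun [set: T] (k ^~ U)) :=
  fun (kappa : {measure set T -> \bar R}) (U : set X) => \int[kappa]_t k t U.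

Section mixture_measure.
Variables (k : T -> {measure set X -> \bar R})
  (mk : forall U, measurable U -> measurable_fun [set: T] (k ^~ U))
  (kappa : {measure set T -> \bar R}).

Let mixture0 : mixture mk kappa set0 = 0.
Proof. by apply: integral0_eq => t _; rewrite measure0. Qed.

Let mixture_ge0 U : 0 <= mixture mk kappa U.
Proof. exact: integral_ge0. Qed.

Let mixture_sigma_additive : semi_sigma_additive (mixture mk kappa).
Proof.
move=> F mF tF mUF; rewrite {2}/mixture.
have -> : \int[kappa]_t k t (\bigcup_n F n) =
    \int[kappa]_t \sum_(n <oo) k t (F n).
  by apply: eq_integral => t _; rewrite measure_semi_bigcup.
rewrite integral_nneseries//; last by move=> n; exact: mk.
apply: is_cvg_ereal_nneg_natsum_cond => n _ _; exact: integral_ge0.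
Qed.

HB.instance Definition _ := isMeasure.Build _ _ _ (mixture mk kappa)
  mixture0 mixture_ge0 mixture_sigma_additive.

Import HBNNSimple.

Lemma ge0_integral_mixture (f : X -> \bar R) : (forall x, 0 <= f x) ->
  measurable_fun [set: X] f ->
  \int[mixture mk kappa]_x f x = \int[kappa]_t \int[k t]_x f x.
Proof.
move=> f0 mf; pose g := nnsfun_approx measurableT mf.
have ndg x : nondecreasing_seq (fun n => (g n x)%:E).
  by move=> a b ab; rewrite lee_fin; exact/lefP/nd_nnsfun_approx.
have mg n : measurable_fun [set: X] (fun x => (g n x)%:E).
  exact/measurable_EFinP.
have limg (m : {measure set X -> \bar R}) :
    \int[m]_x f x = limn (fun n => \int[m]_x (g n x)%:E).
  rewrite -monotone_convergence//.
    by apply: eq_integral => x _; apply/esym/cvg_lim => //; exact: cvg_nnsfun_approx.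
  by move=> n x _; rewrite lee_fin.
have sumg n (m : {measure set X -> \bar R}) :
    \int[m]_x (g n x)%:E = \sum_(r \in range (g n)) r%:E * m (g n @^-1` [set r]).
  by rewrite integralT_nnsfun sintegralE.
have g_ge0 n (m : {measure set X -> \bar R}) r :
    0 <= r%:E * m (g n @^-1` [set r]).
  by apply: (mulemu_ge0 (fun r => g n @^-1` [set r])) => r0; exact: preimage_nnfun0.
rewrite limg; under [RHS]eq_integral do rewrite limg.
rewrite [RHS]monotone_convergence//; last 3 first.
- move=> n; apply: measurable_fun_integral_kernel => //.
  by move=> x; rewrite lee_fin.
- by move=> n t _; apply: integral_ge0 => x _; rewrite lee_fin.
- move=> t _ a b ab; apply: ge0_le_integral => //.
  + by move=> x _; rewrite lee_fin.
  + by move=> x _; exact: ndg.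
congr (limn _); apply/funext => n; rewrite sumg.
under [RHS]eq_integral do rewrite sumg.
rewrite ge0_integral_fsum//; last first.
  by move=> r; apply: measurable_funeM; exact: mk.
apply: eq_fsbigr => r /[1!inE] -[x _ gx].
rewrite ge0_integralZl//; last by rewrite lee_fin -gx.
exact: mk.
Qed.

End mixture_measure.
End mixture.

(** * Integration with respect to charges *)

Section bounded_measurable.
Context d (X : measurableType d) (R : realType).
Implicit Types f g : X -> R.

Definition bounded_measurable f :=
  measurable_fun [set: X] f /\ exists M : R, forall x, `|f x| <= M.

Lemma bounded_measurable_cst (c : R) : bounded_measurable (fun=> c).
Proof. by split; [exact: measurable_cst|exists `|c|]. Qed.

Lemma bounded_measurableD f g : bounded_measurable f -> bounded_measurable g ->
  bounded_measurable (fun x => f x + g x).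
Proof.
move=> [mf [A fA]] [mg [B gB]]; split; first exact: measurable_funD.
by exists (A + B) => y; rewrite (le_trans (ler_normD _ _))// lerD.
Qed.

Lemma bounded_measurableM f g : bounded_measurable f -> bounded_measurable g ->
  bounded_measurable (fun x => f x * g x).
Proof.
move=> [mf [A fA]] [mg [B gB]]; split; first exact: measurable_funM.
by exists (A * B) => y; rewrite normrM ler_pM.
Qed.

Lemma bounded_measurableB f g : bounded_measurable f -> bounded_measurable g ->
  bounded_measurable (fun x => f x - g x).
Proof.
move=> [mf [A fA]] [mg [B gB]]; split; first exact: measurable_funB.
by exists (A + B) => y; rewrite (le_trans (ler_normB _ _))// lerD.
Qed.

Lemma bounded_measurable_indic (E : set X) : measurable E ->
  bounded_measurable (\1_E : X -> R).
Proof.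
move=> mE; split; first exact: measurable_indic.
by exists 1 => x; rewrite indicE ger0_norm ?ler0n// lern1 leq_b1.
Qed.

Lemma bounded_measurable_integrable (m : {finite_measure set X -> \bar R})
    (D : set X) f : measurable D -> bounded_measurable f ->
  m.-integrable D (EFin \o f).
Proof.
move=> mD [mf [M fM]].
apply: (@integrableS _ _ _ _ setT) => //.
apply: measurable_bounded_integrable => //.
  by rewrite ltey_eq fin_num_measure.
exists M; split; first exact: num_real.
by move=> c Mc x _ /=; rewrite (le_trans (fM x))// ltW.
Qed.

Lemma ge0_Rintegral_EFin (m : {finite_measure set X -> \bar R})
    (D : set X) f : measurable D -> bounded_measurable f ->
  (\int[m]_(x in D) f x)%:E = (\int[m]_(x in D) (f x)%:E)%E.
Proof.
move=> mD bf; rewrite /Rintegral fineK//.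
exact: integrable_fin_num (bounded_measurable_integrable _ _ bf).
Qed.

End bounded_measurable.

Section charge_integral_theory.
Context d (X : measurableType d) (R : realType).
Variable nu : {charge set X -> \bar R}.
Implicit Types f g : X -> R.
Local Notation bm := (@bounded_measurable _ X R).
Local Notation I f := (charge_integral nu [set: X] f).

Definition variation : set X -> \bar R := charge_total_variation nu.

HB.instance Definition _ := Measure.on variation.

Lemma variationE A : variation A = (pos_part nu A + neg_part nu A)%E.
Proof. by []. Qed.

Let variation_finite : fin_num_fun variation.
Proof. by move=> A mA; rewrite variationE fin_numD !fin_num_measure. Qed.

HB.instance Definition _ := Measure_isFinite.Build _ _ _ variation variation_finite.

Lemma charge_jordanE A : measurable A -> nu A = (pos_part nu A - neg_part nu A)%E.
Proof.
move=> mA; rewrite (jordan_decomp (svalP (hahn_sig nu)) mA).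
by rewrite /cadd/= cscaleN1.
Qed.

Lemma integral_variation (f : X -> \bar R) : (forall x, 0 <= f x)%E ->
  measurable_fun [set: X] f ->
  (\int[variation]_x f x =
   \int[pos_part nu]_x f x + \int[neg_part nu]_x f x)%E.
Proof.
move=> f0 mf; rewrite -ge0_integral_measure_add//.
apply: eq_measure_integral => A mA _.
by rewrite [RHS]measure_addE.
Qed.

Lemma Rintegral_variation f : bm f -> (forall x, 0 <= f x) ->
  \int[variation]_x f x = \int[pos_part nu]_x f x + \int[neg_part nu]_x f x.
Proof.
move=> bf f0; apply: EFin_inj.
rewrite EFinD !ge0_Rintegral_EFin// integral_variation//.
by apply/measurable_EFinP; exact: bf.1.
Qed.

Lemma charge_integralB f g : bm f -> bm g ->
  I (fun x => f x - g x) = I f - I g.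
Proof.
move=> bf bg; rewrite /charge_integral !RintegralB//;
  try exact: bounded_measurable_integrable.
by ring.
Qed.

Lemma charge_integral_indic E : measurable E -> I (\1_E : X -> R) = fine (nu E).
Proof.
move=> mE; rewrite /charge_integral /Rintegral !integral_indic// setIT.
by rewrite charge_jordanE// fineB// fin_num_measure.
Qed.

Lemma ler_norm_charge_integral f : bm f ->
  `|I f| <= \int[variation]_x `|f x|.
Proof.
move=> bf.
have bnf : bm (fun x => `|f x|).
  split; first by apply: measurableT_comp => //; exact: bf.1.
  by have [_ [M fM]] := bf; exists M => x; rewrite normr_id.
rewrite Rintegral_variation//.
rewrite (le_trans (ler_normB _ _))// lerD// le_normr_Rintegral//.
  exact: bounded_measurable_integrable.
exact: bounded_measurable_integrable.
Qed.

Lemma le_charge_integral_variation (h f : X -> R) : bm h -> bm f ->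
  (forall x, `|h x| <= 1) -> (forall x, 0 <= f x) ->
  I (fun x => h x * f x) <= \int[variation]_x f x.
Proof.
move=> bh bf h1 f0; have bhf := bounded_measurableM bh bf.
rewrite (le_trans (ler_norm _))// (le_trans (ler_norm_charge_integral bhf))//.
apply: le_Rintegral => //.
- apply: bounded_measurable_integrable => //; split.
    by apply: measurableT_comp => //; exact: bhf.1.
  by have [_ [M fM]] := bhf; exists M => x; rewrite normr_id.
- exact: bounded_measurable_integrable.
- by move=> x _; rewrite normrM (ger0_norm (f0 x)) ler_piMl.
Qed.

(* Since [h (1 - f) <= 1 - f], the loss [variation setT - I h] bounds the loss
   incurred when integrating [h f] instead of [f]. *)
Lemma variation_le_charge_integral (h f : X -> R) : bm h -> bm f ->
  (forall x, `|h x| <= 1) -> (forall x, 0 <= f x <= 1) ->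
  \int[variation]_x f x <=
  I (fun x => h x * f x) + (fine (variation setT) - I h).
Proof.
move=> bh bf h1 f01.
have b1f : bm (fun x => 1 - f x).
  by apply: bounded_measurableB => //; exact: bounded_measurable_cst.
have f_le1 x : 0 <= 1 - f x by rewrite subr_ge0; have /andP[] := f01 x.
have := le_charge_integral_variation bh b1f h1 f_le1.
have -> : (fun x => h x * (1 - f x)) = (fun x => h x - h x * f x).
  by apply/funext => x; rewrite mulrBr mulr1.
rewrite charge_integralB//; last exact: bounded_measurableM.
rewrite RintegralB//; last 2 first.
- by apply: bounded_measurable_integrable => //; exact: bounded_measurable_cst.
- exact: bounded_measurable_integrable.
rewrite Rintegral_cst// mul1r; lra.
Qed.

End charge_integral_theory.

(** * A capacity continuous along increasing sequences *)

Section capacity.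
Context d (X : measurableType d) (R : realType) (S : Type).
Variables (m : {finite_measure set X -> \bar R})
  (V : S -> {measure set X -> \bar R}) (delta : R).
Implicit Types (f g : X -> R) (A : set S).

Definition feasible A f := [/\ measurable_fun [set: X] f,
  forall x, 0 <= f x <= 1 &
  forall s, A s -> (\int[V s]_x (f x)%:E <= delta%:E)%E].

Definition defect f := \int[m]_x (1 - f x) ^+ 2.

(* [capacity_le A a] states that the capacity
   [inf {defect f | feasible A f}] of [A] is at most [a]. The quadratic
   [defect] makes near-minimizers close to each other in L2(m), so that the
   capacity is continuous along increasing sequences. *)
Definition capacity_le A a :=
  forall e, 0 < e -> exists2 f, feasible A f & defect f < a + e.

Lemma feasible_bm A f : feasible A f -> bounded_measurable f.
Proof.
move=> [mf f01 _]; split=> //; exists 1 => x.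
by have /andP[f0 f1] := f01 x; rewrite ger0_norm.
Qed.

Lemma feasibleS A B f : A `<=` B -> feasible B f -> feasible A f.
Proof. by move=> AB [mf f01 fB]; split=> // s /AB /fB. Qed.

Lemma feasible_midpoint A f g : feasible A f -> feasible A g ->
  feasible A (fun x => (f x + g x) / 2).
Proof.
move=> [mf f01 fA] [mg g01 gA]; split.
- apply: measurable_funM; last exact: measurable_cst.
  exact: measurable_funD.
- by move=> x; have /andP[? ?] := f01 x; have /andP[? ?] := g01 x; lra.
- move=> s As.
  have f0 x : 0 <= f x by have /andP[] := f01 x.
  have g0 x : 0 <= g x by have /andP[] := g01 x.
  under eq_integral do rewrite mulrC EFinM EFinD.
  rewrite ge0_integralZl_EFin//; last 2 first.
  + by move=> x _; rewrite adde_ge0// lee_fin.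
  + by apply: emeasurable_funD; exact/measurable_EFinP.
  rewrite ge0_integralD//; last 4 first.
  + by move=> x _; rewrite lee_fin.
  + exact/measurable_EFinP.
  + by move=> x _; rewrite lee_fin.
  + exact/measurable_EFinP.
  rewrite lee_pdivrMl// (le_trans (leeD (fA s As) (gA s As)))//.
  by rewrite -EFinD -EFinM lee_fin; lra.
Qed.

Let bm2 f : bounded_measurable f ->
  bounded_measurable (fun x => (1 - f x) ^+ 2).
Proof.
move=> bf; under eq_fun do rewrite expr2.
by apply: bounded_measurableM; apply: bounded_measurableB => //;
  exact: bounded_measurable_cst.
Qed.

Lemma defect_ge0 f : 0 <= defect f.
Proof. by apply: Rintegral_ge0 => x _; exact: sqr_ge0. Qed.

Let integr h : bounded_measurable h -> m.-integrable setT (EFin \o h).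
Proof. exact: bounded_measurable_integrable. Qed.

Lemma defect_parallelogram f g : bounded_measurable f -> bounded_measurable g ->
  \int[m]_x (f x - g x) ^+ 2 =
  2 * (defect f + defect g) - 4 * defect (fun x => (f x + g x) / 2).
Proof.
move=> bf bg.
have bh : bounded_measurable (fun x => (f x + g x) / 2).
  apply: bounded_measurableM; last exact: bounded_measurable_cst.
  exact: bounded_measurableD.
have bfg := bounded_measurableD (bm2 bf) (bm2 bg).
have bZ c h : bounded_measurable h -> bounded_measurable (fun x => c * h x).
  by move=> ?; apply: bounded_measurableM => //; exact: bounded_measurable_cst.
rewrite -RintegralD//; [|exact/integr/bm2..].
rewrite -!RintegralZl//; [|exact/integr/bm2|exact: integr].
rewrite -RintegralB//; [|exact/integr/bZ|exact/integr/bZ/bm2].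
by apply: eq_Rintegral => x _; field.
Qed.

Lemma Rintegral_norm_le f t : bounded_measurable f -> 0 < t ->
  \int[m]_x `|f x| <=
  (\int[m]_x (f x) ^+ 2) / (2 * t) + t / 2 * fine (m setT).
Proof.
move=> bf t0.
have bf2 : bounded_measurable (fun x => f x ^+ 2).
  by under eq_fun do rewrite expr2; exact: bounded_measurableM.
have bnf : bounded_measurable (fun x => `|f x|).
  split; first by apply: measurableT_comp => //; exact: bf.1.
  by have [_ [M fM]] := bf; exists M => x; rewrite normr_id.
rewrite -Rintegral_cst// -RintegralZr//; last exact: integr.
rewrite -RintegralD//; last 2 first.
- apply/integr/bounded_measurableM => //; exact: bounded_measurable_cst.
- exact/integr/bounded_measurable_cst.
apply: le_Rintegral => //; [exact: integr|apply: integr|].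
  apply: bounded_measurableD; last exact: bounded_measurable_cst.
  by apply: bounded_measurableM => //; exact: bounded_measurable_cst.
move=> x _; rewrite -subr_ge0 -real_normK ?num_real//.
have -> : `|f x| ^+ 2 / (2 * t) + t / 2 - `|f x| =
    (`|f x| - t) ^+ 2 / (2 * t) by field; lra.
by rewrite divr_ge0 ?sqr_ge0// mulr_ge0// ltW.
Qed.

Section increasing.
Variables (A : nat -> set S) (a : R).
Hypothesis A_incr : forall n, A n `<=` A n.+1.
Hypothesis A_le : forall n, capacity_le (A n) a.

Let A_le_homo i j : (i <= j)%N -> A i `<=` A j.
Proof.
move=> ij; rewrite -(subnKC ij); elim: (j - i)%N => [|n ih].
  by rewrite addn0.
by rewrite addnS => y /ih /A_incr.
Qed.

Let C n := [set defect f | f in [set f | feasible (A n) f]].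
Let c n := inf (C n).

Let has_inf_C n : has_inf (C n).
Proof.
split; first by have [f fA _] := A_le n ltr01; exists (defect f), f.
by exists 0 => _ [f _ <-]; exact: defect_ge0.
Qed.

Let c_le n f : feasible (A n) f -> c n <= defect f.
Proof. by move=> fA; apply: ge_inf; [exact: (has_inf_C n).2|exists f]. Qed.

Let c_a n : c n <= a.
Proof.
apply/ler_addgt0Pr => e e0; have [f fA /ltW fae] := A_le n e0.
exact: le_trans (c_le fA) fae.
Qed.

Let c_nd i j : (i <= j)%N -> c i <= c j.
Proof.
move=> ij; apply: lb_le_inf; first exact: (has_inf_C j).1.
by move=> _ [f fA <-]; apply: c_le; exact: feasibleS (A_le_homo ij) fA.
Qed.

Let has_sup_c : has_sup (range c).
Proof. by split; [exists (c 0%N), 0%N|exists a => _ [n _ <-]]. Qed.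

Lemma near_minimizers (eta : nat -> R) : (forall k, 0 < eta k) ->
  (forall k, eta k.+1 <= eta k) ->
  exists f : nat -> X -> R, [/\
    forall s, (\bigcup_n A n) s ->
      exists k, (\int[V s]_x (f k x)%:E <= delta%:E)%E,
    forall k, bounded_measurable (f k) /\ forall x, 0 <= f k x <= 1,
    defect (f 0%N) < a + eta 0%N &
    forall k, \int[m]_x (f k.+1 x - f k x) ^+ 2 <= 6 * eta k].
Proof.
move=> eta0 eta_decr.
have /choice[N NP] : forall k, exists n, sup (range c) - eta k < c n.
  move=> k; have [_ [n _ <-] h] := sup_adherent (eta0 k) has_sup_c.
  by exists n.
pose n k := (\sum_(j < k.+1) N j + k)%N.
have nS k : (n k <= n k.+1)%N by rewrite /n [in leqRHS]big_ord_recr/= leq_add ?leq_addr ?leqnSn.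
have cn k : sup (range c) - eta k < c (n k).
  rewrite (lt_le_trans (NP k))// c_nd// /n big_ord_recr/=.
  by rewrite addnAC leq_addl.
have /choice[f fP] : forall k, exists f, feasible (A (n k)) f /\
    defect f < c (n k) + eta k.
  move=> k; have [_ [f fA <-] h] := inf_adherent (eta0 k) (has_inf_C (n k)).
  by exists f.
have bf k : bounded_measurable (f k) := feasible_bm (fP k).1.
exists f; split=> [s [j _ As]|k||k].
- exists j; have [_ _] := (fP j).1; apply.
  by apply: A_le_homo As; rewrite leq_addl.
- by split=> //; have [_ ? _] := (fP k).1.
- by rewrite (lt_le_trans (fP 0%N).2)// lerD2r.
rewrite defect_parallelogram//.
have fS : feasible (A (n k)) (f k.+1).
  exact: feasibleS (A_le_homo (nS k)) (fP k.+1).1.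
have := c_le (feasible_midpoint fS (fP k).1).
have := (fP k).2; have := (fP k.+1).2; have := cn k; have := eta_decr k.
have : c (n k.+1) <= sup (range c).
  by apply: ub_le_sup; [exact: has_sup_c.2|exists (n k.+1)].
lra.
Qed.

Lemma capacity_le_bigcup : capacity_le (\bigcup_n A n) a.
Proof.
move=> e e0.
pose t := Num.min (e / 8) 1.
have t0 : 0 < t by rewrite lt_min ltr01 divr_gt0.
pose M := fine (m setT).
have M0 : 0 <= M by rewrite fine_ge0.
pose tau k : R := t / (2 ^ k.+1)%:R.
have tau0 k : 0 < tau k by rewrite divr_gt0// ltr0n expn_gt0.
have tauS k : tau k.+1 = tau k / 2.
  by rewrite /tau expnS natrM invfM; ring.
pose theta k := tau k / (1 + M).
have M1 : 0 < 1 + M by lra.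
have theta0 k : 0 < theta k by rewrite divr_gt0.
pose eta k := theta k * tau k / 6.
have eta0 k : 0 < eta k by rewrite divr_gt0// mulr_gt0.
have etaS k : eta k.+1 <= eta k.
  rewrite /eta /theta tauS ler_pM2r ?invr_gt0//.
  have h : 0 <= tau k * (1 + M)^-1 * tau k.
    by rewrite !mulr_ge0 ?invr_ge0 ?ltW.
  lra.
have [f [fV bf f0 fS]] := near_minimizers eta0 etaS.
have f01 k x : 0 <= f k x <= 1 by have [] := bf k.
pose w k x := `|f k.+1 x - f k x|.
have bw' k : bounded_measurable (fun x => f k.+1 x - f k x).
  by apply: bounded_measurableB; [exact: (bf _).1|exact: (bf _).1].
have bw k : bounded_measurable (w k).
  split; first by apply: measurableT_comp => //; exact: (bw' k).1.
  by have [_ [B fB]] := bw' k; exists B => x; rewrite normr_id.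
have int_w k : \int[m]_x w k x <= tau k.
  rewrite (le_trans (Rintegral_norm_le (bw' k) (theta0 k)))// -/M.
  have : (\int[m]_x (f k.+1 x - f k x) ^+ 2) / (2 * theta k) <= tau k / 2.
    have th2 : 0 < 2 * theta k by have := theta0 k; lra.
    rewrite ler_pdivrMr//; apply: (le_trans (fS k)); rewrite /eta.
    by rewrite le_eqVlt; apply/orP; left; apply/eqP; field.
  have : theta k / 2 * M <= tau k / 2.
    have : theta k * M <= tau k.
      by rewrite /theta -mulrA ler_piMr ?(ltW (tau0 k))// mulrC ler_pdivrMr// mul1r; lra.
    lra.
  lra.
pose g x := infs (f ^~ x) 0%N.
have lbf x : has_lbound (range (f ^~ x)).
  by exists 0 => _ [k _ <-]; have /andP[] := f01 k x.
have g_le k x : g x <= f k x.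
  by apply: ge_inf; [exists 0 => _ [j _ <-]; have /andP[] := f01 j x|exists k].
have g_ge0 x : 0 <= g x.
  apply: lb_le_inf; first by exists (f 0%N x), 0%N.
  by move=> _ [k _ <-]; have /andP[] := f01 k x.
have g01 x : 0 <= g x <= 1.
  by rewrite g_ge0 (le_trans (g_le 0%N x))//; have /andP[] := f01 0%N x.
have mg : measurable_fun [set: X] g.
  by apply: measurable_fun_infs => // k; exact: (bf k).1.1.
have bg : bounded_measurable g.
  split=> //; exists 1 => x; have /andP[g0 g1] := g01 x.
  by rewrite ger0_norm.
exists g.
  split=> // s /fV [k fk]; apply: le_trans fk.
  apply: ge0_le_integral => //.
  - by move=> x _; rewrite lee_fin.
  - exact/measurable_EFinP.
  - by apply/measurable_EFinP; exact: (bf k).1.1.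
  - by move=> x _; rewrite lee_fin.
have tele k x : f 0%N x - f k x <= \sum_(j < k) w j x.
  elim: k => [|k ih]; first by rewrite big_ord0 subrr.
  rewrite big_ord_recr/= (le_trans _ (lerD ih (lexx _)))//.
  by rewrite /w; have := ler_norm (f k x - f k.+1 x); rewrite distrC; lra.
have gw x : (((1 - g x) ^+ 2)%:E <=
    ((1 - f 0%N x) ^+ 2)%:E + \sum_(k <oo) (2 * w k x)%:E)%E.
  have W0 : (0 <= \sum_(k <oo) (2 * w k x)%:E)%E.
    by apply: nneseries_ge0 => k _ _; rewrite lee_fin mulr_ge0// normr_ge0.
  have [->|Woo] := eqVneq (\sum_(k <oo) (2 * w k x)%:E)%E +oo%E.
    by rewrite addey ?leey.
  have Wfin : (\sum_(k <oo) (2 * w k x)%:E)%E \is a fin_num.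
    by rewrite ge0_fin_numE// lt_neqAle Woo leey.
  rewrite -(fineK Wfin) -EFinD lee_fin.
  have g_ge : f 0%N x - fine (\sum_(k <oo) (2 * w k x)%:E)%E / 2 <= g x.
    apply: lb_le_inf; first by exists (f 0%N x), 0%N.
    move=> _ [k _ <-]; have := tele k x.
    have : (\sum_(j < k) (2 * w j x)%:E <= \sum_(j <oo) (2 * w j x)%:E)%E.
      rewrite -(big_mkord xpredT (fun j => (2 * w j x)%:E)).
      by apply: nneseries_lim_ge => j _ _; rewrite lee_fin mulr_ge0// normr_ge0.
    by rewrite -(fineK Wfin) sumEFin lee_fin -mulr_sumr; lra.
  have := g_le 0%N x; have := g01 x; have := f01 0%N x.
  move: (g x) (f 0%N x) (fine _) g_ge => u v W uv /andP[v0 v1] /andP[u0 u1] uv'.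
  nra.
rewrite -lte_fin [ltLHS]ge0_Rintegral_EFin//; last exact: bm2.
apply: (@le_lt_trans _ _ ((defect (f 0%N))%:E + (2 * t)%:E)%E); last first.
  rewrite -EFinD lte_fin.
  have te : t <= e / 8 by rewrite ge_min lexx.
  have t1 : t <= 1 by rewrite ge_min lexx orbT.
  suff : eta 0%N <= t by move: f0; lra.
  have tau_t : tau 0%N <= t by rewrite /tau expn1; lra.
  have theta1 : theta 0%N <= 1.
    by rewrite /theta ler_pdivrMr// mul1r; lra.
  rewrite /eta; have := tau0 0%N; have := theta0 0%N; nra.
apply: (@le_trans _ _ (\int[m]_x
    (((1 - f 0%N x) ^+ 2)%:E + \sum_(k <oo) (2 * w k x)%:E))%E).
  apply: ge0_le_integral => //.
  - by move=> x _; rewrite lee_fin sqr_ge0.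
  - by apply/measurable_EFinP; exact: (bm2 bg).1.
  - apply: emeasurable_funD.
      by apply/measurable_EFinP; exact: (bm2 (bf _).1).1.
    apply: ge0_emeasurable_sum => k.
      by move=> x _ _; rewrite lee_fin mulr_ge0// normr_ge0.
    by move=> _; apply/measurable_EFinP/measurable_funM => //; exact: (bw k).1.
rewrite ge0_integralD//; last 4 first.
- by move=> x _; rewrite lee_fin sqr_ge0.
- by apply/measurable_EFinP; exact: (bm2 (bf _).1).1.
- by move=> x _; apply: nneseries_ge0 => k _ _; rewrite lee_fin mulr_ge0// normr_ge0.
- apply: ge0_emeasurable_sum => k.
    by move=> x _ _; rewrite lee_fin mulr_ge0// normr_ge0.
  by move=> _; apply/measurable_EFinP/measurable_funM => //; exact: (bw k).1.
rewrite -ge0_Rintegral_EFin//; last exact: bm2 (bf _).1.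
rewrite leeD2l// integral_nneseries//; last 2 first.
- by move=> k; apply/measurable_EFinP/measurable_funM => //; exact: (bw k).1.
- by move=> k x _; rewrite lee_fin mulr_ge0// normr_ge0.
apply: (@le_trans _ _ (\sum_(k <oo) (2 * t / (2 ^ k.+1)%:R)%:E)%E); last first.
  by apply: epsilon_trick0; rewrite mulr_ge0// ltW.
apply: lee_nneseries => [k *|k *].
  by apply: integral_ge0 => x _; rewrite lee_fin mulr_ge0// normr_ge0.
under eq_integral do rewrite EFinM.
rewrite ge0_integralZl_EFin//; last 2 first.
- by move=> x _; rewrite lee_fin normr_ge0.
- by apply/measurable_EFinP; exact: (bw k).1.
rewrite -ge0_Rintegral_EFin// -EFinM lee_fin -mulrA ler_pM2l//.
Qed.

End increasing.
End capacity.

(** * Measurability of the kernels given by N *)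

Lemma Rintegral_cvg d (X : measurableType d) (R : realType)
    (m : {finite_measure set X -> \bar R}) (u : nat -> X -> R) (f : X -> R)
    (C : R) :
  (forall n, measurable_fun [set: X] (u n)) ->
  (forall n x, `|u n x| <= C) -> (forall x, u n x @[n --> \oo] --> f x) ->
  \int[m]_x (u n x) @[n --> \oo] --> \int[m]_x f x.
Proof.
move=> mu uC uf.
have mf : measurable_fun [set: X] f.
  by apply: (measurable_fun_cvg mu) => x _; exact: uf.
have fC x : `|f x| <= C.
  have cu : `|u n x| @[n --> \oo] --> `|f x| by exact: cvg_norm.
  rewrite -(cvg_lim _ cu)//; apply: limr_le; last exact: nearW.
  by apply/cvg_ex; exists `|f x|.
have bf : bounded_measurable f by split=> //; exists C.
have [|||||_ _] := @dominated_convergence _ X R m setT measurableT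
  (fun n x => (u n x)%:E) (EFin \o f) (cst C%:E).
- by move=> n; apply/measurable_EFinP.
- exact/measurable_EFinP.
- apply: aeW => x _; apply: cvg_EFin; first exact: nearW.
  exact: uf.
- exact: finite_measure_integrable_cst.
- by apply: aeW => x n _; rewrite lee_fin.
by rewrite -(ge0_Rintegral_EFin m measurableT bf) => /fine_cvg.
Qed.

Lemma charge_integral_cvg d (X : measurableType d) (R : realType)
    (nu : {charge set X -> \bar R}) (u : nat -> X -> R) (f : X -> R) (C : R) :
  (forall n, measurable_fun [set: X] (u n)) ->
  (forall n x, `|u n x| <= C) -> (forall x, u n x @[n --> \oo] --> f x) ->
  charge_integral nu [set: X] (u n) @[n --> \oo] -->
  charge_integral nu [set: X] f.
Proof. by move=> mu uC uf; apply: cvgB; exact: Rintegral_cvg mu uC uf. Qed.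

Section weak_star_continuity.
Context (R : realType) (X : ptopologicalType).

Lemma continuous_pairing (f : X -> R) : bounded_continuous f ->
  continuous (fun nu : signed_measure R X => pairing nu f).
Proof.
move=> bf nu.
have := (@cvg_sup (signed_measure R X) _
  (fun f : {f : X -> R | bounded_continuous f} =>
    Topological.on (initial_topology
      (fun nu : signed_measure R X => pairing nu (sval f))))
  (nbhs nu) nu _).1 (fun A => id) (exist _ f bf).
move=> h A nA; apply: h.
exact: (@initial_continuous (signed_measure R X) R
  (fun nu : signed_measure R X => pairing nu f) nu A nA).
Qed.

Context (N : set (signed_measure R X)) (N0 : N !=set0).

Definition measure_at (t : nonempty_subspace N0) : signed_measure R X :=
  set_val t.

Lemma measure_at_in t : N (measure_at t).
Proof. exact: set_valP. Qed.

Lemma continuous_measure_at : continuous measure_at.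
Proof. exact: initial_continuous. Qed.

Lemma continuous_pairing_at (f : X -> R) : bounded_continuous f ->
  continuous (fun t => pairing (measure_at t) f).
Proof.
move=> bf t.
apply: (@continuous_comp _ _ _ measure_at (fun nu => pairing nu f) t).
  exact: continuous_measure_at.
exact: continuous_pairing.
Qed.

End weak_star_continuity.

Section kernel_measurability.
Context (R : realType) (X : ptopologicalType).
Context (N : set (signed_measure R X)) (N0 : N !=set0).
Local Notation T := (baire R (nonempty_subspace N0)).
Local Notation nu_ := (@measure_at R X N N0).

Lemma bounded_continuous_bm (Y : ptopologicalType) (f : Y -> R) :
  bounded_continuous f -> @bounded_measurable _ (baire R Y) R f.
Proof. by move=> [cf fM]; split=> //; exact: continuous_baire_measurable. Qed.

Lemma measurable_charge_integral_indic (f : X -> R) (E : set (baire R X)) :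
  bounded_continuous f -> measurable E ->
  measurable_fun [set: T] (fun t : T =>
    charge_integral (nu_ t) setT (fun x : baire R X => f x * \1_E x)).
Proof.
move=> bf mE; have [C fC] := bf.2.
have bmf := bounded_continuous_bm bf.
pose P (A : set (baire R X)) := measurable_fun [set: T] (fun t : T =>
  charge_integral (nu_ t) setT (fun x : baire R X => f x * \1_A x)).
have bfi A : measurable A ->
    bounded_measurable (fun x : baire R X => f x * \1_A x).
  move=> mA; apply: bounded_measurableM => //.
  exact: bounded_measurable_indic.
have fC1 (u : R) x : 0 <= u <= 1 -> `|f x * u| <= C.
  move=> /andP[u0 u1]; rewrite normrM (ger0_norm u0) (le_trans _ (fC x))//.
  by rewrite ler_piMr.
have cvgP (u : nat -> baire R X -> R) A :
    (forall n, measurable_fun setT (u n)) ->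
    (forall n x, 0 <= u n x <= 1) ->
    (forall x, u n x @[n --> \oo] --> (\1_A x : R)) ->
    (forall n, measurable_fun [set: T] (fun t : T =>
       charge_integral (nu_ t) setT (fun x : baire R X => f x * u n x))) -> P A.
  move=> mu u01 uA muP; apply: (measurable_fun_cvg muP) => t _.
  apply: (@charge_integral_cvg _ _ _ _ _ _ C).
  - by move=> n; apply: measurable_funM => //; exact: bmf.1.
  - by move=> n x; exact: fC1.
  - by move=> x; apply: cvgM; [exact: cvg_cst|exact: uA].
suff /(_ E) : <<s @cozero_sets R X >> `<=`
    [set A | @measurable _ (baire R X) A /\ P A].
  by rewrite -baire_cozeroE => /(_ mE)[].
apply: lambda_system_subset => //; first exact: setI_closed_cozero.
  split=> //.
  - split=> //; rewrite /P.
    rewrite [F in measurable_fun _ F](_ : _ =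
        (fun t : T => pairing (nu_ t) f)); last first.
      apply/funext => t; congr charge_integral; apply/funext => x.
      by rewrite indicT mulr1.
    apply: continuous_baire_measurable.
    exact: continuous_pairing_at.
  - move=> A B BA [mA PA] [mB PB].
    split; first exact: measurableD.
    rewrite /P [F in measurable_fun _ F](_ : _ = (fun t : T =>
        charge_integral (nu_ t) setT (fun x : baire R X => f x * \1_A x) -
        charge_integral (nu_ t) setT (fun x : baire R X => f x * \1_B x)));
      last first.
      apply/funext => t; rewrite -charge_integralB; [|exact: bfi..].
      congr charge_integral; apply/funext => x; rewrite -mulrBr; congr (_ * _).
      rewrite !indicE in_setD; have [xB|xB] := boolP (x \in B).
        by rewrite andbF (_ : x \in A) ?subrr// inE; apply: BA; rewrite -inE.
      by rewrite andbT subr0.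
    exact: measurable_funB.
  - move=> F ndF FP; split; first by apply: bigcupT_measurable => n; exact: (FP n).1.
    apply: (cvgP (fun n => \1_(F n))).
    + by move=> n; apply: measurable_indic; exact: (FP n).1.
    + by move=> n x; rewrite indicE ler0n lern1 leq_b1.
    + move=> x; rewrite indicE; have [/set_mem[k _ Fk]|xF] := boolP (x \in _).
        apply: cvg_near_cst; exists k => // n /= kn.
        by rewrite indicE mem_set//; have /subsetPset := ndF _ _ kn; exact.
      apply: cvg_near_cst; apply: nearW => n.
      rewrite indicE memNset// => Fn; move/negP: xF; apply.
      by apply/mem_set; exists n.
    + by move=> n; exact: (FP n).2.
move=> _ [g [cg g01] <-]; split.
  by rewrite baire_cozeroE; apply: sub_sigma_algebra; exists g.
have g0 x : 0 <= g x by have /andP[] := g01 x.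
have bramp n : bounded_continuous (fun x => Num.min 1 (n%:R * g x)).
  apply: bounded_continuous_min; first exact: bounded_continuous_cst.
  by apply: bounded_continuousZ; split=> //; exists 1 => x; rewrite ger0_norm//;
    have /andP[] := g01 x.
apply: (cvgP (fun n x => Num.min 1 (n%:R * g x))).
- by move=> n; exact: (bounded_continuous_bm (bramp n)).1.
- by move=> n x; rewrite le_min ler01 mulr_ge0//= ge_min lexx.
- move=> x; rewrite indicE; have [/set_mem/= gx|xg] := boolP (x \in _).
    apply: cvg_near_cst; exists (Num.truncn (g x)^-1).+1 => // n /= gn.
    rewrite min_l// -ler_pdivrMr// div1r (le_trans (ltW (truncnS_gt _)))//.
    by rewrite ler_nat.
  have -> : g x = 0.
    apply/eqP; rewrite eq_le g0 andbT leNgt; apply: contra xg => gx.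
    exact/mem_set.
  by apply: cvg_near_cst; apply: nearW => n; rewrite mulr0 min_r.
move=> n; apply: (continuous_baire_measurable (Y := nonempty_subspace N0)).
apply: (continuous_pairing_at (f := fun x => f x * Num.min 1 (n%:R * g x))).
exact: bounded_continuousM.
Qed.

Variable h : nat -> X -> R.
Hypothesis h_cont : forall n, continuous (h n).
Hypothesis h_le1 : forall n x, `|h n x| <= 1.
Hypothesis norm_h : forall nu, N nu -> variation_norm nu =
  ereal_sup (range (fun n => (pairing nu (h n))%:E)).

Lemma h_bounded_continuous n : bounded_continuous (h n).
Proof. by split=> //; exists 1. Qed.

Lemma variation_norm_sup (nu : signed_measure R X) : N nu ->
  [/\ forall n, pairing nu (h n) <= fine (variation nu setT) &
  forall e, 0 < e -> exists n, fine (variation nu setT) - e < pairing nu (h n)].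
Proof.
move=> Nnu; have := norm_h Nnu; rewrite -[variation_norm nu]/(variation nu setT).
have Vfin : variation nu setT \is a fin_num by rewrite fin_num_measure.
rewrite -(fineK Vfin) => VE; split=> [n|e e0].
  by rewrite -lee_fin VE; apply: ereal_sup_ubound; exists n.
have : ((fine (variation nu setT) - e)%:E < (fine (variation nu setT))%:E)%E.
  by rewrite lte_fin ltrBlDr ltrDl.
rewrite [ltRHS]VE => /ereal_sup_gt[_ [n _ <-]].
by rewrite lte_fin => ?; exists n.
Qed.

Lemma measurable_variation_at (E : set (baire R X)) : measurable E ->
  measurable_fun [set: T] (fun t : T => variation (nu_ t) E).
Proof.
move=> mE.
rewrite [F in measurable_fun _ F](_ : _ = (fun t : T =>
    esups (fun n => (charge_integral (nu_ t) setT
      (fun x : baire R X => h n x * \1_E x))%:E) 0%N)); last first.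
  apply/funext => t.
  have [Vge Vlt] := variation_norm_sup (measure_at_in t).
  have b1 := @bounded_measurable_indic _ (baire R X) R E mE.
  have bh n := bounded_continuous_bm (h_bounded_continuous n).
  have VE : variation (nu_ t) E = (\int[variation (nu_ t)]_x (\1_E x : R))%:E.
    by rewrite ge0_Rintegral_EFin// integral_indic// setIT.
  have i01 (x : baire R X) : 0 <= (\1_E x : R) <= 1.
    by rewrite indicE ler0n lern1 leq_b1.
  apply/eqP; rewrite eq_le; apply/andP; split; last first.
    apply: ub_ereal_sup => _ [n _ <-]; rewrite VE lee_fin.
    by apply: le_charge_integral_variation => // x; have /andP[] := i01 x.
  apply/lee_subgt0Pr => e e0; have [n hn] := Vlt _ e0.
  apply: (@le_trans _ _ (charge_integral (nu_ t) setT
      (fun x : baire R X => h n x * \1_E x))%:E); last first.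
    by apply: ereal_sup_ubound; exists n.
  rewrite VE -EFinB lee_fin.
  have := variation_le_charge_integral (nu_ t) (bh n) b1 (h_le1 n) i01.
  by move: hn; rewrite /pairing; lra.
apply: measurable_fun_esups => n; apply/measurable_EFinP.
exact: measurable_charge_integral_indic (h_bounded_continuous n) mE.
Qed.

Lemma measurable_charge_at (E : set (baire R X)) : measurable E ->
  measurable_fun [set: T] (fun t : T => nu_ t E).
Proof.
move=> mE.
rewrite [F in measurable_fun _ F](_ : _ = (fun t : T =>
    (charge_integral (nu_ t) setT (fun x : baire R X => 1 * \1_E x))%:E));
  last first.
  apply/funext => t.
  rewrite (_ : (fun _ : baire R X => _) = \1_E); last first.
    by apply/funext => x; rewrite mul1r.
  by rewrite charge_integral_indic// fineK// fin_num_measure.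
apply/measurable_EFinP; apply: measurable_charge_integral_indic => //.
exact: bounded_continuous_cst.
Qed.

Lemma measurable_pos_part_at (E : set (baire R X)) : measurable E ->
  measurable_fun [set: T] (fun t : T => pos_part (nu_ t) E).
Proof.
move=> mE.
rewrite [F in measurable_fun _ F](_ : _ = (fun t : T =>
    2^-1%:E * (variation (nu_ t) E + nu_ t E))%E); last first.
  apply/funext => t; rewrite variationE charge_jordanE//.
  have pf : pos_part (nu_ t) E \is a fin_num by rewrite fin_num_measure.
  have nf : neg_part (nu_ t) E \is a fin_num by rewrite fin_num_measure.
  by rewrite -(fineK pf) -(fineK nf) -!EFinD -EFinM; congr EFin; field.
apply: measurable_funeM; apply: emeasurable_funD.
  exact: measurable_variation_at.
exact: measurable_charge_at.
Qed.

Lemma measurable_neg_part_at (E : set (baire R X)) : measurable E ->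
  measurable_fun [set: T] (fun t : T => neg_part (nu_ t) E).
Proof.
move=> mE.
rewrite [F in measurable_fun _ F](_ : _ = (fun t : T =>
    2^-1%:E * (variation (nu_ t) E - nu_ t E))%E); last first.
  apply/funext => t; rewrite variationE charge_jordanE//.
  have pf : pos_part (nu_ t) E \is a fin_num by rewrite fin_num_measure.
  have nf : neg_part (nu_ t) E \is a fin_num by rewrite fin_num_measure.
  rewrite -(fineK pf) -(fineK nf) -!EFinD -EFinM.
  by congr EFin; field.
apply: measurable_funeM; apply: emeasurable_funB.
  exact: measurable_variation_at.
exact: measurable_charge_at.
Qed.

End kernel_measurability.

(** * The singular part *)

Section continuous_dense.
Context (R : realType) (X : ptopologicalType).
Variable m : {finite_measure set (baire R X) -> \bar R}.

Lemma continuous_dense (E : set (baire R X)) (e : R) : measurable E -> 0 < e ->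
  exists f : X -> R, [/\ continuous f, forall x, 0 <= f x <= 1 &
    \int[m]_x `|\1_E x - f x| <= e].
Proof.
pose P (A : set (baire R X)) := forall e, 0 < e ->
  exists f : X -> R, [/\ continuous f, forall x, 0 <= f x <= 1 &
    \int[m]_x `|\1_A x - f x| <= e].
have bm_dist (A : set (baire R X)) (f : X -> R) : measurable A -> continuous f ->
    (forall x, 0 <= f x <= 1) ->
    @bounded_measurable _ (baire R X) R (fun x => `|\1_A x - f x|).
  move=> mA cf f01; split; last first.
    exists 1 => x; rewrite normr_id indicE; have /andP[f0 f1] := f01 x.
    by case: (_ \in _) => /=; rewrite ler_norml; lra.
  apply: measurableT_comp => //; apply: measurable_funB.
    exact: measurable_indic.
  exact: continuous_baire_measurable.
have integr f : bounded_measurable f -> m.-integrable setT (EFin \o f).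
  exact: bounded_measurable_integrable.
have aux (a b u v : R) :
    `|Num.max 0 (a - b) - Num.max 0 (u - v)| <= `|a - u| + `|b - v|.
  have := ler_norm (a - u); have := ler_norm (u - a); rewrite (distrC u).
  have := ler_norm (b - v); have := ler_norm (v - b); rewrite (distrC v).
  move=> ? ? ? ?; rewrite ler_norml.
  by case: (leP 0 (a - b)) => ?; case: (leP 0 (u - v)) => ?; lra.
move=> mE; move: e; suff /(_ E) : <<s @cozero_sets R X >> `<=`
    [set A | @measurable _ (baire R X) A /\ P A].
  by rewrite -baire_cozeroE => /(_ mE)[].
apply: lambda_system_subset => //; first exact: setI_closed_cozero.
  split=> //.
  - split=> // e e0; exists (fun=> 1); split.
    + exact: cst_continuous.
    + by move=> x; rewrite ler01 lexx.
    + under eq_Rintegral do rewrite indicT subrr normr0.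
      by rewrite Rintegral_cst// mul0r ltW.
  - move=> A B BA [mA PA] [mB PB]; split; first exact: measurableD.
    move=> e e0; have e2 : 0 < e / 2 by rewrite divr_gt0.
    have [f [cf f01 fA]] := PA _ e2; have [g [cg g01 gB]] := PB _ e2.
    exists (fun x => Num.max 0 (f x - g x)).
    have cfg : continuous (fun x => Num.max 0 (f x - g x)).
      move=> x; apply: (@continuous_max _ _ (cst 0) (fun x => f x - g x) x).
        exact: cst_continuous.
      by apply: cvgB; [exact: cf|exact: cg].
    have fg01 x : 0 <= Num.max 0 (f x - g x) <= 1.
      have /andP[? ?] := f01 x; have /andP[? ?] := g01 x.
      by rewrite le_max lexx ge_max ler01/=; lra.
    split=> //.
    rewrite [leRHS](splitr e) (le_trans _ (lerD fA gB))//.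
    rewrite -RintegralD//; [|exact/integr/bm_dist..].
    apply: le_Rintegral => //.
    + by apply/integr/bm_dist => //; exact: measurableD.
    + by apply/integr/bounded_measurableD; exact: bm_dist.
    + move=> x _; rewrite (_ : \1_(A `\` B) x = Num.max 0 (\1_A x - \1_B x)).
        exact: aux.
      rewrite !indicE in_setD; have [xB|xB] := boolP (x \in B).
        rewrite (_ : x \in A) ?subrr ?maxxx//.
        by rewrite inE; apply: BA; rewrite -inE.
      by rewrite andbT subr0 max_r.
  - move=> F ndF FP.
    have mUF : @measurable _ (baire R X) (\bigcup_n F n).
      by apply: bigcupT_measurable => n; exact: (FP n).1.
    split=> // e e0; have e2 : 0 < e / 2 by rewrite divr_gt0.
    have mF n : @measurable _ (baire R X) (F n) by exact: (FP n).1.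
    have : \int[m]_x (\1_(F n) x : R) @[n --> \oo] -->
        \int[m]_x (\1_(\bigcup_n F n) x : R).
      apply: (@Rintegral_cvg _ _ _ _ _ _ 1).
      + by move=> n; exact: measurable_indic.
      + by move=> n x; rewrite indicE ger0_norm// lern1 leq_b1.
      + move=> x; rewrite indicE; have [/set_mem[k _ Fk]|xF] := boolP (x \in _).
          apply: cvg_near_cst; exists k => // n /= kn.
          by rewrite indicE mem_set//; have /subsetPset := ndF _ _ kn; exact.
        apply: cvg_near_cst; apply: nearW => n.
        rewrite indicE memNset// => Fn; move/negP: xF; apply.
        by apply/mem_set; exists n.
    move=> /cvgrPdist_lt /(_ _ e2)[n _ /(_ n (leqnn n)) /= hn].
    have [f [cf f01 fF]] := (FP n).2 _ e2.
    exists f; split=> //.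
    have bi A : measurable A -> @bounded_measurable _ (baire R X) R \1_A.
      exact: bounded_measurable_indic.
    have {}hn : \int[m]_x (\1_(\bigcup_n F n) x - \1_(F n) x) <= e / 2.
      rewrite RintegralB//; [|exact/integr/bi..].
      by rewrite (le_trans (ler_norm _))// ltW.
    rewrite (splitr e) (le_trans _ (lerD hn fF))//.
    rewrite -RintegralD//; last 2 first.
    + by apply/integr/bounded_measurableB; exact: bi.
    + exact/integr/bm_dist.
    apply: le_Rintegral => //.
    + exact/integr/bm_dist.
    + apply/integr/bounded_measurableD; last exact: bm_dist.
      by apply: bounded_measurableB; exact: bi.
    + move=> x _; rewrite (le_trans (ler_distD (\1_(F n) x) _ _))// lerD2r.
      rewrite ger0_norm// subr_ge0 !indicE ler_nat.
      have [xF|//] := boolP (x \in F n).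
      by rewrite mem_set//; exists n => //; rewrite -inE.
move=> _ [g [cg g01] <-].
have mg : @measurable _ (baire R X) [set x | 0 < g x].
  by rewrite baire_cozeroE; apply: sub_sigma_algebra; exists g.
split=> // e e0.
have g0 x : 0 <= g x by have /andP[] := g01 x.
pose r n x := Num.min 1 (n%:R * g x).
have br n : bounded_continuous (r n).
  apply: bounded_continuous_min; first exact: bounded_continuous_cst.
  by apply: bounded_continuousZ; split=> //; exists 1 => x; rewrite ger0_norm//;
    have /andP[] := g01 x.
have r01 n x : 0 <= r n x <= 1.
  by rewrite le_min ler01 mulr_ge0//= ge_min lexx.
have : \int[m]_x `|\1_[set x | 0 < g x] x - r n x| @[n --> \oo] --> \int[m]_x 0.
  apply: (@Rintegral_cvg _ _ _ _ _ _ 1).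
  - by move=> n; exact: (bm_dist _ _ mg (br n).1 (r01 n)).1.
  - move=> n x; rewrite normr_id indicE; have /andP[r0 r1] := r01 n x.
    by case: (_ \in _) => /=; rewrite ler_norml; lra.
  - move=> x; rewrite indicE; have [/set_mem/= gx|xg] := boolP (x \in _).
      apply: cvg_near_cst; exists (Num.truncn (g x)^-1).+1 => // n /= gn.
      rewrite /r min_l ?subrr ?normr0// -ler_pdivrMr// div1r.
      by rewrite (le_trans (ltW (truncnS_gt _)))// ler_nat.
    have gx0 : g x = 0.
      apply/eqP; rewrite eq_le g0 andbT leNgt; apply: contra xg => gx.
      exact/mem_set.
    by apply: cvg_near_cst; apply: nearW => n; rewrite /r gx0 mulr0 min_r// subrr normr0.
rewrite Rintegral_cst// mul0r => /cvgrPdist_lt /(_ _ e0)[n _ /(_ n (leqnn n)) /=].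
rewrite sub0r normrN => /ltW/(le_trans (ler_norm _)) hn.
by exists (r n); split=> //; exact: (br n).1.
Qed.

End continuous_dense.

Section finite_measure_of.
Context d (T : measurableType d) (R : realType).
Variables (mu : {measure set T -> \bar R}).

(* The proof of finiteness is an argument, so that the finite measure structure
   can be inferred from the term. *)
Definition finite_measure_of (_ : (mu setT < +oo)%E) : set T -> \bar R := mu.

Hypothesis fin : (mu setT < +oo)%E.

HB.instance Definition _ := Measure.on (finite_measure_of fin).

Let finite_measure_of_fin : fin_num_fun (finite_measure_of fin).
Proof. exact: lty_fin_num_fun. Qed.

HB.instance Definition _ := Measure_isFinite.Build _ _ _ (finite_measure_of fin)
  finite_measure_of_fin.

End finite_measure_of.

Lemma continuous_bigmax (R : realType) (Y : topologicalType)
    (u : nat -> Y -> R) n : (forall i, continuous (u i)) ->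
  continuous (fun y => \big[Order.max/0]_(i < n) u i y).
Proof.
elim: n u => [|n ih] u cu.
  under eq_fun do rewrite big_ord0.
  exact: cst_continuous.
under eq_fun do rewrite big_ord_recl/=.
move=> y; apply: (@continuous_max _ _ (u 0%N)
  (fun y => \big[Order.max/0]_(i < n) u i.+1 y) y); first exact: cu.
exact: (ih (fun i => u i.+1)).
Qed.

Section singular.
Context (R : realType) (X : ptopologicalType).
Context (N : set (signed_measure R X)) (N0 : N !=set0).
Local Notation Y := (nonempty_subspace N0).
Local Notation T := (baire R Y).
Local Notation nu_ := (@measure_at R X N N0).
Local Notation norm nu := (fine (variation nu setT)).
Variable h : nat -> X -> R.
Hypothesis h_cont : forall n, continuous (h n).
Hypothesis h_le1 : forall n x, `|h n x| <= 1.
Hypothesis norm_h : forall nu, N nu -> variation_norm nu =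
  ereal_sup (range (fun n => (pairing nu (h n))%:E)).
Variables (P : metricType R) (phi : P -> set (signed_measure R X)).
Hypotheses (polishP : polish P) (usco_phi : usco phi)
  (N_phi : N = \bigcup_p phi p).
Variable d : nat -> P.
Hypothesis dP : forall p e, 0 < e -> exists m, ball (d m) e p.
Variable m : {finite_measure set (baire R X) -> \bar R}.

Let bh n : bounded_continuous (h n) := h_bounded_continuous h_cont h_le1 n.

(* Besides localizing [p], membership in a level makes [|nu|] a limit of the
   maxima of finitely many of the weak* continuous [nu |-> nu (h i * f)],
   uniformly in [nu]. *)
Definition level (p : P) (nu : signed_measure R X) (j k : nat) : Prop :=
  [/\ exists i, (i <= k)%N /\ ball (d i) j.+1%:R^-1 p,
      norm nu <= k%:R &
      exists i, (i <= k)%N /\ norm nu - j.+1%:R^-1 <= pairing nu (h i)].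

Definition level_set (s : seq nat) : set (signed_measure R X) :=
  [set nu | exists p, phi p nu /\
    forall j, (j < size s)%N -> level p nu j (nth 0%N s j)].

Lemma levelS p nu j k l : (k <= l)%N -> level p nu j k -> level p nu j l.
Proof.
move=> kl [[i [ik ip]] nk [i' [i'k i'nu]]]; split.
- by exists i; split=> //; exact: leq_trans kl.
- by rewrite (le_trans nk)// ler_nat.
- by exists i'; split=> //; exact: leq_trans kl.
Qed.

Lemma exists_level p nu j : N nu -> exists k, level p nu j k.
Proof.
move=> Nnu; have j0 : 0 < j.+1%:R^-1 :> R by rewrite invr_gt0.
have [i ip] := dP p j0.
have [_ /(_ _ j0)[i' /ltW i'nu]] := variation_norm_sup norm_h Nnu.
pose k := (Num.truncn (norm nu)).+1.
exists (i + i' + k)%N; split.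
- by exists i; split=> //; rewrite -addnA leq_addr.
- rewrite (le_trans (ltW (truncnS_gt _)))// ler_nat.
  by rewrite leq_addl.
- by exists i'; split=> //; rewrite addnAC leq_addl.
Qed.

Lemma level_set0 : level_set [::] = N.
Proof.
rewrite N_phi; apply/seteqP; split => nu /=.
  by move=> [p [pnu _]]; exists p.
by move=> [p _ pnu]; exists p.
Qed.

Lemma level_set_sub s : level_set s `<=` N.
Proof. by move=> nu [p [pnu _]]; rewrite N_phi; exists p. Qed.

Lemma level_set_rconsS s k : level_set (rcons s k) `<=` level_set (rcons s k.+1).
Proof.
move=> nu [p [pnu nuk]]; exists p; split=> // j; rewrite size_rcons => js.
have := nuk j; rewrite size_rcons => /(_ js).
rewrite !nth_rcons; case: ifPn => // _; case: ifPn => // _.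
exact: levelS.
Qed.

Lemma level_set_rcons s : level_set s `<=` \bigcup_k level_set (rcons s k).
Proof.
move=> nu nus; have := nus => -[p [pnu nup]].
have [k kP] := exists_level p (size s) (level_set_sub nus).
exists k => //; exists p; split=> // j; rewrite size_rcons ltnS leq_eqVlt.
move=> /predU1P[->|js]; first by rewrite nth_rcons ltnn eqxx.
by rewrite nth_rcons js; exact: nup.
Qed.

Local Notation cap := (capacity_le m (fun nu : signed_measure R X => variation nu)).

Lemma capacity_branch (delta a : R) : ~ cap delta N a ->
  exists n : nat -> nat, forall k, ~ cap delta (level_set (mkseq n k)) a.
Proof.
move=> capN.
have /choice[F FP] : forall s, exists k, ~ cap delta (level_set s) a ->
    ~ cap delta (level_set (rcons s k)) a.
  move=> s; apply: contrapT => /forallNP nk.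
  have [cs|cs] := pselect (cap delta (level_set s) a).
    by apply: (nk 0%N).
  have ck k : cap delta (level_set (rcons s k)) a.
    by apply: contrapT => ck; apply: (nk k).
  apply: cs => e e0.
  have [f fA fe] := capacity_le_bigcup (@level_set_rconsS s) ck e0.
  by exists f => //; apply: feasibleS fA; exact: level_set_rcons.
pose S := nat_rect (fun=> seq nat) [::] (fun _ s => rcons s (F s)).
exists (F \o S) => k.
have -> : mkseq (F \o S) k = S k.
  by elim: k => [//|k ih]; rewrite mkseqS ih.
by elim: k => [|k ih]; [rewrite level_set0|exact: FP].
Qed.

Section branch.
Variable n : nat -> nat.

Definition branch_set k : set Y := [set t | level_set (mkseq n k.+1) (nu_ t)].

Lemma branch_setP k t : branch_set k t -> exists p, phi p (nu_ t) /\
  forall j, (j <= k)%N -> level p (nu_ t) j (n j).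
Proof.
move=> [p [pt tp]]; exists p; split=> // j jk.
by have := tp j; rewrite size_mkseq ltnS nth_mkseq// => /(_ jk).
Qed.

Lemma branch_set_decr k : branch_set k.+1 `<=` branch_set k.
Proof.
move=> t /branch_setP[p [pt tp]]; exists p; split=> // j.
rewrite size_mkseq => jk; rewrite nth_mkseq//; apply: tp.
by rewrite -ltnS ltnW.
Qed.

Lemma branch_set_compact (G : nat -> set Y) : (forall i, open (G i)) ->
  (forall t, exists i, G i t) -> (forall i, G i `<=` G i.+1) ->
  exists i k, branch_set k `<=` G i.
Proof.
move=> oG GT ndG.
have /choice[G' G'P] : forall i, exists G' : set (signed_measure R X),
    open G' /\ nu_ @^-1` G' = G i.
  by move=> i; have [G' oG' G'E] := oG i; exists G'.
pose G'' i := \bigcup_(j in [set j | (j <= i)%N]) G' j.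
have G_le i j : (i <= j)%N -> G i `<=` G j.
  move=> ij; rewrite -(subnKC ij); elim: (j - i)%N => [|k ih].
    by rewrite addn0.
  by rewrite addnS => y /ih /ndG.
have [i|i nu [j /= ji G'j]||i [k ik]] :=
    @usco_cell_cover R P _ phi d n G'' polishP usco_phi.
- by apply: bigcup_open => j _; exact: (G'P j).1.
- by exists j => //=; rewrite (leq_trans ji).
- rewrite -N_phi => nu Nnu.
  have [t <-] : exists t : Y, nu_ t = nu.
    by exists (SigSub (mem_set Nnu)).
  have [i Gi] := GT t; exists i => //; exists i => /=; first exact: leqnn.
  by move: Gi; rewrite -(G'P i).2.
- exists i, k => t /branch_setP[p [pt tp]].
  have [|j /= ji G'j] := ik p _ _ pt.
    by move=> j jk; have [[l [lj lp]] _ _] := tp j jk; exists l.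
  by apply: (G_le _ _ ji); rewrite -(G'P j).2.
Qed.

End branch.

End singular.

Section singular_measure.
Context (R : realType) (X : ptopologicalType).
Context (N : set (signed_measure R X)) (N0 : N !=set0).
Local Notation Y := (nonempty_subspace N0).
Local Notation T := (baire R Y).
Local Notation nu_ := (@measure_at R X N N0).
Local Notation norm nu := (fine (variation nu setT)).
Variable h : nat -> X -> R.
Hypothesis h_cont : forall n, continuous (h n).
Hypothesis h_le1 : forall n x, `|h n x| <= 1.
Hypothesis norm_h : forall nu, N nu -> variation_norm nu =
  ereal_sup (range (fun n => (pairing nu (h n))%:E)).
Variables (P : metricType R) (phi : P -> set (signed_measure R X)).
Hypotheses (polishP : polish P) (usco_phi : usco phi)
  (N_phi : N = \bigcup_p phi p).
Variable d : nat -> P.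
Hypothesis dP : forall p e, 0 < e -> exists m, ball (d m) e p.
Variable m : {finite_measure set (baire R X) -> \bar R}.
Local Notation cap := (capacity_le m (fun nu : signed_measure R X => variation nu)).

Let bh n : bounded_continuous (h n) := h_bounded_continuous h_cont h_le1 n.
Let mV := measurable_variation_at (N0 := N0) h_cont h_le1 norm_h.

Section branch.
Variables (n : nat -> nat) (delta a : R).
Hypotheses (delta_gt0 : 0 < delta) (a_gt0 : 0 < a).
Hypothesis ncap : forall k, ~ cap delta (level_set h phi d (mkseq n k)) a.
Local Notation M := (branch_set (N0 := N0) h phi d n).

Let C01 := [set f : X -> R | continuous f /\ forall x, 0 <= f x <= 1].
Let I (f : X -> R) (t : Y) := \int[variation (nu_ t)]_x f x.
Let c (f : X -> R) := (\int[m]_x (1 - f x)) / a.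

Let C01_bm f : C01 f -> @bounded_measurable _ (baire R X) R f.
Proof.
move=> [cf f01]; apply: bounded_continuous_bm; split=> //.
by exists 1 => x; have /andP[f0 f1] := f01 x; rewrite ger0_norm.
Qed.

Let C01_bm1 f : C01 f -> @bounded_measurable _ (baire R X) R (fun x => 1 - f x).
Proof.
by move=> /C01_bm bf; apply: bounded_measurableB => //; exact: bounded_measurable_cst.
Qed.

Let I_ge0 f t : C01 f -> 0 <= I f t.
Proof. by move=> [_ f01]; apply: Rintegral_ge0 => x _; have /andP[] := f01 x. Qed.

Let c_ge0 f : C01 f -> 0 <= c f.
Proof.
move=> [_ f01]; rewrite divr_ge0 ?(ltW a_gt0)//.
by apply: Rintegral_ge0 => x _; rewrite subr_ge0; have /andP[] := f01 x.
Qed.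

Let I_le_norm f t : C01 f -> I f t <= norm (nu_ t).
Proof.
move=> Cf; have [cf f01] := Cf.
rewrite -[leRHS]mul1r -Rintegral_cst//.
apply: le_Rintegral => //.
- exact/bounded_measurable_integrable/C01_bm.
- exact/bounded_measurable_integrable/bounded_measurable_cst.
- by move=> x _; have /andP[] := f01 x.
Qed.

Let F := [set (fun t : Y => I f t / delta + c f) | f in C01].

Let F_ge g k : F g -> exists2 t, M k t & 1 <= g t.
Proof.
move=> [f Cf <-]; have [cf f01] := Cf; apply: contrapT => nt.
have lt1 t : M k t -> I f t / delta + c f < 1.
  by move=> Mt; rewrite ltNge; apply/negP => ge1; apply: nt; exists t.
have [[nu nuM]|M0] := pselect (exists nu, level_set h phi d (mkseq n k.+1) nu);
    last first.
  case: (@ncap k.+1) => e e0; exists (fun=> 1).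
    split; first exact: measurable_cst.
      by move=> x; rewrite ler01 lexx.
    by move=> nu nuM; exfalso; apply: M0; exists nu.
  rewrite /defect; under eq_Rintegral do rewrite subrr expr0n/=.
  by rewrite Rintegral_cst// mul0r addr_gt0.
have at_ nu' : level_set h phi d (mkseq n k.+1) nu' ->
    exists2 t : Y, M k t & nu_ t = nu'.
  move=> nu'M; have Nnu' := level_set_sub N_phi nu'M.
  by exists (SigSub (mem_set Nnu')).
case: (@ncap k.+1) => e e0; exists f.
  split=> //; first exact: (C01_bm Cf).1.
  move=> nu' /at_[t Mt <-].
  rewrite -ge0_Rintegral_EFin//; last exact: C01_bm.
  rewrite lee_fin -[leRHS]mul1r -ler_pdivrMr//.
  by rewrite (le_trans _ (ltW (lt1 _ Mt)))// lerDl c_ge0.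
have [t Mt _] := at_ _ nuM.
have cf1 : c f < 1 by rewrite (le_lt_trans _ (lt1 _ Mt))// lerDr divr_ge0 ?I_ge0 ?ltW.
rewrite ltr_wpDr ?(ltW e0)//; move: cf1; rewrite /c ltr_pdivrMr// mul1r.
apply: le_lt_trans; apply: le_Rintegral => //.
- apply: bounded_measurable_integrable => //.
  under eq_fun do rewrite expr2.
  by apply: bounded_measurableM; exact: C01_bm1.
- exact/bounded_measurable_integrable/C01_bm1.
- by move=> x _; have /andP[? ?] := f01 x; rewrite expr2 ler_piMl//; lra.
Qed.

Let F_bounded g : F g -> exists C, forall t, M 0 t -> `|g t| <= C.
Proof.
move=> [f Cf <-]; exists ((n 0%N)%:R / delta + c f) => t /branch_setP[p [_ tp]].
have [_ nt _] := tp 0%N (leqnn 0).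
rewrite ger0_norm; last by rewrite addr_ge0 ?c_ge0// divr_ge0 ?I_ge0// ltW.
by rewrite lerD2r ler_pM2r ?invr_gt0// (le_trans (I_le_norm _ _)).
Qed.

Let F_convex g1 g2 t : F g1 -> F g2 -> 0 <= t <= 1 ->
  exists2 g, F g & forall y, M 0 y -> g y <= t * g1 y + (1 - t) * g2 y.
Proof.
move=> [f1 C1 <-] [f2 C2 <-] /andP[t0 t1].
pose f x := t * f1 x + (1 - t) * f2 x.
have Cf : C01 f.
  have [cf1 f1_01] := C1; have [cf2 f2_01] := C2; split.
    move=> x; apply: cvgD; apply: cvgM; do ?[exact: cvg_cst|exact: cf1|exact: cf2].
  move=> x; have /andP[? ?] := f1_01 x; have /andP[? ?] := f2_01 x.
  by rewrite /f; apply/andP; split; nra.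
have bZ (r : R) g : bounded_measurable g ->
    @bounded_measurable _ (baire R X) R (fun x => r * g x).
  by move=> bg; apply: bounded_measurableM => //; exact: bounded_measurable_cst.
have comb (q : {finite_measure set (baire R X) -> \bar R}) (u v : X -> R) :
    @bounded_measurable _ (baire R X) R u ->
    @bounded_measurable _ (baire R X) R v ->
    \int[q]_x (t * u x + (1 - t) * v x) =
    t * (\int[q]_x u x) + (1 - t) * (\int[q]_x v x).
  move=> b1 b2; rewrite RintegralD//; last 2 first.
  - exact/bounded_measurable_integrable/bZ.
  - exact/bounded_measurable_integrable/bZ.
  by rewrite !RintegralZl//; exact: bounded_measurable_integrable.
exists (fun y => I f y / delta + c f); first by exists f.
move=> y _; rewrite /I comb; [|exact: C01_bm..].
have -> : c f = t * c f1 + (1 - t) * c f2.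
  rewrite /c (_ : \int[m]_x (1 - f x) = \int[m]_x
    (t * (1 - f1 x) + (1 - t) * (1 - f2 x))).
    by rewrite comb; [ring|exact: C01_bm1..].
  by apply: eq_Rintegral => x _; rewrite /f; ring.
by rewrite le_eqVlt; apply/orP; left; apply/eqP; ring.
Qed.

Lemma branch_mixture : exists kappa : probability T R,
  (\int[kappa]_t variation (nu_ t) setT <= (n 0)%:R%:E)%E /\
  forall f : X -> R, C01 f -> (1 <= delta^-1%:E *
    (\int[kappa]_t \int[variation (nu_ t)]_x (f x)%:E) + (c f)%:E)%E.
Proof.
have F0 : F !=set0.
  exists (fun t => I (fun=> 1) t / delta + c (fun=> 1)), (fun=> 1) => //.
  by split=> [|x]; [exact: cst_continuous|rewrite ler01 lexx].
have [kappa [kge kle]] := minimax_measure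
  (@branch_set_decr _ _ _ _ h _ phi d n)
  (@branch_set_compact _ _ _ _ h _ _ polishP usco_phi N_phi d n)
  F0 F_bounded F_convex F_ge.
have normM k t : M k t -> norm (nu_ t) <= (n 0)%:R.
  by move=> /branch_setP[p [_ tp]]; have [] := tp 0%N.
pose mx (f : nat -> X -> R) k (t : Y) :=
  \big[Order.max/0]_(i < k) pairing (nu_ t) (f i).
have cmx f k : (forall i, bounded_continuous (f i)) -> continuous (mx f k).
  move=> bf; apply: (@continuous_bigmax _ _ (fun i t => pairing (nu_ t) (f i))) => i.
  exact: continuous_pairing_at.
have mbc (g : Y -> R) : bounded_continuous g ->
    measurable_fun [set: T] (fun t : T => (g t)%:E).
  by move=> bg; apply/measurable_EFinP; exact: (continuous_baire_measurable bg.1).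
exists kappa; split.
- pose g k (t : Y) := Num.min k%:R (Num.max 0 (mx h k t)).
  have bg k : bounded_continuous (g k).
    by apply: bounded_continuous_clip => //; exact: cmx.
  have mx0 k t : 0 <= mx h k t.
    exact: bigmax_ge_id.
  have gE k t : g k t = Num.min k%:R (mx h k t) by rewrite /g max_r.
  have g0 k t : 0 <= g k t by rewrite gE le_min mx0 ler0n.
  have g_norm k t : g k t <= norm (nu_ t).
    have [Vge _] := variation_norm_sup norm_h (measure_at_in t).
    rewrite gE ge_min; apply/orP; right; apply: bigmax_le => [|i _]; last exact: Vge.
    exact: fine_ge0.
  have g_nd t : nondecreasing_seq (fun k => (g k t)%:E).
    apply/nondecreasing_seqP => k; rewrite lee_fin !gE le_min !ge_min ler_nat leqnSn/=.
    apply/orP; right; apply/bigmax_leP; split=> // i _.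
    exact: (le_bigmax 0 (fun i : 'I_k.+1 => pairing (nu_ t) (h i)) (widen_ord (leqnSn k) i)).
  have cvg_g t : (g k t)%:E @[k --> \oo] --> variation (nu_ t) setT.
    rewrite -(fineK (_ : variation (nu_ t) setT \is a fin_num)); last first.
      by rewrite fin_num_measure.
    apply: cvg_EFin; first exact: nearW.
    have [Vge Vlt] := variation_norm_sup norm_h (measure_at_in t).
    apply/cvgrPdist_le => e e0; have [i ie] := Vlt _ e0.
    exists (i + (Num.truncn (norm (nu_ t))).+1).+1 => // k /= ik.
    rewrite ger0_norm ?subr_ge0// lerBlDl -lerBlDr gE le_min; apply/andP; split.
      have : norm (nu_ t) <= k%:R.
        rewrite (le_trans (ltW (truncnS_gt _)))// ler_nat ltnW//.
        by rewrite (leq_ltn_trans _ ik)// leq_addl.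
      by lra.
    have ik' : (i < k)%N by rewrite (leq_trans _ ik)// ltnS leq_addr.
    rewrite (le_trans (ltW ie))//.
    exact: (le_bigmax 0 (fun i : 'I_k => pairing (nu_ t) (h i)) (Ordinal ik')).
  have -> : (\int[kappa]_t variation (nu_ t) setT =
      \int[kappa]_t limn (fun k => (g k t)%:E))%E.
    by apply: eq_integral => t _; apply/esym/cvg_lim.
  rewrite monotone_convergence//; last 2 first.
  + by move=> i; exact: mbc.
  + by move=> i t _; rewrite lee_fin.
  apply: lime_le.
    apply: ereal_nondecreasing_is_cvgn => i l il.
    apply: ge0_le_integral => //.
    + by move=> t _; rewrite lee_fin.
    + exact: mbc.
    + exact: mbc.
    + by move=> t _; exact: g_nd.
  apply: nearW => k; apply: (kle _ _ 0%N) => // t Mt.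
  exact: le_trans (g_norm k t) (normM _ _ Mt).
- move=> f Cf; have [cf f01] := Cf.
  have bcf : bounded_continuous f.
    by split=> //; exists 1 => x; have /andP[f0 f1] := f01 x; rewrite ger0_norm.
  have f0 x : 0 <= f x by have /andP[] := f01 x.
  have bhf i : bounded_continuous (fun x => h i x * f x) by exact: bounded_continuousM.
  pose w j (t : Y) := Num.min (n 0)%:R
    (Num.max 0 (mx (fun i x => h i x * f x) (n j).+1 t)).
  have bw j : bounded_continuous (w j).
    by apply: bounded_continuous_clip => //; exact: cmx.
  have w0 j t : 0 <= w j t by rewrite le_min ler0n le_max lexx.
  have bh' i := bounded_continuous_bm (bh i).
  have mx_le k t : mx (fun i x => h i x * f x) k t <= I f t.
    apply: bigmax_le => [|i _]; first exact: I_ge0.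
    by apply: le_charge_integral_variation => //; exact: C01_bm.
  have w_le j t : w j t <= I f t.
    by rewrite ge_min ge_max mx_le I_ge0// orbT.
  have w_ge j t : M j t -> I f t <= w j t + j.+1%:R^-1.
    move=> Mt; have [p [_ tp]] := branch_setP Mt.
    have [_ _ [i [ij hi]]] := tp j (leqnn j).
    have := variation_le_charge_integral (nu_ t) (bh' i) (C01_bm Cf) (h_le1 i) f01.
    have : pairing (nu_ t) (fun x => h i x * f x) <= w j t.
      have ij' : (i < (n j).+1)%N by rewrite ltnS.
      have := le_bigmax 0 (fun i : 'I_(n j).+1 => pairing (nu_ t) (fun x => h i x * f x)) (Ordinal ij').
      move=> /= hmx; rewrite le_min le_max hmx orbT andbT.
      rewrite (le_trans hmx)// (le_trans (mx_le _ _))//.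
      exact: le_trans (I_le_norm _ Cf) (normM _ _ Mt).
    move=> hw hI; apply: (le_trans hI); apply: lerD => //.
    have aux (x y z : R) : x - y <= z -> x - z <= y by lra.
    exact: aux hi.
  have mI : measurable_fun [set: T] (fun t : T => (I f t)%:E).
    rewrite [G in measurable_fun _ G](_ : _ =
        (fun t : T => \int[variation (nu_ t)]_x (f x)%:E)%E); last first.
      by apply/funext => t; rewrite /I ge0_Rintegral_EFin//; exact: C01_bm.
    apply: measurable_fun_integral_kernel => //.
    by apply/measurable_EFinP; exact: (C01_bm Cf).1.
  have mw j : measurable_fun [set: T] (fun t : T => (w j t)%:E).
    exact: mbc.
  have <- : (\int[kappa]_t (I f t)%:E =
      \int[kappa]_t \int[variation (nu_ t)]_x (f x)%:E)%E.
    apply: eq_integral => t _; rewrite /I ge0_Rintegral_EFin//.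
    exact: C01_bm.
  apply/lee_addgt0Pr => e e0.
  pose j := Num.truncn (delta * e)^-1.
  have je : j.+1%:R^-1 / delta <= e.
    rewrite ler_pdivrMr// mulrC -[leRHS]invrK lef_pV2 ?posrE ?invr_gt0 ?mulr_gt0//.
    exact/ltW/truncnS_gt.
  pose g t := w j t / delta + (j.+1%:R^-1 / delta + c f).
  have k0 : 0 <= j.+1%:R^-1 / delta + c f.
    by rewrite addr_ge0 ?c_ge0// divr_ge0 ?invr_ge0// ltW.
  have g0 t : 0 <= g t by rewrite addr_ge0// divr_ge0// ltW.
  have bg : bounded_continuous g.
    apply: bounded_continuousD; last exact: bounded_continuous_cst.
    by apply: bounded_continuousM => //; exact: bounded_continuous_cst.
  have Ff : F (fun t => I f t / delta + c f) by exists f.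
  apply: (le_trans (kge _ g j Ff bg g0 _)).
    move=> t Mt; rewrite /g addrA -mulrDl lerD2r ler_pM2r ?invr_gt0//.
    exact: w_ge.
  under eq_integral do rewrite /g EFinD mulrC EFinM.
  rewrite ge0_integralD//=; last 2 first.
  + by move=> t _; rewrite -EFinM lee_fin mulr_ge0// invr_ge0 ltW.
  + by apply: measurable_funeM; exact: mw.
  rewrite integral_cst//= probability_setT mule1.
  rewrite ge0_integralZl_EFin//; last 2 first.
  + by move=> t _; rewrite lee_fin.
  + by rewrite invr_ge0 ltW.
  rewrite -addeA; apply: leeD.
    rewrite lee_pmul2l// ?lte_fin ?invr_gt0//.
    apply: ge0_le_integral => //.
    + by move=> t _; rewrite lee_fin.
    + by move=> t _; rewrite lee_fin.
  by rewrite -EFinD lee_fin addrC lerD2l.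
Qed.

End branch.
End singular_measure.

Section singular_null_set.
Context (R : realType) (X : ptopologicalType).
Context (N : set (signed_measure R X)) (N0 : N !=set0).
Local Notation Y := (nonempty_subspace N0).
Local Notation T := (baire R Y).
Local Notation nu_ := (@measure_at R X N N0).
Variable h : nat -> X -> R.
Hypothesis h_cont : forall n, continuous (h n).
Hypothesis h_le1 : forall n x, `|h n x| <= 1.
Hypothesis norm_h : forall nu, N nu -> variation_norm nu =
  ereal_sup (range (fun n => (pairing nu (h n))%:E)).
Variables (P : metricType R) (phi : P -> set (signed_measure R X)).
Hypotheses (polishP : polish P) (usco_phi : usco phi)
  (N_phi : N = \bigcup_p phi p).
Variable m : {finite_measure set (baire R X) -> \bar R}.
Hypothesis m_singular : forall kappa : probability T R,
  (\int[kappa]_t variation (nu_ t) setT < +oo)%E ->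
  exists E : set (baire R X), [/\ measurable E, m (~` E) = 0%E &
    (\int[kappa]_t variation (nu_ t) E = 0)%E].
Local Notation cap := (capacity_le m (fun nu : signed_measure R X => variation nu)).

Let mV := measurable_variation_at (N0 := N0) h_cont h_le1 norm_h.

Lemma capacity_zero (delta a : R) : 0 < delta -> 0 < a -> cap delta N a.
Proof.
have aux (u v w : R) : u - v <= w -> 1 - v <= w + (1 - u) by lra.
have le_add (u v w : R) : u + v <= w -> 0 <= v -> u <= w by lra.
move=> delta0 a0; apply: contrapT => ncap.
have [d dP] : exists d : nat -> P, forall p e, 0 < e -> exists m, ball (d m) e p.
  apply: polish_dense_sequence => //.
  by have [nu] := N0; rewrite N_phi => -[p _ _]; exists p.
have [n {}ncap] := capacity_branch norm_h N_phi dP ncap.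
have [kappa [kn kf]] := branch_mixture N0 h_cont h_le1 norm_h polishP usco_phi
  N_phi delta0 a0 ncap.
have koo : (\int[kappa]_t variation (nu_ t) setT < +oo)%E.
  by rewrite (le_lt_trans kn)// ltry.
have [E [mE mE0 kE0]] := m_singular koo.
pose th := finite_measure_of (mu := mixture mV kappa) koo.
have th_E : th E = 0%E by [].
have mth_oo : (measure_add th m setT < +oo)%E.
  rewrite measure_addE lte_add_pinfty// ltey_eq fin_num_measure//.
pose rho := finite_measure_of mth_oo.
have [r r0 r_lt1] : exists2 r, 0 < r & delta^-1 * r + r / a < 1.
  have da0 : 0 < delta^-1 + a^-1 by rewrite addr_gt0 ?invr_gt0.
  exists ((delta^-1 + a^-1)^-1 / 2); first by rewrite divr_gt0 ?invr_gt0.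
  rewrite [X in _ + X]mulrC -mulrDl mulrA divff ?gt_eqF//.
  by rewrite mul1r invf_lt1// ltr1n.
have [f [cf f01 fr]] := continuous_dense rho mE r0.
have f0 x : 0 <= f x by have /andP[] := f01 x.
have bf : @bounded_measurable _ (baire R X) R f.
  apply: bounded_continuous_bm; split=> //.
  by exists 1 => x; have /andP[_ f1] := f01 x; rewrite ger0_norm.
pose D x := `|\1_E x - f x|.
have bD : @bounded_measurable _ (baire R X) R D.
  have bd : @bounded_measurable _ (baire R X) R (fun x => \1_E x - f x).
    by apply: bounded_measurableB => //; exact: bounded_measurable_indic.
  split; first by apply: measurableT_comp => //; exact: bd.1.
  by have [_ [M DM]] := bd; exists M => x; rewrite normr_id.
have rhoD : \int[rho]_x D x = \int[th]_x D x + \int[m]_x D x.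
  apply: EFin_inj; rewrite EFinD !ge0_Rintegral_EFin//.
  rewrite -ge0_integral_measure_add//; last first.
    by apply/measurable_EFinP; exact: bD.1.
  by move=> x _; rewrite lee_fin normr_ge0.
have thf : \int[th]_x f x <= \int[th]_x D x.
  have -> : \int[th]_x D x = \int[th]_x D x + \int[th]_x (\1_E x : R).
    rewrite [X in _ = _ + X](_ : _ = 0) ?addr0//.
    by rewrite /Rintegral integral_indic// setIT; exact: (congr1 fine th_E).
  rewrite -RintegralD//; last 2 first.
  - exact: bounded_measurable_integrable.
  - exact/bounded_measurable_integrable/bounded_measurable_indic.
  apply: le_Rintegral => //.
  - exact: bounded_measurable_integrable.
  - apply/bounded_measurable_integrable/bounded_measurableD => //.
    exact: bounded_measurable_indic.
  - move=> x _; rewrite /D distrC -lerBlDr; exact: ler_norm.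
have mf : \int[m]_x (1 - f x) <= \int[m]_x D x.
  have -> : \int[m]_x D x = \int[m]_x D x + \int[m]_x (\1_(~` E) x : R).
    rewrite [X in _ = _ + X](_ : _ = 0) ?addr0//.
    have mCE := measurableC mE.
    by rewrite /Rintegral integral_indic// setIT; exact: (congr1 fine mE0).
  have bC : @bounded_measurable _ (baire R X) R \1_(~` E).
    by apply: bounded_measurable_indic; exact: measurableC.
  rewrite -RintegralD//; last 2 first.
  - exact: bounded_measurable_integrable.
  - exact: bounded_measurable_integrable.
  apply: le_Rintegral => //.
  - apply/bounded_measurable_integrable/bounded_measurableB => //.
    exact: bounded_measurable_cst.
  - exact/bounded_measurable_integrable/bounded_measurableD.
  - move=> x _; rewrite (_ : \1_(~` E) x = 1 - \1_E x).
      by apply: aux; exact: ler_norm.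
    by rewrite !indicE in_setC; case: (_ \in _); rewrite ?subrr ?subr0.
have D_ge0 (q : {finite_measure set (baire R X) -> \bar R}) : 0 <= \int[q]_x D x.
  by apply: Rintegral_ge0 => x _; exact: normr_ge0.
have := kf f (conj cf f01).
have -> : (\int[kappa]_t \int[variation (nu_ t)]_x (f x)%:E = (\int[th]_x f x)%:E)%E.
  rewrite ge0_Rintegral_EFin// -(ge0_integral_mixture mV)//.
  by apply/measurable_EFinP; exact: bf.1.
rewrite -EFinM -EFinD lee_fin leNgt => /negP; apply.
have h1 : delta^-1 * (\int[th]_x f x) <= delta^-1 * r.
  rewrite ler_pM2l ?invr_gt0// (le_trans thf)//.
  by apply: le_add (D_ge0 m); rewrite -rhoD.
have h2 : (\int[m]_x (1 - f x)) / a <= r / a.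
  rewrite ler_pM2r ?invr_gt0// (le_trans mf)//.
  by apply: le_add (D_ge0 th); rewrite addrC -rhoD.
exact: le_lt_trans (lerD h1 h2) r_lt1.
Qed.

Lemma singular_null_set : exists B : set (baire R X), [/\ measurable B,
  m (~` B) = 0%E & forall nu, N nu -> variation nu B = 0%E].
Proof.
have e0 k : 0 < 1 / (2 ^ k.+1)%:R :> R by rewrite divr_gt0// ltr0n expn_gt0.
have /choice[f fP] : forall k, exists f : baire R X -> R,
    feasible (fun nu : signed_measure R X => variation nu)
      (1 / (2 ^ k.+1)%:R) N f /\ defect m f < 2 * (1 / (2 ^ k.+1)%:R).
  move=> k; have [f fN fd] := capacity_zero (e0 k) (e0 k) (e0 k).
  by exists f; split=> //; move: fd; lra.
pose A k := [set x : baire R X | f k x <= 1 / 2].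
have bf k : bounded_measurable (f k) := feasible_bm (fP k).1.
have f01 k x : 0 <= f k x <= 1 by have [_ + _] := (fP k).1.
have f_ge0 k x : 0 <= f k x by have /andP[] := f01 k x.
have mA k : measurable (A k).
  have := (bf k).1 measurableT `]-oo, (1 / 2)%R]%classic (measurable_itv _).
  by rewrite setTI; congr measurable; apply/seteqP; split => x /=; rewrite in_itv.
have mS : measurable (lim_sup_set A).
  apply: bigcapT_measurable => i; apply: bigcup_measurable => k _; exact: mA.
exists (~` lim_sup_set A); split; first exact: measurableC.
  rewrite setCK; apply: lim_sup_set_cvg0 => //.
  apply: (@le_lt_trans _ _ (\sum_(k <oo) (8 / (2 ^ k.+1)%:R)%:E)%E); last first.
    by rewrite (le_lt_trans (epsilon_trick0 _ _))// ltry.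
  apply: lee_nneseries => [k *|k *] //.
  have mAk : (\int[m]_x (\1_(A k) x : R))%:E = m (A k).
    rewrite ge0_Rintegral_EFin//; first by rewrite integral_indic// setIT.
    exact: bounded_measurable_indic.
  rewrite -[leLHS]mAk lee_fin.
  have b2 : bounded_measurable (fun x => (1 - f k x) ^+ 2).
    under eq_fun do rewrite expr2.
    by apply: bounded_measurableM; apply: bounded_measurableB => //;
      exact: bounded_measurable_cst.
  have : \int[m]_x (\1_(A k) x : R) <= \int[m]_x (4 * (1 - f k x) ^+ 2).
    apply: le_Rintegral => //.
    - exact/bounded_measurable_integrable/bounded_measurable_indic.
    - apply/bounded_measurable_integrable/bounded_measurableM => //.
      exact: bounded_measurable_cst.
    - move=> x _; rewrite indicE; have [|_] := boolP (x \in A k); last first.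
        by rewrite mulr_ge0// sqr_ge0.
      rewrite inE /A /= => fx; rewrite expr2; nra.
  rewrite RintegralZl//; last exact: bounded_measurable_integrable.
  by have := (fP k).2; rewrite /defect; lra.
move=> nu Nnu.
have -> : ~` lim_sup_set A = \bigcup_i \bigcap_(k >= i) ~` A k.
  by rewrite setC_bigcap; apply: eq_bigcupr => i _; rewrite setC_bigcup.
have mI i : measurable (\bigcap_(k >= i) ~` A k).
  apply: bigcap_measurable => [|k _]; first by exists i => /=.
  exact: measurableC.
apply/eqP; rewrite eq_le measure_ge0 andbT.
apply: (le_trans (measure_sigma_subadditive _ _ _ (@subset_refl _ _))) => //.
  exact: bigcup_measurable.
rewrite eseries0// => i _ _.
apply/eqP; rewrite eq_le measure_ge0 andbT; apply/lee_addgt0Pr => e e_gt0.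
rewrite add0e.
pose k := (i + Num.truncn (2 / e))%N.
have ke : 2 * (1 / (2 ^ k.+1)%:R) <= e.
  rewrite mulrA mulr1 ler_pdivrMr ?ltr0n ?expn_gt0// mulrC -ler_pdivrMr//.
  rewrite (le_trans (ltW (truncnS_gt _)))// ler_nat.
  by rewrite (leq_trans _ (ltnW (ltn_expl _ _)))// ltnS leq_addl.
apply: le_trans (_ : (2 * (1 / (2 ^ k.+1)%:R))%:E <= _)%E; last by rewrite lee_fin.
apply: (@le_trans _ _ (variation nu (~` A k))).
  apply: le_measure; rewrite ?inE//; first exact: measurableC.
  by apply: bigcap_inf => /=; rewrite leq_addr.
have mAC : measurable (~` A k) by exact: measurableC.
have VE : (\int[variation nu]_x (\1_(~` A k) x)%:E = variation nu (~` A k))%E.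
  by rewrite integral_indic// setIT.
rewrite -[leLHS]VE.
apply: (@le_trans _ _ (\int[variation nu]_x (2%:E * (f k x)%:E))%E); last first.
  rewrite ge0_integralZl_EFin//.
  - by rewrite EFinM lee_pmul2l//; have [_ _] := (fP k).1; exact.
  - by move=> x _; rewrite lee_fin.
  - by apply/measurable_EFinP; exact: (bf k).1.
apply: ge0_le_integral => //.
- by apply/measurable_EFinP; exact: measurable_indic.
- by apply: measurable_funeM; apply/measurable_EFinP; exact: (bf k).1.
- move=> x _; rewrite -EFinM lee_fin indicE in_setC.
  have [|xA] := boolP (x \in A k); first by rewrite mulr_ge0.
  move/negP : xA; rewrite inE /A /= => /negP; rewrite -ltNge => fx.
  by rewrite -ler_pdivrMl// mulr1; lra.
Qed.

End singular_null_set.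

(** * Exhaustion *)

Lemma exists_invS_le (R : realType) (e : R) :
  0 < e -> exists n : nat, n.+1%:R^-1 <= e.
Proof.
move=> e0; exists (Num.truncn e^-1); rewrite invf_ple ?posrE//.
exact/ltW/truncnS_gt.
Qed.

Lemma ge0_integral_mnormalize d (T : measurableType d) (R : realType)
    (m : {measure set T -> \bar R}) (P : probability T R) (f : T -> \bar R) :
  (0 < m setT < +oo)%E -> (forall t, 0 <= f t)%E -> measurable_fun setT f ->
  (\int[mnormalize m P]_t f t = (fine (m setT))^-1%:E * \int[m]_t f t)%E.
Proof.
move=> /andP[m0 moo] f0 mf.
have r0 : 0 <= (fine (m setT))^-1 by rewrite invr_ge0 fine_ge0.
transitivity (\int[mscale (NngNum r0) m]_t f t)%E.
  apply: eq_measure_integral => A mA _.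
  rewrite -[LHS]/(mnormalize m P A) /mnormalize gt_eqF// lt_eqF//=.
  by rewrite muleC.
by rewrite ge0_integral_mscale.
Qed.

Lemma countable_mixture d (T : measurableType d) (R : realType)
    (kappa : nat -> probability T R) (L : T -> \bar R) :
  measurable_fun setT L -> (forall t, 0 <= L t)%E ->
  (forall n, \int[kappa n]_t L t < +oo)%E ->
  exists k : probability T R, (\int[k]_t L t < +oo)%E /\
    forall f : T -> \bar R, measurable_fun setT f -> (forall t, 0 <= f t)%E ->
    (\int[k]_t f t = 0)%E -> forall n, (\int[kappa n]_t f t = 0)%E.
Proof.
move=> mL L0 Loo.
have IL0 n : (0 <= \int[kappa n]_t L t)%E by exact: integral_ge0.
pose l n := fine (\int[kappa n]_t L t).
have l0 n : 0 <= l n by rewrite fine_ge0.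
have lE n : (\int[kappa n]_t L t = (l n)%:E)%E.
  by rewrite fineK// ge0_fin_numE.
have pow0 n : 0 < (2 ^ n.+1)%:R :> R by rewrite ltr0n expn_gt0.
pose a n := (1 + l n)^-1 / (2 ^ n.+1)%:R.
have l1 n : 0 < 1 + l n by rewrite ltr_wpDr.
have a0 n : 0 < a n by rewrite divr_gt0// invr_gt0.
have a_ge0 n : 0 <= a n := ltW (a0 n).
pose ms := mseries (fun n => mscale (NngNum (a_ge0 n)) (kappa n)) 0.
have msE f : measurable_fun setT f -> (forall t, 0 <= f t)%E ->
    (\int[ms]_t f t = \sum_(n <oo) (a n)%:E * \int[kappa n]_t f t)%E.
  move=> mf f0; rewrite ge0_integral_measure_series//.
  by apply: eq_eseriesr => n _; rewrite ge0_integral_mscale.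
have a_le n : a n * (1 + l n) = 1 / (2 ^ n.+1)%:R.
  by rewrite /a mulrAC mulVf ?gt_eqF// mul1r.
have term_le n (r : R) : 0 <= r -> r <= 1 + l n ->
    ((a n)%:E * r%:E <= (1 / (2 ^ n.+1)%:R)%:E)%E.
  by move=> r0 rl; rewrite -EFinM lee_fin -a_le ler_pM2l.
have sum_le1 (u : nat -> \bar R) : (forall n, 0 <= u n)%E ->
    (forall n, u n <= (1 / (2 ^ n.+1)%:R)%:E)%E -> (\sum_(n <oo) u n < +oo)%E.
  move=> u0 u1; apply: (@le_lt_trans _ _ 1%:E); last exact: ltry.
  by apply: (le_trans _ (epsilon_trick0 xpredT ler01)); apply: lee_nneseries.
have msT : (ms setT = \sum_(n <oo) (a n)%:E)%E.
  apply: eq_eseriesr => n _; rewrite -[LHS]/((a n)%:E * kappa n setT)%E.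
  by rewrite probability_setT mule1.
have msToo : (ms setT < +oo)%E.
  rewrite msT; apply: sum_le1 => n; first by rewrite lee_fin.
  by have := @term_le n 1 ler01; rewrite mule1; apply; rewrite lerDl.
have msT0 : (0 < ms setT)%E.
  rewrite msT; apply: (@lt_le_trans _ _ (\sum_(0 <= n < 1) (a n)%:E)%E).
    by rewrite big_nat1 lte_fin.
  by apply: nneseries_lim_ge => n _ _; rewrite lee_fin.
have msTb : (0 < ms setT < +oo)%E by rewrite msT0.
have Z0 : 0 < (fine (ms setT))^-1 by rewrite invr_gt0 fine_gt0.
exists (mnormalize ms (kappa 0%N)); split.
  rewrite ge0_integral_mnormalize// lte_mul_pinfty ?lee_fin ?(ltW Z0)//.
  rewrite msE//; apply: sum_le1 => n; first by rewrite mule_ge0// lee_fin.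
  by rewrite lE; apply: term_le; rewrite ?lerDr.
move=> f mf f0; rewrite ge0_integral_mnormalize// => /eqP.
rewrite mule_eq0 eqe gt_eqF//= msE// => /eqP sum0 n.
have t0 j : (0 <= (a j)%:E * \int[kappa j]_t f t)%E.
  by rewrite mule_ge0 ?lee_fin// integral_ge0.
have : ((a n)%:E * \int[kappa n]_t f t <= 0)%E.
  rewrite -sum0 (le_trans _ (nneseries_lim_ge n.+1 _))//.
  by rewrite big_nat_recr//= leeDr// sume_ge0.
rewrite pmule_rle0 ?lte_fin// => h.
by apply/eqP; rewrite eq_le h integral_ge0.
Qed.

Section exhaustion.
Context d d' (T : measurableType d) (X : measurableType d') (R : realType).
Variables (k : T -> {measure set X -> \bar R})
  (mk : forall U, measurable U -> measurable_fun [set: T] (k ^~ U))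
  (m : {finite_measure set X -> \bar R}).
Implicit Type kappa : probability T R.

Definition mixture_null kappa (E : set X) :=
  measurable E /\ mixture mk kappa E = 0%E.

Lemma mixture_null_bigcup kappa (E : nat -> set X) :
  (forall n, mixture_null kappa (E n)) -> mixture_null kappa (\bigcup_n E n).
Proof.
move=> E0; have mE n : measurable (E n) := (E0 n).1.
split; first exact: bigcup_measurable.
apply/eqP; rewrite eq_le measure_ge0 andbT.
apply: (le_trans (measure_sigma_subadditive _ _ _ (@subset_refl _ _))) => //.
  exact: bigcup_measurable.
by rewrite eseries0// => n _ _; exact: (E0 n).2.
Qed.

Lemma mixture_nullU kappa (E F : set X) : mixture_null kappa E ->
  mixture_null kappa F -> mixture_null kappa (E `|` F).
Proof.
move=> nE nF; rewrite -bigcup2E; apply: mixture_null_bigcup => -[//|[//|n]] /=.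
by split; [exact: measurable0|exact: measure0].
Qed.

Let mr (E : set X) := fine (m E).

Let mrK E : measurable E -> (mr E)%:E = m E.
Proof. by move=> mE; rewrite fineK// fin_num_measure. Qed.

Let le_mr E F : measurable E -> measurable F -> E `<=` F -> mr E <= mr F.
Proof. by move=> mE mF EF; rewrite -lee_fin !mrK//; apply: le_measure; rewrite ?inE. Qed.

Lemma maximal_null kappa : exists S, mixture_null kappa S /\
  forall E, mixture_null kappa E -> m (E `\` S) = 0%E.
Proof.
pose A := [set mr E | E in mixture_null kappa].
have A0 : mixture_null kappa set0 by split; [exact: measurable0|exact: measure0].
have hA : has_sup A.
  split; first by exists (mr set0), set0.
  by exists (mr setT) => _ [E [mE _] <-]; exact: le_mr.
have /choice[E EP] : forall n, exists E, mixture_null kappa E /\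
    sup A - n.+1%:R^-1 < mr E.
  move=> n; have n0 : 0 < n.+1%:R^-1 :> R by rewrite invr_gt0.
  by have [_ [E nE <-] hE] := sup_adherent n0 hA; exists E.
pose S := \bigcup_n E n.
have nS : mixture_null kappa S by apply: mixture_null_bigcup => n; exact: (EP n).1.
have supS : sup A <= mr S.
  apply/ler_addgt0Pr => e e0; have [n ne] := exists_invS_le e0.
  have EnS : mr (E n) <= mr S.
    by apply: le_mr; [exact: (EP n).1.1|exact: nS.1|exact: bigcup_sup].
  have h : sup A - n.+1%:R^-1 <= mr S := le_trans (ltW (EP n).2) EnS.
  by rewrite (le_trans _ (lerD h ne))// subrK.
exists S; split=> // F nF.
have mFS : measurable (F `\` S) by apply: measurableD; [exact: nF.1|exact: nS.1].
have nFS := mixture_nullU nF nS.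
have : mr (F `|` S) <= sup A by apply: ub_le_sup; [exact: hA.2|exists (F `|` S)].
have : mr (F `|` S) = mr (F `\` S) + mr S.
  apply: EFin_inj; rewrite EFinD !mrK//; [|exact: nS.1|exact: nFS.1].
  rewrite -measureU//; [|exact: nS.1|by rewrite setDKI].
  congr (m _); apply/seteqP; split => x [Fx|]; last by right.
  - by have [Sx|nSx] := pselect (S x); [right|left].
  - by right.
  - by left; case: Fx.
have : 0 <= mr (F `\` S) by rewrite fine_ge0.
by move=> h0 h1 h2; rewrite -mrK//; congr EFin; lra.
Qed.

End exhaustion.

Section exhaustion_kernel.
Context d d' (T : measurableType d) (X : measurableType d') (R : realType).
Variables (k : T -> {measure set X -> \bar R})
  (mk : forall U, measurable U -> measurable_fun [set: T] (k ^~ U))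
  (m : {finite_measure set X -> \bar R}).

Let K (kappa : probability T R) := (\int[kappa]_t k t setT < +oo)%E.

Lemma exhaustion (kappa0 : probability T R) : K kappa0 ->
  exists kappa S, [/\ K kappa, mixture_null mk kappa S,
    forall E, mixture_null mk kappa E -> m (E `\` S) = 0%E &
    forall kappa', K kappa' -> exists E, mixture_null mk kappa' E /\
      m (S `\` E) = 0%E].
Proof.
move=> K0.
have /choice[S SP] := maximal_null mk m.
have mS a : measurable (S a) := (SP a).1.1.
pose e a := fine (m (S a)).
have eE a : (e a)%:E = m (S a) by rewrite fineK// fin_num_measure.
have dom (u : nat -> probability T R) : (forall n, K (u n)) -> exists a,
    K a /\ forall E, mixture_null mk a E -> forall n, mixture_null mk (u n) E.
  move=> Ku; have [a [Ka aP]] :=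
    countable_mixture (mk measurableT) (fun t => measure_ge0 (k t) setT) Ku.
  exists a; split=> // E [mE E0] n; split=> //.
  exact: (aP (fun t => k t E) (mk mE) (fun t => measure_ge0 (k t) E) E0 n).
have le_e a b : (forall E, mixture_null mk a E -> mixture_null mk b E) ->
    e a <= e b.
  move=> ab; rewrite -lee_fin !eE.
  have := (SP b).2 _ (ab _ (SP a).1) => SD.
  rewrite -(setDUK (@subIsetl _ (S a) (S b))) -[leRHS]add0e -SD.
  rewrite measureU//; last 3 first.
  - exact: measurableI.
  - by apply: measurableD => //; exact: measurableI.
  - exact: setDIK.
  rewrite addeC setDIr setDv set0U; apply: leeD => //.
  by apply: le_measure; rewrite ?inE//; exact: measurableI.
have hI : has_inf [set e a | a in K].
  split; first by exists (e kappa0), kappa0.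
  by exists 0 => _ [a _ <-]; rewrite fine_ge0.
have /choice[u uP] : forall n, exists a, K a /\
    e a < inf [set e a | a in K] + n.+1%:R^-1.
  move=> n; have n0 : 0 < n.+1%:R^-1 :> R by rewrite invr_gt0.
  by have [_ [a Ka <-] ha] := inf_adherent n0 hI; exists a.
have [kappa [Kk kP]] := dom u (fun n => (uP n).1).
have ek : e kappa <= inf [set e a | a in K].
  apply/ler_addgt0Pr => eps e0; have [n ne] := exists_invS_le e0.
  rewrite (le_trans (le_e kappa (u n) _))//; first by move=> E /kP.
  by rewrite (le_trans (ltW (uP n).2))// lerD2l.
exists kappa, (S kappa); split=> //; [exact: (SP kappa).1|exact: (SP kappa).2|].
move=> kappa' K'.
pose v n := if n is 0%N then kappa else kappa'.
have Kv n : K (v n) by case: n.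
have [b [Kb bP]] := dom v Kv.
exists (S b); split; first exact: (bP _ (SP b).1 1%N).
have bk : m (S b `\` S kappa) = 0%E := (SP kappa).2 _ (bP _ (SP b).1 0%N).
have : e kappa <= e b by rewrite (le_trans ek)//; apply: ge_inf; [exact: hI.2|exists b].
rewrite -lee_fin !eE => h.
have Eb : m (S b) = m (S kappa `&` S b).
  have EB := measureDI m (mS b) (mS kappa).
  by rewrite [LHS]EB [X in (X + _)%E]bk add0e setIC.
have {}h : (m (S kappa `\` S b) + m (S kappa `&` S b) <= m (S kappa `&` S b))%E.
  have := measureDI m (mS kappa) (mS b) => EK.
  by rewrite -[leRHS]Eb -[leLHS]EK.
apply/eqP; rewrite eq_le measure_ge0 andbT.
have fI : (m (S kappa `&` S b) \is a fin_num)%E.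
  by apply: fin_num_measure; exact: measurableI.
by rewrite -(leeD2rE _ _ fI) add0e.
Qed.

End exhaustion_kernel.

(** * Mixtures without cancellation *)

Section dominated_density.
Context d (X : measurableType d) (R : realType).
Variables (rho alpha : {finite_measure set X -> \bar R}).

Lemma dominated_density : (forall A, measurable A -> (alpha A <= rho A)%E) ->
  exists s : X -> R, [/\ measurable_fun [set: X] s, forall x, 0 <= s x <= 1 &
    forall E, measurable E -> alpha E = (\int[rho]_(x in E) (s x)%:E)%E].
Proof.
move=> alpha_le.
have dom : alpha `<< rho.
  apply/null_content_dominatesP => A mA rA0.
  by apply/eqP; rewrite eq_le measure_ge0 andbT -rA0 alpha_le.
have [f0 [f0_ge0 f0_fin /integrableP[mf0 _] f0E]] := radon_nikodym_sigma_finite dom.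
have [f [f_ge0 mf fE]] : exists f : X -> R, [/\ forall x, 0 <= f x,
    measurable_fun setT f &
    forall E, measurable E -> alpha E = (\int[rho]_(x in E) (f x)%:E)%E].
  exists (fun x => fine (f0 x)); split=> [x||E mE]; first exact: fine_ge0.
    exact: measurableT_comp.
  by rewrite f0E//; apply: eq_integral => x _; rewrite fineK.
pose s x := Num.min (f x) 1.
pose e x := Num.max (f x - 1) 0.
pose A := f @^-1` `]1, +oo[.
have mA : measurable A by rewrite -[A]setTI; exact: mf.
have ms : measurable_fun setT s by exact: measurable_minr.
have me : measurable_fun setT e.
  by apply: measurable_maxr => //; exact: measurable_funB.
have s01 x : 0 <= s x <= 1 by rewrite /s le_min f_ge0 ler01 ge_min lexx orbT.
have e_ge0 x : 0 <= e x by rewrite /e le_max lexx orbT.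
have fse x : f x = s x + e x.
  by rewrite /s /e; case: (leP (f x)) => ?; case: (leP (f x - 1)) => ?; lra.
have mEF (g : X -> R) D : measurable_fun setT g -> measurable_fun D (EFin \o g).
  by move=> mg; apply/measurable_EFinP; apply: measurable_funTS.
(* The excess [e] of [f] over 1 integrates to 0, as [alpha A <= rho A] for
   [A = {f > 1}]. *)
have split_f E : measurable E ->
    alpha E = (\int[rho]_(x in E) (s x)%:E + \int[rho]_(x in E) (e x)%:E)%E.
  move=> mE; rewrite fE//; under eq_integral do rewrite fse EFinD.
  rewrite ge0_integralD//; try exact: mEF.
    by move=> x _; rewrite lee_fin; have /andP[] := s01 x.
  by move=> x _; rewrite lee_fin.
have eA : (\int[rho]_x (e x)%:E = \int[rho]_(x in A) (e x)%:E)%E.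
  rewrite [RHS]integral_mkcond; apply: eq_integral => x _; rewrite patchE.
  case: ifPn => //; rewrite notin_setE /A/= in_itv/= andbT /e => /negP.
  by rewrite -leNgt => f1; rewrite max_r// subr_le0.
have sA : (\int[rho]_(x in A) (s x)%:E = rho A)%E.
  rewrite -[RHS]mul1e -integral_cst//; apply: eq_integral => x.
  by rewrite inE /A/= in_itv/= andbT /s => f1; rewrite min_r// ltW.
have eA_ge0 : (0 <= \int[rho]_(x in A) (e x)%:E)%E.
  by apply: integral_ge0 => x _; rewrite lee_fin.
have e0 : (\int[rho]_x (e x)%:E = 0)%E.
  apply/eqP; rewrite eA eq_le eA_ge0 andbT.
  have rfin : rho A \is a fin_num by rewrite fin_num_measure.
  have := alpha_le _ mA; rewrite split_f// sA => h.
  by rewrite -(leeD2lE _ _ rfin) adde0.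
exists s; split=> // E mE; rewrite split_f//.
suff -> : (\int[rho]_(x in E) (e x)%:E = 0)%E by rewrite adde0.
apply/eqP; rewrite eq_le; apply/andP; split.
  rewrite -e0; apply: ge0_subset_integral => //; first exact: mEF.
  by move=> x _; rewrite lee_fin.
by apply: integral_ge0 => x _; rewrite lee_fin.
Qed.

End dominated_density.

Section generic_series.
Context d (X : measurableType d) (R : realType).
Variables (rho : {finite_measure set X -> \bar R}) (s : nat -> X -> R).
Hypothesis ms : forall n, measurable_fun [set: X] (s n).
Hypothesis s_le1 : forall n x, `|s n x| <= 1.

Let small (S : X -> R) (eta : R) := [set x | 0 < `|S x| <= eta].

Let measurable_small S eta : measurable_fun [set: X] S -> measurable (small S eta).
Proof.
move=> mS; have -> : small S eta = (fun x => `|S x|) @^-1` `]0, eta].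
  by apply/seteqP; split => x; rewrite /small/= in_itv.
by rewrite -[X in measurable X]setTI; apply: measurableT_comp.
Qed.

Let exists_eta (S : X -> R) (eta eps : R) : measurable_fun [set: X] S ->
  0 < eta -> 0 < eps ->
  exists eta', 0 < eta' <= eta /\ (rho (small S eta') <= eps%:E)%E.
Proof.
move=> mS eta0 eps0; pose F n := small S (eta / n.+1%:R).
have mF n : measurable (F n) by exact: measurable_small.
have F0 : \bigcap_n F n = set0.
  apply/seteqP; split => // x Fx.
  have /andP[Sx0 _] := Fx 0%N I.
  have [n] := exists_invS_le (divr_gt0 Sx0 (mulr_gt0 eta0 (ltr0n R 2))).
  have /andP[_ SxF] := Fx n I.
  rewrite ler_pdivlMr ?mulr_gt0// => h.
  have : `|S x| <= eta * n.+1%:R^-1 := SxF.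
  move: h; rewrite mulrA [_ * eta]mulrC; move: Sx0.
  by move: (`|S x|) (eta * _) => a b; lra.
have cF : (rho \o F) n @[n --> \oo] --> 0%E.
  rewrite -(measure0 rho) -F0; apply: nonincreasing_cvg_mu => //.
  - by rewrite ltey_eq fin_num_measure.
  - by rewrite F0.
  - move=> a b ab; apply/subsetPset => x /andP[Sx0 Sx]; rewrite /F /small/= Sx0/=.
    by rewrite (le_trans Sx)// ler_pM2l// lef_pV2 ?posrE// ler_nat.
have /cF[n _ /(_ n (leqnn n))] : nbhs (0 : \bar R)%E [set y | (y < eps%:E)%E].
  by apply: open_nbhs_nbhs; split; [exact: open_ereal_lt_ereal|rewrite /= lte_fin].
move=> /ltW/= rn; exists (eta / n.+1%:R); split=> //.
by rewrite divr_gt0//= ler_pdivrMr// ler_peMr ?ler1n// ltW.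
Qed.

(* Outside of a set of measure at most [2 ^ -(n + 1)], a nonzero partial sum [S n]
   exceeds [eta n] in absolute value; as [c k <= eta k / 2 ^ (k + 1)], the
   remaining terms cannot cancel it. *)
Lemma generic_series : exists c : nat -> R,
  (forall n, 0 < c n <= (2 ^ n.+1)%:R^-1) /\
  exists M, [/\ measurable M, rho M = 0%E &
    forall x, ~ M x -> (forall n, exists2 k, (n <= k)%N & s k x != 0) ->
    ~ ((\sum_(k < n) c k * s k x) @[n --> \oo] --> 0)].
Proof.
pose w n : R := (2 ^ n.+1)%:R^-1.
have w0 n : 0 < w n by rewrite invr_gt0 ltr0n expn_gt0.
have /choice[pick pickP] : forall q : (X -> R) * R * nat, exists eta',
    measurable_fun setT q.1.1 -> 0 < q.1.2 ->
    0 < eta' <= q.1.2 /\ (rho (small q.1.1 eta') <= (w q.2)%:E)%E.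
  move=> [[S eta] n]/=; have [mS|nS] := pselect (measurable_fun setT S); last by exists 0.
  have [eta0|neta] := pselect (0 < eta); last by exists 0.
  by have [e eP] := exists_eta mS eta0 (w0 n); exists e.
pose next (n : nat) (q : (X -> R) * R) :=
  let S := fun x => q.1 x + w n * q.2 * s n x in (S, pick (S, q.2, n.+1)).
pose st := nat_rect (fun=> ((X -> R) * R)%type)
  (fun=> 0, pick (fun=> 0, 1, 0%N)) next.
pose S n := (st n).1; pose eta n := (st n).2; pose c n := w n * eta n.
have SS n x : S n.+1 x = S n x + c n * s n x by [].
have etaS n : eta n.+1 = pick (S n.+1, eta n, n.+1) by [].
have inv n : [/\ measurable_fun setT (S n), 0 < eta n <= 1 &
    (rho (small (S n) (eta n)) <= (w n)%:E)%E].
  elim: n => [|n [mS /andP[eta0 eta1] _]].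
    have mS : measurable_fun setT (S 0%N) by exact: measurable_cst.
    by have [] := pickP (S 0%N, 1, 0%N) mS ltr01.
  have mS' : measurable_fun setT (S n.+1).
    apply: measurable_funD => //; apply: measurable_funM => //.
  have [/andP[h1 h2] h3] := pickP (S n.+1, eta n, n.+1) mS' eta0.
  by split=> //; rewrite etaS h1 (le_trans h2).
have eta_gt0 n : 0 < eta n by have [_ /andP[]] := inv n.
have eta_decr n : eta n.+1 <= eta n.
  have [mS _ _] := inv n.+1.
  by have [/andP[]] := pickP (S n.+1, eta n, n.+1) mS (eta_gt0 n).
have c0 n : 0 < c n by exact: mulr_gt0.
exists c; split.
  move=> n; rewrite c0/= /c ler_piMr//; first exact: ltW.
  by have [_ /andP[]] := inv n.
pose B n := small (S n) (eta n).
have mB n : measurable (B n) by have [mS _ _] := inv n; exact: measurable_small.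
exists (lim_sup_set B); split.
- by apply: bigcap_measurable => // n _; apply: bigcup_measurable => k _.
- apply: lim_sup_set_cvg0 => //.
  apply: (@le_lt_trans _ _ 1%:E); last exact: ltry.
  apply: (le_trans _ (epsilon_trick0 xpredT ler01)).
  by apply: lee_nneseries => // n _; rewrite div1r; have [] := inv n.
move=> x nM s_io.
have [n0 n0B] : exists n0, forall n, (n0 <= n)%N -> ~ B n x.
  have [n0 n0B] : exists n0, ~ (\bigcup_(j >= n0) B j) x.
    by apply/existsNP => h; apply: nM => n _; exact: h.
  by exists n0 => n n0n Bn; apply: n0B; exists n.
have [n n0n Sn0] : exists2 n, (n0 <= n)%N & S n x != 0.
  have [k n0k sk0] := s_io n0; have [Sk0|Sk0] := eqVneq (S k x) 0; last by exists k.
  exists k.+1; first exact: leqW.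
  by rewrite SS Sk0 add0r mulf_neq0// gt_eqF.
have Sn : eta n < `|S n x|.
  rewrite ltNge; apply/negP => h; apply: (n0B n n0n).
  by rewrite /B /small/= normr_gt0 Sn0.
have tail p : `|S (n + p)%N x - S n x| <= eta n * (1 - (2 ^ p)%:R^-1) /\
    eta (n + p)%N <= eta n.
  elim: p => [|p [IH1 IH2]].
    by rewrite addn0 subrr normr0 expn0 invr1 subrr mulr0.
  rewrite addnS; split; last exact: le_trans (eta_decr _) IH2.
  rewrite SS addrAC.
  have h1 : `|c (n + p)%N * s (n + p)%N x| <= eta n * (2 ^ p.+1)%:R^-1.
    rewrite normrM gtr0_norm// (@le_trans _ _ (c (n + p)%N))//.
      by rewrite ler_piMr// ltW.
    rewrite /c mulrC ler_pM//; [exact: ltW|exact: ltW|].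
    by rewrite /w lef_pV2 ?posrE ?ltr0n ?expn_gt0// ler_nat leq_exp2l// ltnS leq_addl.
  rewrite (le_trans (ler_normD _ _))// (le_trans (lerD IH1 h1))//.
  rewrite -mulrDr ler_pM2l// expnS natrM invfM.
  by move: ((2 ^ p)%:R^-1) => a; lra.
have SE m : \sum_(k < m) c k * s k x = S m x.
  elim: m => [|m IH]; first by rewrite big_ord0.
  by rewrite big_ord_recr/= IH SS.
under eq_fun do rewrite SE.
move=> S0.
have /S0 : nbhs (0 : R) [set y | `|y| < `|S n x| - eta n].
  by apply: (@nbhs0_lt R R); rewrite subr_gt0.
move=> [m _ /(_ (n + m)%N (leq_addl _ _))]/=.
apply/negP; rewrite -leNgt.
have [tm _] := tail m.
have tm' : `|S (n + m)%N x - S n x| <= eta n.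
  by rewrite (le_trans tm)// ler_piMr ?(ltW (eta_gt0 n))// gerBl invr_ge0.
have := ler_normB (S (n + m)%N x) (S (n + m)%N x - S n x).
rewrite opprB addrC subrK => h.
by rewrite lerBlDr (le_trans h)// lerD2l.
Qed.

End generic_series.

Lemma ge0_integral_mrestr d (T : measurableType d) (R : realType)
    (m : {measure set T -> \bar R}) (A : set T) (mA : measurable A)
    (f : T -> \bar R) :
  measurable_fun setT f -> (forall t, 0 <= f t)%E ->
  (\int[mrestr m mA]_t f t = \int[m]_(t in A) f t)%E.
Proof.
move=> mf f0; rewrite -(setUv A) ge0_integral_setU//; last 3 first.
- exact: measurableC.
- by rewrite setUv.
- by apply/disj_setPCl.
rewrite [X in (_ + X)%E = _](_ : _ = 0%E); last first.
  apply: null_set_integral; first exact: measurableC.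
    exact: measurable_funTS.
  by rewrite -[LHS]/(m (~` A `&` A)) setICl measure0.
rewrite adde0; apply: eq_measure_integral => B mB BA.
by rewrite -[LHS]/(m (B `&` A)) (setIidl BA).
Qed.

Lemma ge0_integral_mixture_in d d' (T : measurableType d)
    (X : measurableType d') (R : realType) (k : T -> {measure set X -> \bar R})
    (mk : forall U, measurable U -> measurable_fun [set: T] (k ^~ U))
    (kappa : {measure set T -> \bar R}) (E : set X) (f : X -> \bar R) :
  measurable E -> (forall x, 0 <= f x)%E -> measurable_fun setT f ->
  (\int[mixture mk kappa]_(x in E) f x =
   \int[kappa]_t \int[k t]_(x in E) f x)%E.
Proof.
move=> mE f0 mf; rewrite [LHS]integral_mkcond ge0_integral_mixture.
- by apply: eq_integral => t _; rewrite [RHS]integral_mkcond.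
- by move=> x; rewrite patchE; case: ifP.
- by apply/(measurable_restrict _ mE measurableT).1; exact: measurable_funTS.
Qed.

Lemma exists_nat_pair_index : exists idx : nat -> nat * nat,
  forall q n0, exists2 n, (n0 <= n)%N & idx n = q.
Proof.
exists (fun n => oapp fst (0%N, 0%N) (@unpickle (nat * nat * nat)%type n)) => q n0.
pose g j := pickle (q, j : nat).
have [j gj] : exists j, (n0 <= g j)%N.
  apply: contrapT => /forallNP small.
  have g_inj : injective g by move=> a b /(pcan_inj pickleK)[].
  have : (size (map g (iota 0 n0.+1)) <= size (iota 0 n0))%N.
    apply: uniq_leq_size; first by rewrite map_inj_uniq// iota_uniq.
    move=> _ /mapP[j _ ->]; rewrite mem_iota/= add0n ltnNge.
    exact/negP.
  by rewrite size_map !size_iota ltnn.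
by exists (g j) => //; rewrite /g pickleK.
Qed.

Section cancellation_free_mixture.
Context d d' (T : measurableType d) (X : measurableType d') (R : realType).
Variables (p q L : T -> {measure set X -> \bar R})
  (mp : forall U, measurable U -> measurable_fun [set: T] (p ^~ U))
  (mq : forall U, measurable U -> measurable_fun [set: T] (q ^~ U))
  (mL : forall U, measurable U -> measurable_fun [set: T] (L ^~ U)).
Hypothesis Lpq : forall t U, measurable U -> (L t U = p t U + q t U)%E.
Variables (f : nat -> X -> R) (D : nat -> nat -> set T).
Hypothesis mf : forall i, measurable_fun setT (f i).
Hypothesis f02 : forall i x, 0 <= f i x <= 2.
Hypothesis mD : forall i k, measurable (D i k).
Hypothesis cover_D : forall k, \bigcup_i D i k = setT.
Hypothesis pq_D : forall i k t E, D i k t -> measurable E ->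
  (p t E + p t E + \int[q t]_(x in E) (f i x)%:E <=
   k.+1%:R^-1%:E + \int[p t]_(x in E) (f i x)%:E)%E.

Lemma cancellation_free_mixture (kappa : probability T R) :
  (\int[kappa]_t L t setT < +oo)%E ->
  exists lam : probability T R, (\int[lam]_t L t setT < +oo)%E /\
    forall E, measurable E ->
    (forall E', measurable E' -> E' `<=` E ->
      mixture mp lam E' = mixture mq lam E') ->
    mixture mL kappa E = 0%E.
Proof.
move=> Loo.
pose theta := finite_measure_of (mu := mixture mL kappa) Loo.
pose A k := seqDU (fun i => D i k).
have mA k i : measurable (A k i) by exact: seqDU_measurable.
have pL t U : measurable U -> (p t U <= L t U)%E.
  by move=> mU; rewrite Lpq// leeDl.
have qL t U : measurable U -> (q t U <= L t U)%E.
  by move=> mU; rewrite Lpq// leeDr.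
have mLE U : mixture mL kappa U = (\int[kappa]_t L t U)%E by [].
have density (r : T -> {measure set X -> \bar R})
    (mr : forall U, measurable U -> measurable_fun [set: T] (r ^~ U)) k i :
    (forall t U, measurable U -> (r t U <= L t U)%E) ->
    exists s : X -> R, [/\ measurable_fun [set: X] s, forall x, 0 <= s x <= 1 &
      forall E, measurable E ->
      (\int[kappa]_(t in A k i) r t E = \int[theta]_(x in E) (s x)%:E)%E].
  move=> rL; pose al := mixture mr (mrestr kappa (mA k i)).
  have alE E : measurable E -> al E = (\int[kappa]_(t in A k i) r t E)%E.
    by move=> mE; rewrite -ge0_integral_mrestr//; exact: (mr _ mE).
  have al_le E : measurable E -> (al E <= theta E)%E.
    move=> mE; rewrite alE//; apply: (@le_trans _ _ (\int[kappa]_t r t E)%E).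
      by apply: ge0_subset_integral => //; exact: (mr _ mE).
    apply: ge0_le_integral => //; [exact: (mr _ mE)|exact: mL|].
    by move=> t _; exact: rL.
  have alfin : (al setT < +oo)%E by apply: le_lt_trans (al_le _ measurableT) _.
  have [s [ms s01 sE]] := @dominated_density _ X R theta (finite_measure_of alfin) al_le.
  by exists s; split=> // E mE; rewrite -sE// -alE.
have /choice[u uP] : forall n : nat * nat, exists s : X -> R,
    [/\ measurable_fun [set: X] s, forall x, 0 <= s x <= 1 &
      forall E, measurable E ->
      (\int[kappa]_(t in A n.1 n.2) p t E = \int[theta]_(x in E) (s x)%:E)%E].
  by move=> n; exact: density.
have /choice[v vP] : forall n : nat * nat, exists s : X -> R,
    [/\ measurable_fun [set: X] s, forall x, 0 <= s x <= 1 &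
      forall E, measurable E ->
      (\int[kappa]_(t in A n.1 n.2) q t E = \int[theta]_(x in E) (s x)%:E)%E].
  by move=> n; exact: density.
have [idx idxP] := exists_nat_pair_index.
have mu_ a : measurable_fun setT (u a) by have [] := uP a.
have mv_ a : measurable_fun setT (v a) by have [] := vP a.
have u01 a x : 0 <= u a x <= 1 by have [_ ->] := uP a.
have v01 a x : 0 <= v a x <= 1 by have [_ ->] := vP a.
pose s n x := u (idx n) x - v (idx n) x.
have ms n : measurable_fun setT (s n) by exact: measurable_funB.
have s_le1 n x : `|s n x| <= 1.
  have /andP[? ?] := u01 (idx n) x; have /andP[? ?] := v01 (idx n) x.
  by rewrite /s ler_norml; apply/andP; split; lra.
have [c [c_le [M [mM M0 MP]]]] := generic_series theta ms s_le1.
have c_ge0 n : 0 <= c n by have /andP[/ltW] := c_le n.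
pose lam0 := mseries (fun n =>
  mscale (NngNum (c_ge0 n)) (mrestr kappa (mA (idx n).1 (idx n).2))) 0.
have lam0E (g : T -> \bar R) : measurable_fun setT g -> (forall t, 0 <= g t)%E ->
    (\int[lam0]_t g t =
     \sum_(n <oo) (c n)%:E * \int[kappa]_(t in A (idx n).1 (idx n).2) g t)%E.
  move=> mg g0; rewrite ge0_integral_measure_series//.
  by apply: eq_eseriesr => n _; rewrite ge0_integral_mscale// ge0_integral_mrestr.
have sum_le (g : nat -> \bar R) (r : R) : 0 <= r -> (forall n, 0 <= g n <= r%:E)%E ->
    (\sum_(n <oo) (c n)%:E * g n <= r%:E)%E.
  move=> r0 gr; apply: (le_trans _ (epsilon_trick0 xpredT r0)).
  apply: lee_nneseries => n _ => [_|].
    by have /andP[g0 _] := gr n; rewrite mule_ge0// lee_fin.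
  rewrite mulrC EFinM; have /andP[g0 gn] := gr n.
  by apply: lee_pmul; rewrite ?lee_fin//; have /andP[] := c_le n.
have A1 k i : (kappa (A k i) <= 1)%E by exact: probability_le1.
have lam0T : (lam0 setT = \sum_(n <oo) (c n)%:E * kappa (A (idx n).1 (idx n).2))%E.
  rewrite -[LHS]mul1e -integral_cst// lam0E//.
  by apply: eq_eseriesr => n _; rewrite integral_cst ?mul1e.
have lam0_gt0 : (0 < lam0 setT)%E.
  have [i Ai] : exists i, (0 < kappa (A 0%N i))%E.
    apply: contrapT => /forallNP A0; have := oner_neq0 R; apply/negP; rewrite negbK.
    rewrite -(@eqe R) -(probability_setT kappa) -(cover_D 0) seqDU_bigcup_eq.
    rewrite measure_bigcup//; last by move=> i _; exact: mA.
    rewrite eseries0// => i _ _; apply/eqP.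
    by rewrite eq_le measure_ge0 andbT leNgt; exact/negP/A0.
  have [n _ nE] := idxP (0%N, i) 0%N.
  rewrite lam0T (@lt_le_trans _ _ ((c n)%:E * kappa (A 0%N i))%E)//.
    by rewrite mule_gt0// lte_fin; have /andP[] := c_le n.
  have t_ge0 m : (0 <= (c m)%:E * kappa (A (idx m).1 (idx m).2))%E.
    by rewrite mule_ge0// lee_fin.
  rewrite (le_trans _ (nneseries_lim_ge n.+1 _))//.
  by rewrite big_nat_recr//= nE leeDr// sume_ge0.
have lam0_lty : (lam0 setT < +oo)%E.
  rewrite lam0T (@le_lt_trans _ _ 1%:E)//; last exact: ltry.
  by apply: sum_le => // n; rewrite measure_ge0 A1.
have lam0b : (0 < lam0 setT < +oo)%E by rewrite lam0_gt0.
have Z0 : 0 < (fine (lam0 setT))^-1 by rewrite invr_gt0 fine_gt0.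
have lamE (g : T -> \bar R) : measurable_fun setT g -> (forall t, 0 <= g t)%E ->
    (\int[mnormalize lam0 kappa]_t g t = (fine (lam0 setT))^-1%:E *
     \sum_(n <oo) (c n)%:E * \int[kappa]_(t in A (idx n).1 (idx n).2) g t)%E.
  by move=> mg g0; rewrite ge0_integral_mnormalize// lam0E.
exists (mnormalize lam0 kappa); split.
  rewrite lamE//; last exact: mL.
  rewrite lte_mul_pinfty ?lee_fin ?(ltW Z0)//.
  have L0 : (0 <= \int[kappa]_t L t setT)%E by exact: integral_ge0.
  have Lfin : (\int[kappa]_t L t setT)%E \is a fin_num by rewrite ge0_fin_numE.
  rewrite (@le_lt_trans _ _ (fine (\int[kappa]_t L t setT))%:E)//; last exact: ltry.
  apply: sum_le; first exact: fine_ge0.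
  move=> n; rewrite integral_ge0//= fineK//.
  by apply: ge0_subset_integral => //; exact: mL.
move=> E mE eqE.
have int_series (w : nat * nat -> X -> R) (r : T -> {measure set X -> \bar R})
    (mr : forall U, measurable U -> measurable_fun [set: T] (r ^~ U)) E' :
    (forall a, [/\ measurable_fun [set: X] (w a), forall x, 0 <= w a x <= 1 &
      forall E, measurable E -> (\int[kappa]_(t in A a.1 a.2) r t E =
        \int[theta]_(x in E) (w a x)%:E)%E]) -> measurable E' ->
    mixture mr (mnormalize lam0 kappa) E' = ((fine (lam0 setT))^-1%:E *
      \int[theta]_(x in E') (\sum_(n <oo) (c n * w (idx n) x)%:E))%E.
  move=> wP mE'; rewrite [LHS]lamE//; last exact: (mr _ mE').
  congr (_ * _)%E; rewrite integral_nneseries//; last 2 first.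
  - move=> n; apply/measurable_EFinP/measurable_funTS/measurable_funM => //.
    by have [] := wP (idx n).
  - by move=> n x _; rewrite lee_fin mulr_ge0//; have [_ /(_ x)/andP[]] := wP (idx n).
  apply: eq_eseriesr => n _; have [mw w01 ->] := wP (idx n) => //.
  under [RHS]eq_integral do rewrite EFinM.
  rewrite ge0_integralZl ?lee_fin//; first exact/measurable_EFinP/measurable_funTS.
  by move=> x _; rewrite lee_fin; have /andP[] := w01 x.
pose U x := (\sum_(n <oo) (c n * u (idx n) x)%:E)%E.
pose V x := (\sum_(n <oo) (c n * v (idx n) x)%:E)%E.
have series_le1 (w : nat * nat -> X -> R) x : (forall a, 0 <= w a x <= 1) ->
    (0 <= \sum_(n <oo) (c n * w (idx n) x)%:E <= 1)%E.
  move=> w01; apply/andP; split.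
    by apply: nneseries_ge0 => n _ _; rewrite lee_fin mulr_ge0//; have /andP[] := w01 (idx n).
  under eq_eseriesr do rewrite EFinM.
  by apply: (sum_le (fun n => (w (idx n) x)%:E)) => // n; rewrite !lee_fin.
have measurable_series (w : nat * nat -> X -> R) :
    (forall a, measurable_fun setT (w a)) -> (forall a x, 0 <= w a x <= 1) ->
    measurable_fun setT (fun x => \sum_(n <oo) (c n * w (idx n) x)%:E)%E.
  move=> mw w01; apply: ge0_emeasurable_sum => n.
    by move=> x _ _; rewrite lee_fin mulr_ge0//; have /andP[] := w01 (idx n) x.
  by move=> _; apply/measurable_EFinP/measurable_funM.
have pmulI (z : R) (a b : \bar R) : 0 < z -> (z%:E * a = z%:E * b)%E -> a = b.
  move=> z0 /(congr1 (fun y => z^-1%:E * y)%E).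
  by rewrite !muleA -!EFinM mulVf ?gt_eqF// !mul1e.
have UVae : ae_eq theta E U V.
  apply: integral_ae_eq => //.
  - apply: (@le_integrable _ _ _ theta _ mE _ (cst 1%E)).
    + by apply: measurable_funTS; exact: measurable_series.
    + move=> x _; have /andP[U0 U1] := series_le1 u x (fun a => u01 a x).
      by rewrite /= normr1 gee0_abs.
    + exact: (finite_measure_integrable_cst theta 1).
  - by apply: measurable_funTS; exact: measurable_series.
  - move=> E' E'E mE'; have := eqE E' mE' E'E.
    rewrite (int_series u p mp _ uP mE') (int_series v q mq _ vP mE').
    exact: pmulI.
have cvg_partial (w : nat * nat -> X -> R) x : (forall a, 0 <= w a x <= 1) ->
    (\sum_(k < n) c k * w (idx k) x) @[n --> \oo] -->
    fine (\sum_(n <oo) (c n * w (idx n) x)%:E)%E.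
  move=> w01; have /andP[w0 w1] := series_le1 w x w01.
  have wfin : (\sum_(n <oo) (c n * w (idx n) x)%:E)%E \is a fin_num.
    by rewrite ge0_fin_numE// (le_lt_trans w1)// ltry.
  have : (\sum_(0 <= k < n) (c k * w (idx k) x)%:E)%E @[n --> \oo] -->
      (fine (\sum_(n <oo) (c n * w (idx n) x)%:E)%E)%:E.
    rewrite fineK//; apply: is_cvg_nneseries => n _ _.
    by rewrite lee_fin mulr_ge0//; have /andP[] := w01 (idx n).
  move=> /fine_cvg; apply: cvg_trans; apply: near_eq_cvg; apply: nearW => n /=.
  by rewrite sumEFin big_mkord.
have uv_ae : {ae theta, forall x, E x -> forall a, u a x = v a x}.
  have Mae : {ae theta, forall x, ~ M x}.
    by exists M; split=> // x /contrapT.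
  move: UVae Mae; apply: filterS2 => x UV nM Ex a; apply: contrapT => /eqP uva.
  apply: (MP x nM).
    move=> n0; have [n n0n na] := idxP a n0; exists n => //.
    by rewrite /s na subr_eq0.
  have -> : (fun n => \sum_(k < n) c k * s k x) = (fun n =>
      \sum_(k < n) c k * u (idx k) x - \sum_(k < n) c k * v (idx k) x).
    by apply/funext => n; rewrite -sumrB; apply: eq_bigr => k _; rewrite mulrBr.
  have UV0 : fine (U x) - fine (V x) = 0 by rewrite (UV Ex) subrr.
  suff h : (fun n => \sum_(k < n) c k * u (idx k) x - \sum_(k < n) c k * v (idx k) x)
      @ \oo --> fine (U x) - fine (V x) by rewrite UV0 in h.
  by apply: cvgB; exact: cvg_partial.
have PQ k i E' : measurable E' -> E' `<=` E ->
    (\int[kappa]_(t in A k i) p t E' = \int[kappa]_(t in A k i) q t E')%E.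
  move=> mE' E'E; have [_ _ ->//] := uP (k, i); have [_ _ ->//] := vP (k, i).
  apply: ae_eq_integral => //.
  - exact/measurable_EFinP/measurable_funTS.
  - exact/measurable_EFinP/measurable_funTS.
  - by move: uv_ae; apply: filterS => x + E'x; move=> ->//; exact: E'E.
have bound k i : (\int[kappa]_(t in A k i) L t E <=
    \int[kappa]_(t in A k i) (k.+1%:R^-1)%:E)%E.
  have ef0 x : (0 <= (f i x)%:E)%E by rewrite lee_fin; have /andP[] := f02 i x.
  have mef : measurable_fun setT (fun x => (f i x)%:E) by exact/measurable_EFinP.
  pose P := (\int[kappa]_(t in A k i) p t E)%E.
  have mI (r : T -> {measure set X -> \bar R})
      (mr : forall U, measurable U -> measurable_fun [set: T] (r ^~ U)) :
      measurable_fun [set: T] (fun t => \int[r t]_(x in E) (f i x)%:E)%E.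
    under eq_fun do rewrite integral_mkcond.
    apply: measurable_fun_integral_kernel => //.
    - by move=> x; rewrite patchE; case: ifP.
    - by apply/(measurable_restrict _ mE measurableT).1; exact: measurable_funTS.
  pose J (r : T -> {measure set X -> \bar R}) :=
    (\int[kappa]_(t in A k i) \int[r t]_(x in E) (f i x)%:E)%E.
  have JE (r : T -> {measure set X -> \bar R})
      (mr : forall U, measurable U -> measurable_fun [set: T] (r ^~ U)) :
      (\int[mixture mr (mrestr kappa (mA k i))]_(x in E) (f i x)%:E = J r)%E.
    rewrite ge0_integral_mixture_in// ge0_integral_mrestr//; first exact: mI.
    by move=> t; exact: integral_ge0.
  have mrE (r : T -> {measure set X -> \bar R})
      (mr : forall U, measurable U -> measurable_fun [set: T] (r ^~ U)) E' :
      measurable E' -> (mixture mr (mrestr kappa (mA k i)) E' =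
      \int[kappa]_(t in A k i) r t E')%E.
    by move=> mE'; rewrite [LHS]ge0_integral_mrestr//; exact: (mr _ mE').
  have Jpq : J p = J q.
    rewrite -(JE p mp) -(JE q mq); apply: eq_measure_integral => E' mE' E'E.
    by rewrite [LHS]mrE// [RHS]mrE// PQ.
  have P0 : (0 <= P)%E by exact: integral_ge0.
  have Pfin : (P \is a fin_num)%E.
    rewrite ge0_fin_numE//; have [_ _ uE] := uP (k, i).
    have := uE E mE; rewrite -/P => ->.
    apply: (@le_lt_trans _ _ (\int[theta]_(x in E) (cst 1 x))%E); last first.
      by rewrite integral_cst// mul1e ltey_eq fin_num_measure.
    apply: ge0_le_integral => //.
    - by move=> x _; rewrite lee_fin; have /andP[] := u01 (k, i) x.
    - exact/measurable_EFinP/measurable_funTS.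
    - by move=> x _; rewrite lee_fin; have /andP[] := u01 (k, i) x.
  have J0 : (0 <= J p)%E by apply: integral_ge0 => t _; exact: integral_ge0.
  have Jfin : (J p \is a fin_num)%E.
    rewrite ge0_fin_numE// -(JE p mp).
    apply: (@le_lt_trans _ _ (\int[mixture mp (mrestr kappa (mA k i))]_(x in E) (cst 2%:E x))%E).
      apply: ge0_le_integral => //; first exact: measurable_funTS.
      by move=> x _; rewrite lee_fin; have /andP[] := f02 i x.
    rewrite integral_cst// lte_mul_pinfty//.
    by rewrite [ltLHS](mrE p mp E mE) -/P -ge0_fin_numE.
  have LP : (\int[kappa]_(t in A k i) L t E = P + P)%E.
    under eq_integral do rewrite Lpq//.
    rewrite ge0_integralD//; last 2 first.
    - by apply: measurable_funTS; exact: mp.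
    - by apply: measurable_funTS; exact: mq.
    by rewrite -PQ.
  have : (\int[kappa]_(t in A k i) (p t E + p t E + \int[q t]_(x in E) (f i x)%:E) <=
      \int[kappa]_(t in A k i) ((k.+1%:R^-1)%:E + \int[p t]_(x in E) (f i x)%:E))%E.
    apply: ge0_le_integral => //.
    - by move=> t _; apply: adde_ge0; [rewrite adde_ge0|exact: integral_ge0].
    - apply: measurable_funTS; apply: emeasurable_funD; last exact: (mI q mq).
      by apply: emeasurable_funD; exact: mp.
    - by apply: measurable_funTS; apply: emeasurable_funD => //; exact: (mI p mp).
    - move=> t At; apply: pq_D => //; exact: subset_seqDU At.
  have mpE : measurable_fun (A k i) (p ^~ E) by apply: measurable_funTS; exact: mp.
  have mJp : measurable_fun (A k i) (fun t => \int[p t]_(x in E) (f i x)%:E)%E.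
    by apply: measurable_funTS; exact: (mI p mp).
  have mJq : measurable_fun (A k i) (fun t => \int[q t]_(x in E) (f i x)%:E)%E.
    by apply: measurable_funTS; exact: (mI q mq).
  have J_ge0 (r : T -> {measure set X -> \bar R}) t :
    A k i t -> (0 <= \int[r t]_(x in E) (f i x)%:E)%E by move=> _; exact: integral_ge0.
  have pp_ge0 t : A k i t -> (0 <= p t E + p t E)%E by rewrite adde_ge0.
  have mpp : measurable_fun (A k i) (fun t => p t E + p t E)%E by exact: emeasurable_funD.
  rewrite (ge0_integralD _ (mA k i) pp_ge0 mpp (J_ge0 q) mJq).
  have p_ge0 t : A k i t -> (0 <= p t E)%E by [].
  have k_ge0 t : A k i t -> (0 <= (k.+1%:R^-1)%:E :> \bar R)%E by rewrite lee_fin.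
  rewrite (ge0_integralD _ (mA k i) p_ge0 mpE p_ge0 mpE).
  rewrite (ge0_integralD _ (mA k i) k_ge0 (measurable_cst _) (J_ge0 p) mJp).
  rewrite -/P -[X in (_ + X <= _)%E]/(J q) -[X in (_ <= _ + X)%E]/(J p) -Jpq.
  by rewrite leeD2rE// LP.
have le_k k : (mixture mL kappa E <= (k.+1%:R^-1)%:E)%E.
  rewrite mLE -(cover_D k) seqDU_bigcup_eq.
  rewrite (ge0_integral_bigcup _ (mA k) _ _ (trivIset_seqDU _))//; last first.
    by apply: measurable_funTS; exact: mL.
  apply: (@le_trans _ _ (\sum_(i <oo) \int[kappa]_(t in A k i) (k.+1%:R^-1)%:E)%E).
    by apply: lee_nneseries => [i _ _|i _]; [exact: integral_ge0|exact: bound].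
  rewrite -(ge0_integral_bigcup _ (mA k) _ _ (trivIset_seqDU _))//.
  by rewrite -seqDU_bigcup_eq cover_D integral_cst//= probability_setT mule1.
apply/eqP; rewrite eq_le measure_ge0 andbT.
apply/lee_addgt0Pr => e e0; have [k ke] := exists_invS_le e0.
by rewrite add0e (le_trans (le_k k))// lee_fin.
Qed.

End cancellation_free_mixture.

(** * Barycenters and densities *)

Section charge_difference.
Context d (X : measurableType d) (R : realType).
Implicit Types (m : {finite_measure set X -> \bar R}).

Definition charge_difference m1 m2 : {charge set X -> \bar R} :=
  crestr0 (cadd (charge_of_finite_measure m1)
    (cscale (-1) (charge_of_finite_measure m2))) measurableT.

Lemma charge_differenceE m1 m2 A : measurable A ->
  charge_difference m1 m2 A = (m1 A - m2 A)%E.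
Proof.
move=> mA; rewrite /charge_difference/= /crestr0 mem_set// /crestr/= setIT.
by rewrite /cadd/= cscaleN1.
Qed.

Lemma charge_difference_out m1 m2 A : ~ measurable A ->
  charge_difference m1 m2 A = 0%E.
Proof. by move=> mA; rewrite /charge_difference/= /crestr0 memNset. Qed.

Let eq_difference (a b c e : \bar R) : a \is a fin_num -> b \is a fin_num ->
  c \is a fin_num -> e \is a fin_num -> (a - b = c - e -> a + e = c + b)%E.
Proof.
move=> /fineK<- /fineK<- /fineK<- /fineK<-; rewrite -!EFinB -!EFinD => -[h].
by congr EFin; lra.
Qed.

Lemma charge_integral_difference (nu : {charge set X -> \bar R}) m1 m2
    (f : X -> R) :
  (forall A, measurable A -> nu A = m1 A - m2 A)%E -> bounded_measurable f ->
  charge_integral nu [set: X] f = \int[m1]_x f x - \int[m2]_x f x.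
Proof.
move=> nuE bf.
have If m := bounded_measurable_integrable m measurableT bf.
have Rfin m : (\int[m]_x (f x)%:E \is a fin_num)%E 
  by have := integrable_fin_num measurableT (If m).
have : (\int[measure_add (pos_part nu) m2]_x (f x)%:E =
        \int[measure_add m1 (neg_part nu)]_x (f x)%:E)%E.
  apply: eq_measure_integral => A mA _.
  rewrite [LHS]measure_addE [RHS]measure_addE.
  apply: eq_difference; [exact: fin_num_measure..|].
  by rewrite -nuE// charge_jordanE.
rewrite !integral_measure_add//; [|exact: If..].
rewrite /charge_integral /Rintegral.
rewrite -(fineK (Rfin (pos_part nu))) -(fineK (Rfin (neg_part nu))).
rewrite -(fineK (Rfin m1)) -(fineK (Rfin m2)) -!EFinD => -[e].
by rewrite /=; lra.
Qed.

End charge_difference.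

Section Rintegral_mixture.
Context d d' (T : measurableType d) (X : measurableType d') (R : realType).
Variables (k : T -> {finite_measure set X -> \bar R})
  (mk : forall U, measurable U -> measurable_fun [set: T] (fun t => k t U))
  (lam : {measure set T -> \bar R}).
Hypothesis kfin : (mixture (k := fun t => k t) mk lam setT < +oo)%E.
Let m : {finite_measure set X -> \bar R} :=
  finite_measure_of (mu := mixture (k := fun t => k t) mk lam) kfin.
Implicit Type f : X -> R.

Let ge0_Rintegral_mixture f : bounded_measurable f -> (forall x, 0 <= f x) ->
  lam.-integrable setT (fun t => (\int[k t]_x f x)%:E) /\
  \int[lam]_t \int[k t]_x f x = \int[m]_x f x.
Proof.
move=> bf f0; have mEf : measurable_fun setT (EFin \o f) by apply/measurable_EFinP; exact: bf.1.
have kE : (fun t => (\int[k t]_x f x)%:E) = (fun t => \int[k t]_x (f x)%:E)%E.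
  by apply/funext => t; rewrite ge0_Rintegral_EFin.
have mixE : (\int[lam]_t \int[k t]_x (f x)%:E = \int[m]_x (f x)%:E)%E.
  by apply/esym; apply: (ge0_integral_mixture mk lam).
split.
  rewrite kE; apply/integrableP; split.
    exact: measurable_fun_integral_kernel.
  under eq_integral do 
    [rewrite gee0_abs; last by apply: integral_ge0 => x _; rewrite lee_fin].
  rewrite mixE; apply: (@integrable_lty _ _ _ m) => //.
  exact: bounded_measurable_integrable.
by rewrite /Rintegral kE mixE.
Qed.

Lemma Rintegral_mixture f : bounded_measurable f ->
  lam.-integrable setT (fun t => (\int[k t]_x f x)%:E) /\
  \int[lam]_t \int[k t]_x f x = \int[m]_x f x.
Proof.
move=> bf; have [_ [M fM]] := bf.
have bM := @bounded_measurable_cst _ X R M.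
have bfM : bounded_measurable (fun x => f x + M) by exact: bounded_measurableD.
have M0 (x : X) : 0 <= M by rewrite (le_trans _ (fM point)).
have fM0 x : 0 <= f x + M 
  by have := fM x; rewrite ler_norml -lerBlDr sub0r => /andP[].
have [I1 E1] := ge0_Rintegral_mixture bfM fM0.
have [I2 E2] := ge0_Rintegral_mixture bM M0.
have fE (n : {finite_measure set X -> \bar R}) :
    \int[n]_x f x = \int[n]_x (f x + M) - \int[n]_x M.
  rewrite -RintegralB//; [|exact: bounded_measurable_integrable..].
  by apply: eq_Rintegral => x _; rewrite addrK.
rewrite (_ : (fun t => (\int[k t]_x f x)%:E) = (fun t =>
    (\int[k t]_x (f x + M))%:E - (\int[k t]_x M)%:E)%E); last first.
  by apply/funext => t; rewrite fE EFinB.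
split; first exact: integrableB.
under eq_Rintegral do rewrite fE.
by rewrite RintegralB// E1 E2 -fE.
Qed.

End Rintegral_mixture.

Lemma charge_integral_mixture d d' (T : measurableType d)
    (X : measurableType d') (R : realType)
    (nu : T -> {charge set X -> \bar R})
    (mp : forall U, measurable U -> measurable_fun [set: T] (fun t => pos_part (nu t) U))
    (mq : forall U, measurable U -> measurable_fun [set: T] (fun t => neg_part (nu t) U))
    (lam : {measure set T -> \bar R}) (b : {charge set X -> \bar R})
    (f : X -> R) :
  (mixture (k := fun t => pos_part (nu t)) mp lam setT < +oo)%E ->
  (mixture (k := fun t => neg_part (nu t)) mq lam setT < +oo)%E ->
  (forall A, measurable A ->
    b A = mixture (k := fun t => pos_part (nu t)) mp lam A -
          mixture (k := fun t => neg_part (nu t)) mq lam A)%E ->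
  bounded_measurable f ->
  charge_integral b setT f = \int[lam]_t charge_integral (nu t) setT f.
Proof.
move=> pfin qfin bE bf.
rewrite (charge_integral_difference (m1 := finite_measure_of pfin)
  (m2 := finite_measure_of qfin))//.
have [Ip Ep] := Rintegral_mixture pfin bf.
have [Iq Eq] := Rintegral_mixture qfin bf.
by rewrite /charge_integral RintegralB// Ep Eq.
Qed.

Section signed_density.
Context d (X : measurableType d) (R : realType).
Implicit Types b mu : {charge set X -> \bar R}.

Let pos_set b : set X := (sval (hahn_sig b)).1.

Let measurable_pos_set b : measurable (pos_set b).
Proof. by have [[+ _] _ _ _] := svalP (hahn_sig b). Qed.

Let pos_part_setC b : pos_part b (~` pos_set b) = 0%E.
Proof.
rewrite [LHS]jordan_posE cjordan_posE /crestr0 mem_set; last exact: measurableC.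
by rewrite /crestr setICl charge0.
Qed.

Let neg_part_set b : neg_part b (pos_set b) = 0%E.
Proof.
rewrite [LHS]jordan_negE cjordan_negE /crestr0 mem_set; last first.
  exact: measurable_pos_set.
have [_ _ _ PN0] := svalP (hahn_sig b).
by rewrite /crestr [X in b X](_ : _ = set0) ?charge0 ?oppe0.
Qed.

Lemma le_abse_variation mu A : measurable A -> (`|mu A| <= variation mu A)%E.
Proof.
move=> mA; rewrite charge_jordanE// variationE (le_trans (lee_abs_sub _ _))//.
by rewrite !gee0_abs.
Qed.

Lemma signed_density b mu (B : set X) : measurable B ->
  (forall E, measurable E -> variation b E = 0%E ->
    variation mu (E `\` B) = 0%E) ->
  exists g : X -> R, [/\ measurable_fun setT g, forall x, B x -> g x = 0,
    (\int[variation b]_x `|g x|%:E < +oo)%E &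
    forall E, measurable E ->
      mu E = (mu (E `&` B) + (charge_integral b (E `\` B) g)%:E)%E].
Proof.
move=> mB dom; have mCB := measurableC mB.
pose muC : {charge set X -> \bar R} := crestr0 mu mCB.
have muCE A : measurable A -> muC A = mu (A `\` B).
  by move=> mA; rewrite /muC/= /crestr0 mem_set// /crestr setDE.
have muC_dom : muC `<< variation b.
  apply/null_content_dominatesP => A mA bA0; rewrite muCE//.
  have mAB : measurable (A `\` B) by exact: measurableD.
  apply/eqP; rewrite -abse_eq0 eq_le abse_ge0 andbT.
  by rewrite (le_trans (le_abse_variation mu mAB))// dom.
pose f := Radon_Nikodym muC (variation b).
have f_fin x : f x \is a fin_num by exact: Radon_Nikodym_fin_num.
have f_int : (variation b).-integrable setT f by exact: Radon_Nikodym_integrable.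
have fE A : measurable A -> mu (A `\` B) = (\int[variation b]_(x in A) f x)%E.
  by move=> mA; rewrite -muCE//; exact: Radon_Nikodym_integral.
pose P := pos_set b.
have mP : measurable P := measurable_pos_set b.
pose sg x : R := \1_P x - \1_(~` P) x.
pose g x : R := \1_(~` B) x * (sg x * fine (f x)).
have sgP x : P x -> sg x = 1.
  by move=> Px; rewrite /sg !indicE mem_set// memNset ?subr0//; exact/not_notP.
have sgN x : ~ P x -> sg x = -1.
  by move=> Px; rewrite /sg !indicE memNset// mem_set// sub0r.
have sg1 x : `|sg x| = 1.
  by have [/sgP ->|/sgN ->] := pselect (P x); rewrite ?normrN1 ?normr1.
have mff : measurable_fun setT (fine \o f).
  by apply: measurableT_comp => //; have /measurable_int := f_int.
have mg : measurable_fun setT g.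
  apply: measurable_funM => //; apply: measurable_funM => //.
  by apply: measurable_funB; apply: measurable_indic => //; exact: measurableC.
exists g; split=> //.
- by move=> x Bx; rewrite /g indicE memNset ?mul0r//=.
- suff /integrableP[] : (variation b).-integrable setT (EFin \o g) by [].
  apply: (le_integrable measurableT _ _ f_int); first exact/measurable_EFinP.
  move=> x _; rewrite -(fineK (f_fin x)) /= lee_fin /g !normrM sg1 mul1r.
  by rewrite ler_piMl// indicE ger0_norm// lern1 leq_b1.
move=> E mE; have mEB : measurable (E `\` B) by exact: measurableD.
rewrite (charge_partition mu mE mB mCB) ?setUv ?setICr// -setDE.
congr (_ + _)%E; have := fE _ mEB; rewrite setDDl setUid => ->.
have gE x : (E `\` B) x -> (g x)%:E = ((sg x)%:E * f x)%E.
  move=> [_ nBx]; rewrite /g indicE mem_set// mul1r EFinM fineK//.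
have gP x : (E `\` B) x -> P x -> (g x)%:E = f x.
  by move=> Dx Px; rewrite gE// sgP// mul1e.
have gN x : (E `\` B) x -> ~ P x -> (g x)%:E = (-1%:E * f x)%E.
  by move=> Dx Px; rewrite gE// sgN// EFinN.
have mf D : measurable_fun D f.
  by apply: measurable_funTS; have /measurable_int := f_int.
have part_int (m : {measure set X -> \bar R}) :
    (forall h : X -> \bar R, (forall x, 0 <= h x)%E -> measurable_fun setT h ->
      \int[m]_x h x <= \int[variation b]_x h x)%E -> m.-integrable (E `\` B) f.
  move=> m_le; apply: (integrableS measurableT) => //; apply/integrableP; split=> //.
  rewrite (le_lt_trans (m_le _ _ _))//; first exact: measurableT_comp.
  by have /integrableP[] := f_int.
have Ip : (pos_part b).-integrable (E `\` B) f.
  by apply: part_int => h h0 mh; rewrite integral_variation// leeDl// integral_ge0.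
have In : (neg_part b).-integrable (E `\` B) f.
  by apply: part_int => h h0 mh; rewrite integral_variation// leeDr// integral_ge0.
have mgD : measurable_fun (E `\` B) (EFin \o g).
  by apply/measurable_EFinP; exact: measurable_funTS.
have Ep : (\int[pos_part b]_(x in E `\` B) (g x)%:E =
    \int[pos_part b]_(x in E `\` B) f x)%E.
  apply: ae_eq_integral => //; exists (~` P); split.
  - exact: measurableC.
  - exact: pos_part_setC.
  - by move=> x /= h Px; apply: h => Dx; exact: gP.
have En : (\int[neg_part b]_(x in E `\` B) (g x)%:E =
    - \int[neg_part b]_(x in E `\` B) f x)%E.
  rewrite -mulN1e -integralZl//; apply: ae_eq_integral => //.
    by apply: measurable_funeM.
  exists P; split => //; first exact: neg_part_set.
  by move=> x /= h; apply: contrapT => Px; apply: h => Dx; exact: gN.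
have pfin := integrable_fin_num mEB Ip.
have nfin := integrable_fin_num mEB In.
rewrite /charge_integral /Rintegral Ep En fineN opprK EFinD !fineK//.
rewrite -integral_measure_add//; apply: eq_measure_integral => A mA _.
by rewrite [RHS]measure_addE.
Qed.

End signed_density.

Lemma norming_defect_rearrange (R : realDomainType) (p q hp hq v i e : R) :
  v - i <= e -> p + q <= hp - hq + (v - i) -> p + p + (q + hq) <= e + (p + hp).
Proof. lra. Qed.

Section dominating_barycenter.
Context (R : realType) (X : ptopologicalType).
Context (N : set (signed_measure R X)) (N0 : N !=set0).
Local Notation Y := (nonempty_subspace N0).
Local Notation T := (baire R Y).
Local Notation nu_ := (@measure_at R X N N0).
Variable h : nat -> X -> R.
Hypothesis h_cont : forall n, continuous (h n).
Hypothesis h_le1 : forall n x, `|h n x| <= 1.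
Hypothesis norm_h : forall nu, N nu -> variation_norm nu =
  ereal_sup (range (fun n => (pairing nu (h n))%:E)).

Let mV := measurable_variation_at (N0 := N0) h_cont h_le1 norm_h.
Let mP := measurable_pos_part_at (N0 := N0) h_cont h_le1 norm_h.
Let mQ := measurable_neg_part_at (N0 := N0) h_cont h_le1 norm_h.

Let near_norming n k : set T := [set t | fine (variation (nu_ t) setT) -
  pairing (nu_ t) (h n) <= k.+1%:R^-1].

Let measurable_near_norming n k : measurable (near_norming n k).
Proof.
have mf : measurable_fun [set: T] (fun t : T =>
    fine (variation (nu_ t) setT) - pairing (nu_ t) (h n)).
  apply: measurable_funB.
    by apply: measurableT_comp => //; exact: (mV measurableT).
  apply: (continuous_baire_measurable (Y := Y)).
  exact: continuous_pairing_at (h_bounded_continuous h_cont h_le1 n).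
have := mf measurableT `]-oo, k.+1%:R^-1]%classic (measurable_itv _).
by rewrite setTI; congr measurable; apply/seteqP; split => t /=; rewrite in_itv.
Qed.

Let near_norming_cover k : \bigcup_n near_norming n k = setT.
Proof.
apply/seteqP; split=> // t _.
have [_ /(_ k.+1%:R^-1)] := variation_norm_sup norm_h (measure_at_in t).
rewrite invr_gt0 ltr0n => /(_ isT)[n hn]; exists n => //=.
by rewrite /near_norming/= lerBlDr -lerBlDl ltW.
Qed.

(* [1 + h n] instead of [h n]: nonnegative integrands can be integrated in
   [\bar R] without integrability conditions. *)
Let h0 n (x : baire R X) := 1 + h n x.

Let integral_h0 (m : {finite_measure set (baire R X) -> \bar R}) n
    (E : set (baire R X)) : measurable E ->
  (\int[m]_(x in E) (h0 n x)%:E =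
   (fine (m E) + \int[m]_x (h n x * \1_E x))%:E)%E.
Proof.
move=> mE.
have bh := bounded_continuous_bm (h_bounded_continuous h_cont h_le1 n).
have b1 := @bounded_measurable_indic _ (baire R X) R E mE.
have bh1 := bounded_measurableM bh b1.
have -> : fine (m E) = \int[m]_x (\1_E x : R).
  by rewrite /Rintegral integral_indic// setIT.
rewrite -RintegralD//; try exact: bounded_measurable_integrable.
rewrite ge0_Rintegral_EFin//; last exact: bounded_measurableD.
rewrite integral_mkcond; apply: eq_integral => x _; rewrite patchE indicE.
by case: ifPn => xE; rewrite ?mulr1 ?mulr0 ?addr0.
Qed.

Let near_norming_le n k t E : near_norming n k t -> measurable E ->
  (pos_part (nu_ t) E + pos_part (nu_ t) E +
     \int[neg_part (nu_ t)]_(x in E) (h0 n x)%:E <=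
   k.+1%:R^-1%:E + \int[pos_part (nu_ t)]_(x in E) (h0 n x)%:E)%E.
Proof.
move=> tD mE; rewrite !integral_h0//.
have bh := bounded_continuous_bm (h_bounded_continuous h_cont h_le1 n).
have b1 := @bounded_measurable_indic _ (baire R X) R E mE.
have i01 (x : baire R X) : 0 <= (\1_E x : R) <= 1.
  by rewrite indicE ler0n lern1 leq_b1.
have := variation_le_charge_integral (nu_ t) bh b1 (h_le1 n) i01.
rewrite Rintegral_variation// /Rintegral !integral_indic// setIT.
have pfin : pos_part (nu_ t) E \is a fin_num by rewrite fin_num_measure.
rewrite -[X in (X + X + _ <= _)%E](fineK pfin) -!EFinD lee_fin.
move: tD; rewrite /near_norming/= /pairing /charge_integral.
exact: norming_defect_rearrange.
Qed.

Lemma dominating_barycenter (kappa : probability T R) :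
  (\int[kappa]_t variation (nu_ t) setT < +oo)%E ->
  exists (lam : probability T R) (b : signed_measure R X),
    [/\ is_barycenter lam b, (\int[lam]_t variation (nu_ t) setT < +oo)%E &
      forall E, measurable E -> variation b E = 0%E ->
        mixture mV kappa E = 0%E].
Proof.
move=> kappa_oo.
have LPQ (t : T) (U : set (baire R X)) : measurable U ->
    variation (nu_ t) U = (pos_part (nu_ t) U + neg_part (nu_ t) U)%E.
  by move=> _; rewrite variationE.
have pV (t : T) (U : set (baire R X)) : measurable U ->
    (pos_part (nu_ t) U <= variation (nu_ t) U)%E.
  by move=> mU; rewrite LPQ// leeDl.
have qV (t : T) (U : set (baire R X)) : measurable U ->
    (neg_part (nu_ t) U <= variation (nu_ t) U)%E.
  by move=> mU; rewrite LPQ// leeDr.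
have mh0 i : measurable_fun setT (h0 i).
  apply: measurable_funD => //.
  by have [] := bounded_continuous_bm (h_bounded_continuous h_cont h_le1 i).
have h02 i x : 0 <= h0 i x <= 2.
  have := h_le1 i x; rewrite ler_norml => /andP[h1 h2].
  by rewrite /h0 -lerBlDl sub0r h1 -natr1 addrC lerD2r.
have [lam [lam_oo lamP]] := @cancellation_free_mixture _ _ T (baire R X) R
  (fun t => pos_part (nu_ t)) (fun t => neg_part (nu_ t))
  (fun t => variation (nu_ t)) mP mQ mV LPQ h0 near_norming mh0 h02
  measurable_near_norming near_norming_cover near_norming_le kappa kappa_oo.
pose mixP := mixture (k := fun t : T => pos_part (nu_ t)) mP lam.
pose mixQ := mixture (k := fun t : T => neg_part (nu_ t)) mQ lam.
have pfin : (mixP setT < +oo)%E.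
  apply: le_lt_trans lam_oo; apply: ge0_le_integral => //; [exact: mP|exact: mV|].
  by move=> t _; exact: pV.
have qfin : (mixQ setT < +oo)%E.
  apply: le_lt_trans lam_oo; apply: ge0_le_integral => //; [exact: mQ|exact: mV|].
  by move=> t _; exact: qV.
pose b : signed_measure R X := SignedMeasure (@charge_difference_out _ _ _
  (finite_measure_of pfin) (finite_measure_of qfin)).
have bE E : measurable E -> b E = (mixP E - mixQ E)%E.
  by move=> mE; rewrite [LHS]charge_differenceE.
exists lam, b; split=> //.
  move=> f bf; rewrite /pairing.
  rewrite (charge_integral_mixture (nu := fun t : T => charge_of (nu_ t)) pfin qfin bE)//.
  exact: bounded_continuous_bm.
move=> E mE bE0; apply: lamP => // E' mE' E'E.
have : b E' = 0%E.
  apply/eqP; rewrite -abse_eq0 eq_le abse_ge0 andbT.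
  rewrite (le_trans (le_abse_variation b mE'))// -bE0.
  by apply: le_measure; rewrite ?inE.
rewrite bE// => /eqP; rewrite sube_eq ?add0e; first by move/eqP.
  exact: (fin_num_measure (finite_measure_of pfin)).
by rewrite fin_num_adde_defr.
Qed.

End dominating_barycenter.

Theorem theorem12 (R : realType) (X : ptopologicalType)
    (N : set (signed_measure R X)) (N0 : N !=set0) (aN : analytic R N)
    (normN : exists H : set (X -> R),
      [/\ countable H,
          forall h, H h -> continuous h /\ (forall x, -1 <= h x <= 1) &
          forall nu, N nu ->
            variation_norm nu =
            ereal_sup [set (pairing nu h)%:E | h in H]])
    (mu : signed_measure R X) :
  exists (g : baire R X -> R) (B : set (baire R X))
      (lam : probability (baire R (nonempty_subspace N0)) R)
      (lam_hat : signed_measure R X),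
    (measurable_fun [set: baire R X] g /\ measurable B /\
     is_barycenter lam lam_hat) /\
    [/\ (\int[lam]_nu variation_norm (set_val (nu : nonempty_subspace N0)) < +oo)%E,
        forall x, B x -> g x = 0,
        (\int[charge_total_variation lam_hat]_x `|g x|%:E < +oo)%E,
        forall nu, N nu -> charge_total_variation nu B = 0%E &
        forall E : set (baire R X), measurable E ->
          mu E = (mu (E `&` B) +
                  (charge_integral lam_hat (E `\` B) g)%:E)%E].
Proof.
have [P [phi [polishP usco_phi N_phi]]] := aN.
have [H [H_count H_bound norm_H]] := normN.
have H0 : H !=set0.
  have [nu Nnu] := N0; apply/set0P/negP => /eqP H0.
  have := norm_H nu Nnu; rewrite H0 image_set0 ereal_sup0 => vE.
  by have := measure_ge0 (variation nu) setT; rewrite [leRHS]vE.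
have [h [Hh h_surj]] := countable_enumeration H_count H0.
have h_cont n : continuous (h n) by exact: (H_bound _ (Hh n)).1.
have h_le1 n x : `|h n x| <= 1 by rewrite ler_norml; exact: (H_bound _ (Hh n)).2.
have norm_h nu : N nu -> variation_norm nu =
    ereal_sup (range (fun n => (pairing nu (h n))%:E)).
  move=> /norm_H ->; congr ereal_sup; apply/seteqP; split.
    by move=> _ [f /h_surj[n <-] <-]; exists n.
  by move=> _ [n _ <-]; exists (h n).
pose mV := measurable_variation_at (N0 := N0) h_cont h_le1 norm_h.
pose t0 : baire R (nonempty_subspace N0) := point.
have dirac_oo : (\int[\d_t0]_t variation (@measure_at R X N N0 t) setT < +oo)%E.
  rewrite [ltLHS](integral_dirac t0 measurableT (mV _ measurableT)).
  by rewrite diracT mul1e ltey_eq fin_num_measure.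
have [kappa [S [kappa_oo S0 S_max S_min]]] :=
  @exhaustion _ _ (baire R (nonempty_subspace N0)) (baire R X) R
  (fun t => variation (@measure_at R X N N0 t)) mV (variation mu) \d_t0 dirac_oo.
have mS := S0.1.
have m_oo : (mrestr (variation mu) mS setT < +oo)%E.
  by rewrite -[ltLHS]/(variation mu (setT `&` S)) setTI ltey_eq fin_num_measure.
have [B [mB muB NB]] : exists B : set (baire R X), [/\ measurable B,
    finite_measure_of m_oo (~` B) = 0%E & forall nu, N nu -> variation nu B = 0%E].
  apply: (singular_null_set (N0 := N0) h_cont h_le1 norm_h polishP usco_phi N_phi).
  move=> kappa' /S_min[E [nE muE]]; exists E; split; [exact: nE.1| |exact: nE.2].
  by rewrite -muE setDE setIC.
have [lam [b [bary lam_oo b_dom]]] :=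
  dominating_barycenter h_cont h_le1 norm_h kappa_oo.
have mBS : measurable (B `&` S) by exact: measurableI.
have [E mE bE0|g [mg g0 g_oo gE]] := @signed_density _ (baire R X) R b mu _ mBS.
  have EB : E `\` (B `&` S) `<=` (E `\` S) `|` (S `\` B).
    move=> x [Ex nBS]; have [Sx|nSx] := pselect (S x); last by left.
    by right; split=> // Bx; apply: nBS.
  have m1 : measurable (E `\` S) by exact: measurableD.
  have m2 : measurable (S `\` B) by exact: measurableD.
  apply/eqP; rewrite eq_le measure_ge0 andbT.
  apply: (le_trans (le_measure (variation mu) _ _ EB)); rewrite ?inE.
  - by apply: measurableD.
  - exact: measurableU.
  rewrite (le_trans (measureU2 _ m1 m2))//.
  rewrite [X in (X + _ <= _)%E]S_max ?add0e; last by split=> //; exact: b_dom.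
  by rewrite setDE setIC -[X in (X <= _)%E]/(finite_measure_of m_oo (~` B)) muB.
exists g, (B `&` S), lam, b; split=> //; split=> // nu Nnu.
apply/eqP; rewrite eq_le measure_ge0 andbT -(NB nu Nnu).
by apply: (le_measure (variation nu)); rewrite ?inE//; exact: subIsetl.
Qed.
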